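(* Let $F$ be a field of characteristic $2$. Let $B$ be an anisotropic bilinear form over $F$ of dimension $5$, and let $Q=\langle1,a,b\rangle$ be an anisotropic totally singular quadratic form over $F$ of dimension $3$. Then the following statements are equivalent: (1) $B$ is $F(Q)$-minimal. (2) There exist $c\in F^*$ and a bilinear form $C$ over $F$ of dimension $5$ which is a strong Pfister neighbor of the bilinear Pfister form $\langle\langle a,b,c\rangle\rangle_b$ and satisfies the two conditions: (i) $\widetilde B\simeq\widetilde C$; (ii) for any nonzero $u,v\in F^2(a,b)$ such that $\langle u,v,uv\rangle_b$ is similar to a subform of $\langle\langle a,b,c\rangle\rangle_b$, the invariant $e^2(C\perp\langle\det C\rangle_b\perp\langle\langle u,v\rangle\rangle_b+I^3F)$ has length $2$.
   Context: $F$ is a field of characteristic $2$, $F^*=F\setminus\{0\}$. Bilinear forms are symmetric and nondegenerate; a bilinear form $B$ is isotropic if $B(v,v)=0$ for some $v\ne0$. $\langle c_1,\dots,c_s\rangle$ is the totally singular quadratic form $\sum c_iz_i^2$; $\langle a_1,\dots,a_n\rangle_b$ (with $a_i\in F^*$) is the diagonal bilinear form $\sum a_ix_iy_i$; $\perp$ is orthogonal sum, $\simeq$ isometry. Two forms are similar if one is isometric to a nonzero scalar multiple of the other; $C\subset B$ ($C$ is a subform of $B$) if $B\simeq C\perp C'$ for some form $C'$. $F(Q)$ is the quotient field of $F[x,y,z]/(x^2+ay^2+bz^2)$. $F^2(a,b)$ is the subfield of $F$ generated by $F^2=\{x^2\mid x\in F\}$ and $a,b$. For a bilinear form $B$ on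 $V$, $\widetilde B$ is the totally singular quadratic form on $V$ given by $\widetilde B(v)=B(v,v)$. Minimality: for a field extension $K/F$, an anisotropic bilinear form $B$ over $F$ is $K$-minimal if $B_K$ is isotropic and every subform of $B$ of dimension $<\dim B$ remains anisotropic over $K$. $\langle\langle a_1,\dots,a_n\rangle\rangle_b=\langle1,a_1\rangle_b\otimes\cdots\otimes\langle1,a_n\rangle_b$ is an $n$-fold bilinear Pfister form. A bilinear form $C$ is a strong Pfister neighbor of a bilinear Pfister form $\rho$ if $2\dim C>\dim\rho$ and $\alpha C\subset\rho$ for some $\alpha\in F^*$. $\det C$ is the determinant of $C$, taken in $F^*/F^{*2}$ (any representative in $F^*$ may be used). $W(F)$ is the Witt ring of nondegenerate symmetric bilinear forms, $IF$ its fundamental ideal (classes of even-dimensional forms), $I^nF=(IF)^n$. $\nu_F(2)$ is the additive subgroup of $\Omega^2_F$ (absolute Kähler differential $2$-forms of $F$) generated by the logarithmic symbols $\frac{da_1}{a_1}\wedge\frac{da_2}{a_2}$, $a_1,a_2\in F^*$. Kato's isomorphism $e^2:I^2F/I^3F\to\nu_F(2)$ is given on generators by $e^2(\langle\langle a_1,a_2\rangle\rangle_b+I^3F)=\frac{da_1}{a_1}\wedge\frac{da_2}{a_2}$. The length of an element of $\nu_F(2)$ is the smallest number of logarithmic symbols $\frac{da_1}{a_1}\wedge\frac{da_2}{a_2}$ whose sum is that element. *)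

(* Defs.v *)
From HB Require Import structures.
From mathcomp Require Import all_boot all_order all_algebra.
From mathcomp Require Import boolp mxtens freeg mpoly ring.

Set Implicit Arguments.
Unset Strict Implicit.
Unset Printing Implicit Defensive.

Import GRing.Theory.
Local Open Scope ring_scope.
Local Open Scope quotient_scope.

Section Forms.
Variable F : fieldType.

(* The Gram matrix of a form on F^bdim with respect to the standard basis;
   symmetry and nondegeneracy are imposed separately by [bilinear_form]. *)
Record bform := BForm { bdim : nat; gram : 'M[F]_bdim }.
Implicit Types B C M : bform.

Definition bilinear_form B := (gram B)^T = gram B /\ gram B \in unitmx.

Definition qform n := 'rV[F]_n -> F.

Definition tilde B : qform (bdim B) := fun v => (v *m gram B *m v^T) 0 0.
Arguments tilde : clear implicits.

Definition totally_singular (c : seq F) : qform (size c) :=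
  fun z => \sum_(i < size c) c`_i * z 0 i ^+ 2.
Arguments totally_singular : clear implicits.

Definition qanisotropic n (q : qform n) := forall v, q v = 0 -> v = 0.

Definition qisometric m n (q : qform m) (q' : qform n) :=
  exists2 P : 'M[F]_(m, n), row_free P && row_full P
    & forall v, q v = q' (v *m P).

Definition isotropic B := exists2 v : 'rV[F]_(bdim B), v != 0 & tilde B v = 0.
Definition anisotropic B := ~ isotropic B.

Definition isometric B C :=
  exists2 P : 'M[F]_(bdim B, bdim C), row_free P && row_full P
    & gram B = P *m gram C *m P^T.

Definition orth B C := BForm (block_mx (gram B) 0 0 (gram C)).
Definition bzero := BForm (0 : 'M[F]_0).
Definition orths (s : seq bform) := foldr orth bzero s.
Definition tensor B C := BForm (gram B *t gram C).
Definition bscale (k : F) B := BForm (k *: gram B).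
Definition diagb (s : seq F) := BForm (diag_mx (\row_(i < size s) s`_i)).
Definition pfister (s : seq F) :=
  foldr (fun a rho => tensor (diagb [:: 1; a]) rho) (diagb [:: 1]) s.

Definition similar_forms B C := exists2 k, k != 0 & isometric B (bscale k C).

Definition subform C B := bilinear_form C /\
  exists C', bilinear_form C' /\ isometric B (orth C C').

Definition strong_neighbor C rho :=
  [/\ bilinear_form C, (bdim rho < 2 * bdim C)%N
    & exists2 alpha, alpha != 0 & subform (bscale alpha C) rho].

Definition metabolic M := bilinear_form M /\
  exists r (W : 'M[F]_(r, bdim M)),
    [/\ row_free W, W *m gram M *m W^T = 0 & bdim M = r.*2].

(* Equality of classes in W(F).  In characteristic 2 the forms of class 0 are
   the metabolic ones, not only the hyperbolic ones. *)
Definition witt_equiv B C := exists M M',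
  [/\ metabolic M, metabolic M' & isometric (orth B M) (orth C M')].

(* [in_Ipow n B]: the class of B lies in I^n F.  No clause for opposites is
   needed, since -[B][C] = [-B][C] and -B is again even-dimensional. *)
Inductive in_Ipow : nat -> bform -> Prop :=
| Ipow_all B : bilinear_form B -> in_Ipow 0 B
| Ipow_mul n B C : bilinear_form B -> ~~ odd (bdim B) ->
    in_Ipow n C -> in_Ipow n.+1 (tensor B C)
| Ipow_zero n : in_Ipow n bzero
| Ipow_add n B C : in_Ipow n B -> in_Ipow n C -> in_Ipow n (orth B C)
| Ipow_witt n B C : bilinear_form C -> witt_equiv B C ->
    in_Ipow n B -> in_Ipow n C.

Inductive subfield_gen (S : F -> Prop) : F -> Prop :=
| subfield_in x : S x -> subfield_gen S x
| subfield_1 : subfield_gen S 1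
| subfield_B x y : subfield_gen S x -> subfield_gen S y ->
    subfield_gen S (x - y)
| subfield_M x y : subfield_gen S x -> subfield_gen S y ->
    subfield_gen S (x * y)
| subfield_V x : subfield_gen S x -> subfield_gen S x^-1.

Definition in_F2 (a b : F) : F -> Prop :=
  subfield_gen (fun x => (exists y, x = y ^+ 2) \/ x = a \/ x = b).

End Forms.
Arguments tilde {F} B.
Arguments totally_singular {F} c.

Definition bext (F K : fieldType) (iota : {rmorphism F -> K}) (B : bform F) :=
  BForm (map_mx iota (gram B)).

Definition minimal (F K : fieldType) (iota : {rmorphism F -> K})
    (B : bform F) :=
  [/\ bilinear_form B, anisotropic B, isotropic (bext iota B)
    & forall C, subform C B -> (bdim C < bdim B)%N ->
        anisotropic (bext iota C)].

Section FunctionField.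
Variables (F : fieldType) (a b : F).

Definition Qpoly : {mpoly F[3]} :=
  let x := 'X_(inord 0) in let y := 'X_(inord 1) in let z := 'X_(inord 2) in
  x ^+ 2 + a *: y ^+ 2 + b *: z ^+ 2.

(* (K, iota) is a quotient field of F[x,y,z]/(x^2+ay^2+bz^2): ev induces an
   embedding of this ring into K, and every element of K is a fraction. *)
Definition is_function_field (K : fieldType) (iota : {rmorphism F -> K}) :=
  exists ev : {rmorphism {mpoly F[3]} -> K},
    [/\ forall c, ev c%:MP = iota c,
        forall p, ev p = 0 <-> exists q, p = q * Qpoly
      & forall w, exists p q, ev q != 0 /\ w = ev p / ev q].

End FunctionField.

(* For <1,a,b> anisotropic the ring F[x,y,z]/(x^2+ay^2+bz^2) is a domain, so
   a pair (K, iota) as above exists. *)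
Module FunctionFieldExistence.

Lemma fracE (R : idomainType) (x : {fraction R}) :
  exists n m : R, m != 0 /\ x = tofrac n / tofrac m.
Proof.
exists (repr x).1, (repr x).2; split; first exact: denom_ratioP.
have m0 : tofrac (repr x).2 != 0 by rewrite tofrac_eq0 denom_ratioP.
apply: (mulIf m0); rewrite divfK // -{1}[x]reprK; unlock tofrac.
rewrite -[LHS](FracField.pi_mul (repr x)); apply/eqmodP => /=.
rewrite FracField.equivfE /FracField.mulf !numden_Ratio ?mulr1 ?oner_eq0 //.
all: by rewrite ?denom_ratioP 1?mulrC.
Qed.

Section Existence.
Variables (F : fieldType) (a b : F).
Hypothesis charF2 : 2%N \in [pchar F].
Hypothesis anisoQ : qanisotropic (totally_singular [:: 1; a; b]).

Local Notation P3 := {mpoly F[3]}.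
Local Notation q := (Qpoly a b).
Local Notation X i := ('X_(inord i) : P3).

Lemma mpoly_gen_ind n (S : {mpoly F[n]} -> Prop) :
  (forall c, S c%:MP) -> (forall i, S 'X_i) ->
  (forall f g, S f -> S g -> S (f + g)) ->
  (forall f g, S f -> S g -> S (f * g)) -> forall f, S f.
Proof.
move=> SC SX SD SM f; rewrite (mpolyE f).
apply: (big_ind S) => [|//|m _]; first by rewrite -mpolyC0.
rewrite -mul_mpolyC; apply: (SM) => //; rewrite mpolyXE_id.
apply: (big_ind S) => [|//|i _]; first by rewrite -mpolyC1.
elim: (m i) => [|k IHk]; first by rewrite expr0 -mpolyC1.
by rewrite exprS; apply: (SM).
Qed.

Lemma pcharP3 : 2%N \in [pchar P3].
Proof. exact: (rmorph_pchar (@mpolyC 3 F)). Qed.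

Lemma sqrD_P3 (f g : P3) : (f + g) ^+ 2 = f ^+ 2 + g ^+ 2.
Proof. exact: (pFrobenius_autD_comm pcharP3 (mulrC f g)). Qed.

Lemma coef_sqr (f : P3) m : (f ^+ 2)@_(m + m) = f@_m ^+ 2.
Proof.
have -> : f ^+ 2 = \sum_(k <- msupp f) (f@_k ^+ 2 *: 'X_[k + k]).
  rewrite [in LHS](mpolyE f).
  rewrite (big_morph (fun x : P3 => x ^+ 2) sqrD_P3 (expr0n _ _)).
  by apply: eq_bigr => k _; rewrite exprZn mpolyXD expr2 -expr2.
rewrite raddf_sum /=.
under eq_bigr => k _ do rewrite mcoeffZ mcoeffX.
have inj k : (k + k == m + m)%MM = (k == m).
  apply/eqP/eqP => [/mnmP e|-> //]; apply/mnmP => i.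
  by have := e i; rewrite !mnmDE !addnn => /double_inj.
under eq_bigr => k _ do rewrite inj.
have [hm|hm] := boolP (m \in msupp f).
  rewrite (bigD1_seq m) ?msupp_uniq //= eqxx mulr1 big1 ?addr0 // => k /negPf ->.
  by rewrite mulr0.
rewrite big_seq big1 ?(memN_msupp_eq0 hm) ?expr0n // => k hk.
by case: eqVneq hk hm => [->|]; rewrite ?mulr0 // => ->.
Qed.

Lemma aniso_P3 (f g h : P3) :
  f ^+ 2 + a *: g ^+ 2 + b *: h ^+ 2 = 0 -> f = 0 /\ g = 0.
Proof.
move=> e; suff H m : f@_m = 0 /\ g@_m = 0.
  by split; apply/mpolyP => m; rewrite mcoeff0; case: (H m).
have /(congr1 (mcoeff (m + m))) := e.
rewrite !mcoeffD !mcoeffZ !coef_sqr mcoeff0 => em.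
have /anisoQ/rowP v0 : totally_singular [:: 1; a; b]
    (\row_(i < 3) [:: f@_m; g@_m; h@_m]`_i) = 0.
  by rewrite /totally_singular !big_ord_recl big_ord0 !mxE /= mul1r addr0 addrA.
split; first by have := v0 (@Ordinal 3 0 isT); rewrite !mxE.
by have := v0 (@Ordinal 3 1 isT); rewrite !mxE.
Qed.

(* phi is f(x,y,z) |-> f^2 with x^2 replaced by ay^2+bz^2; its kernel is (q). *)
Definition sq (c : F) : P3 := (pFrobenius_aut charF2 c)%:MP.
HB.instance Definition _ := GRing.RMorphism.copy sq
  (@mpolyC 3 F \o pFrobenius_aut charF2).
Definition w : P3 := a *: X 1 ^+ 2 + b *: X 2 ^+ 2.
Definition phi : P3 -> P3 :=
  mmap sq (fun i => if i == 0%N :> nat then w else 'X_i ^+ 2).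
HB.instance Definition _ := GRing.RMorphism.on phi.

Lemma phiC c : phi c%:MP = c%:MP ^+ 2.
Proof. by rewrite /phi mmapC; exact: (rmorphXn (@mpolyC 3 F)). Qed.

Lemma phiX (i : 'I_3) : phi 'X_i = if i == 0%N :> nat then w else 'X_i ^+ 2.
Proof. by rewrite /phi mmapX mmap1U. Qed.

Lemma phi_w : phi w = w ^+ 2.
Proof.
rewrite /w -!mul_mpolyC rmorphD !rmorphM /= !phiC !phiX.
by rewrite !inordK //= sqrD_P3 !exprMn -!expr2.
Qed.

Lemma addrr_P3 (f : P3) : f + f = 0.
Proof. exact: (addrr_pchar2 pcharP3). Qed.

Lemma qE : q = X 0 ^+ 2 + w.
Proof. by rewrite /Qpoly /w addrA. Qed.

Lemma phi_q : phi q = 0.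
Proof. by rewrite qE rmorphD rmorphXn /= phi_w phiX inordK //= addrr_P3. Qed.

Lemma reduce (f : P3) : exists f0 f1 h,
  [/\ phi f0 = f0 ^+ 2, phi f1 = f1 ^+ 2 & f = f0 + f1 * X 0 + h * q].
Proof.
elim/mpoly_gen_ind: f => [c|i|f g|f g].
- by exists c%:MP, 0, 0; rewrite phiC rmorph0 expr0n !mul0r !addr0.
- case: (eqVneq (i : nat) 0%N) => hi.
    exists 0, 1, 0; rewrite rmorph0 rmorph1 expr0n expr1n mul0r addr0 mul1r add0r.
    by split => //; congr 'X_ _; apply: val_inj; rewrite /= inordK.
  exists 'X_i, 0, 0; rewrite phiX (negPf hi) rmorph0 expr0n.
  by rewrite !mul0r !addr0.
- move=> [f0 [f1 [h [e0 e1 ->]]]] [g0 [g1 [k [e2 e3 ->]]]].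
  exists (f0 + g0), (f1 + g1), (h + k).
  rewrite !rmorphD /= e0 e1 e2 e3 !sqrD_P3 !mulrDl; split=> //.
  by rewrite addrACA; congr (_ + _); rewrite addrACA.
move=> [f0 [f1 [h [e0 e1 ef]]]] [g0 [g1 [k [e2 e3 eg]]]].
exists (f0 * g0 + f1 * g1 * w), (f0 * g1 + f1 * g0).
exists (f1 * g1 + (f0 + f1 * X 0) * k + h * g).
rewrite !rmorphD !rmorphM /= e0 e1 e2 e3 phi_w (sqrD_P3 (f0 * g0)) (sqrD_P3 (f0 * g1)).
rewrite !exprMn; split=> //.
have e : X 0 ^+ 2 = q + w by rewrite qE -addrA addrr_P3 addr0.
rewrite ef eg {ef eg e0 e1 e2 e3}.
move: e; move: (X 0) (Qpoly a b) w => x q' w' e.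
apply/eqP; rewrite -subr_eq0; apply/eqP.
transitivity ((x ^+ 2 - (q' + w')) * (f1 * g1)); last by rewrite e subrr mul0r.
ring.
Qed.

Lemma phi_eq0 f : phi f = 0 <-> exists g, f = g * q.
Proof.
split=> [|[g ->]]; last by rewrite rmorphM /= phi_q mulr0.
case: (reduce f) => f0 [f1 [h [e0 e1 ->]]].
rewrite !rmorphD !rmorphM /= phi_q mulr0 addr0 phiX inordK //= e0 e1 => e.
have /aniso_P3[-> yf1] :
    f0 ^+ 2 + a *: (f1 * X 1) ^+ 2 + b *: (f1 * X 2) ^+ 2 = 0.
  by rewrite -addrA -[RHS]e /w !exprMn mulrDr !scalerAr.
have -> : f1 = 0.
  apply/eqP; move/eqP: yf1; rewrite mulf_eq0 => /orP[//|/eqP/mpolyP/(_ U_(inord 1)%MM)].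
  by rewrite mcoeffXU eqxx mcoeff0 => /eqP; rewrite oner_eq0.
by exists h; rewrite mul0r !add0r.
Qed.

Definition kerphi : {pred P3} := fun f => phi f == 0.
Lemma kerphi_ideal : idealr_closed kerphi.
Proof.
split; rewrite ?unfold_in ?rmorph0 ?rmorph1 ?oner_eq0 //.
move=> c f g; rewrite !unfold_in rmorphD rmorphM /= => /eqP -> /eqP ->.
by rewrite mulr0 addr0.
Qed.
HB.instance Definition _ := isIdealr.Build P3 kerphi kerphi_ideal.
Lemma kerphi_prime : prime_idealr_closed kerphi.
Proof. by move=> f g; rewrite !unfold_in rmorphM mulf_eq0. Qed.
HB.instance Definition _ := isPrimeIdealrClosed.Build P3 kerphi kerphi_prime.

Definition coordring := {ideal_quot kerphi}.
HB.instance Definition _ := GRing.ComNzRing.on coordring.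

(* Units are decided classically, since {fraction _} expects a unit ring. *)
Definition cunit : {pred coordring} := fun x => `[< exists y, y * x = 1 >].
Definition cinv (x : coordring) : coordring :=
  if pselect (exists y, y * x = 1) is left h then projT1 (cid h) else x.

Lemma cmulV : {in cunit, left_inverse 1 cinv *%R}.
Proof.
move=> x /asboolP hx; rewrite /cinv.
by case: pselect => // h; case: cid.
Qed.
Lemma cunitP x y : y * x = 1 -> cunit x.
Proof. by move=> e; apply/asboolP; exists y. Qed.
Lemma cinv_out : {in [predC cunit], cinv =1 id}.
Proof. by move=> x /asboolPn hx; rewrite /cinv; case: pselect. Qed.
HB.instance Definition _ := GRing.ComNzRing_hasMulInverse.Build coordring
  cmulV cunitP cinv_out.
Lemma cidom (x y : coordring) : x * y = 0 -> (x == 0) || (y == 0).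
Proof. exact: Quotient.rquot_IdomainAxiom. Qed.
HB.instance Definition _ := GRing.ComUnitRing_isIntegral.Build coordring cidom.

Definition cpi : P3 -> coordring := \pi_{ideal_quot kerphi}.
HB.instance Definition _ := GRing.RMorphism.on cpi.

Lemma cpi_eq0 f : cpi f = 0 <-> phi f = 0.
Proof.
rewrite -(rmorph0 cpi) /cpi; split=> [/eqP|/eqP h].
  by rewrite -Quotient.idealrBE subr0 => /eqP.
by apply/eqP; rewrite -Quotient.idealrBE subr0.
Qed.

Theorem function_field_exists :
  exists (K : fieldType) (iota : {rmorphism F -> K}),
    is_function_field a b iota.
Proof.
pose ev : {rmorphism P3 -> {fraction coordring}} := @tofrac coordring \o cpi.
exists {fraction coordring}, (ev \o @mpolyC 3 F), ev; split=> // [f|x].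
  rewrite -phi_eq0 -cpi_eq0 /=; split=> [/eqP|->]; last by rewrite rmorph0.
  by rewrite tofrac_eq0 => /eqP.
have [n [m [m0 ->]]] := fracE x.
exists (repr n), (repr m); rewrite /= /cpi !reprK tofrac_eq0; split=> //.
Qed.
End Existence.

End FunctionFieldExistence.

Section LmodQuotient.
Variables (R : nzRingType) (V : lmodType R) (rel : V -> Prop).

Inductive lspan : V -> Prop :=
| lspan0 : lspan 0
| lspanP k u v : rel u -> lspan v -> lspan (k *: u + v).

Lemma lspanZD k u v : lspan u -> lspan v -> lspan (k *: u + v).
Proof.
move=> hu; elim: hu v => [|l u' v' ru' _ IH] v hv; first by rewrite scaler0 add0r.
rewrite scalerDr scalerA -addrA; apply: lspanP => //; exact: IH.
Qed.

Definition in_lspan : {pred V} := fun v => `[< lspan v >].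

Lemma in_lspanP v : reflect (lspan v) (v \in in_lspan).
Proof. exact: asboolP. Qed.

Lemma in_lspan_zmod : zmod_closed in_lspan.
Proof.
split=> [|u v /in_lspanP hu /in_lspanP hv]; first exact/in_lspanP/lspan0.
apply/in_lspanP; rewrite addrC -scaleN1r; exact: lspanZD.
Qed.
HB.instance Definition _ := GRing.isZmodClosed.Build V in_lspan in_lspan_zmod.

Definition lquot := {ideal_quot in_lspan}.
HB.instance Definition _ := GRing.Zmodule.on lquot.

Definition lpi (v : V) : lquot := \pi_{ideal_quot in_lspan} v.

Lemma lpiP u v : lpi u = lpi v <-> lspan (u - v).
Proof.
split=> [/eqP|h]; first by rewrite -Quotient.idealrBE => /in_lspanP.
by apply/eqP; rewrite -Quotient.idealrBE; apply/in_lspanP.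
Qed.

Lemma lpi_repr (x : lquot) : lpi (repr x) = x.
Proof. exact: reprK. Qed.

Lemma lpiD u v : lpi (u + v) = lpi u + lpi v.
Proof. exact: (raddfD (\pi_{ideal_quot in_lspan})). Qed.

Definition lscale k (x : lquot) : lquot := lpi (k *: repr x).

Lemma lscaleE k v : lscale k (lpi v) = lpi (k *: v).
Proof.
apply/lpiP; rewrite -scalerBr -[_ *: _]addr0.
by apply: lspanZD lspan0; apply/lpiP; rewrite lpi_repr.
Qed.

Lemma lscaleA k l x : lscale k (lscale l x) = lscale (k * l) x.
Proof. by rewrite -[x]lpi_repr !lscaleE scalerA. Qed.
Lemma lscale1 : left_id 1 lscale.
Proof. by move=> x; rewrite -[x]lpi_repr lscaleE scale1r. Qed.
Lemma lscaleDr : right_distributive lscale +%R.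
Proof.
by move=> k x y; rewrite -[x]lpi_repr -[y]lpi_repr -lpiD !lscaleE scalerDr lpiD.
Qed.
Lemma lscaleDl x : {morph lscale^~ x : k l / k + l}.
Proof. by move=> k l; rewrite -[x]lpi_repr !lscaleE scalerDl lpiD. Qed.

HB.instance Definition _ := GRing.Zmodule_isLmodule.Build R lquot
  lscaleA lscale1 lscaleDr lscaleDl.

End LmodQuotient.

Section Differentials.
Variable F : fieldType.

(* Presentation of the absolute Kaehler module; d(n) = 0 for every integer n
   follows, as does d(x^2) = 0 in characteristic 2. *)
Inductive kahler_rel : {freeg F / F} -> Prop :=
| kahlerD x y : kahler_rel (<< x + y >> - << x >> - << y >>)
| kahlerM x y : kahler_rel (<< x * y >> - x *: << y >> - y *: << x >>).

Definition Omega1 : lmodType F := lquot kahler_rel.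
Definition kd (x : F) : Omega1 := lpi kahler_rel << x >>.

(* Presentation of the exterior square of Omega1. *)
Inductive ext2_rel : {freeg (Omega1 * Omega1)%type / F} -> Prop :=
| ext2_l k u v w :
    ext2_rel (<< (k *: u + v, w) >> - k *: << (u, w) >> - << (v, w) >>)
| ext2_r k u v w :
    ext2_rel (<< (w, k *: u + v) >> - k *: << (w, u) >> - << (w, v) >>)
| ext2_alt u : ext2_rel << (u, u) >>.

Definition Omega2 : lmodType F := lquot ext2_rel.
Definition wedge (u v : Omega1) : Omega2 := lpi ext2_rel << (u, v) >>.

Definition dlog (x : F) : Omega1 := x^-1 *: kd x.

Definition symbols (s : seq (F * F)) :=
  all (fun p => (p.1 != 0) && (p.2 != 0)) s.

Definition symbol_sum (s : seq (F * F)) : Omega2 :=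
  \sum_(p <- s) wedge (dlog p.1) (dlog p.2).

(* Since -1 = 1 in F, sums of symbols exhaust the group nu_F(2). *)
Definition nu2_length (omega : Omega2) (n : nat) :=
  (exists s, [/\ symbols s, size s = n & symbol_sum s = omega]) /\
  (forall s, symbols s -> symbol_sum s = omega -> (n <= size s)%N).

(* The graph of e^2 : I^2 F -> nu_F(2): since 2-fold Pfister forms generate
   I^2 F modulo I^3 F, the value at [B] is obtained by writing [B] as
   a sum of such forms plus an element of I^3 F; by Kato's theorem it does not
   depend on the way [B] is written. *)
Definition e2_graph (B : bform F) (omega : Omega2) :=
  exists s psi, [/\ symbols s, in_Ipow 3 psi,
    witt_equiv B (orth (orths [seq pfister [:: p.1; p.2] | p <- s]) psi)
    & omega = symbol_sum s].

Definition e2_length (B : bform F) (n : nat) :=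
  exists2 omega, e2_graph B omega & nu2_length omega n.

End Differentials.

(* Main.v *)
Require Import Defs.
From mathcomp Require Import all_boot all_order all_algebra.
From mathcomp Require classical_sets.
From mathcomp Require Import perm boolp mxtens freeg mpoly ring zify.

Set Implicit Arguments.
Unset Strict Implicit.
Unset Printing Implicit Defensive.

Import GRing.Theory.
Local Open Scope ring_scope.

(** Write k for the field of squares of F, E for k(a, b), and rho for the Pfister form
<<a, b, c>>.  The predicates [span2], [free2], [adj2] and [indep2] are about span,
freeness, adjunction and 2-independence over k.

As 2 = 0, the map v |-> B(v, v) is additive and B(s v, s v) = s^2 B(v, v). If B is
anisotropic, it therefore identifies the space of B with a k-subspace V of F,
restrictions of B to subspaces are exactly the subforms of B, and isotropy over K only
depends on V.  So being K-minimal is a property of V.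

Over K one has x^2 + a y^2 + b z^2 = 0, so E has degree at most 2 over the squares of K:
three elements of a line gE become dependent, and so do five elements of g(E + cE)
([dependent_ext]).  Conversely, the coefficients of an isotropic vector over K form a
chain in V: elements d_0, d_1, ... of V, not all zero, such that b d_0 and all a d_i + b
d_(i+1) lie in V ([isotropic_chain]). A chain in a space of dimension at most 5 yields
three independent elements of V in one line gE or five in one plane g(E + cE)
([chain_lines]).  Hence B is K-minimal if and only if V lies in a plane g(E + cE) and
meets every line hE in dimension at most 2.

Let M = E + cE = k(a, b, c), and let lam(m) be the square root of the coefficient of m
at the monomial 1.  Then (x, y) |-> lam(x y) on M is the form rho, and lam(gx gy) = g
lam(xy) shows that every line gE has orthogonal complement gcE. Up to a factor, C is the
restriction of this form to V (or to a subspace with the same values); its orthogonal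
complement is some <x, y, z>.  Counting dimensions, V meets a line in dimension 3 if and
only if <x, y, z> meets a line in dimension 2 ([line_to_orth], [orth_to_line]).

In the Witt ring, rho = alpha C + <x, y, z> gives C + <det C> = <<yz, xz>> modulo I^3,
so the invariant in [e2_condition] is dlog(yz) dlog(xz) + dlog u dlog v
([e2_graph_triple]).  That this value only depends on the class of the form is proved
with the trace of (G^-1 D1 G)(G^-1 D2 G), where G is a Gram matrix and D1, D2 are
derivations: it is an isometry invariant that vanishes on metabolic forms and on I^3
([e2_graph_uniq]), and derivations separate differential forms ([symbol_sum_eq]).

It remains to see that this invariant is a single symbol if and only if <x, y, z> meets
a line in dimension 2.  If it contains p and pr with r in E outside k, then r can be
taken to be a common slot of both symbols ([symbol_slot], [orth_line_contra]).  For the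
converse, contraction with a volume form turns the symbols into derivations D1, D2 of M,
whose kernels are E = k(u, v) and k(yz, xz), and each of which has square proportional
to itself.  If the sum of the symbols is a symbol, then D1 + D2 has this property too;
this puts the commutator of D1 and D2 into the span of D1 and D2, and makes the two
kernels share an element r outside k ([common_subfield]).  Multiplication by r then
sends some nonzero element of <x, y, z> into <x, y, z> ([pure_line]). *)

(** * Totally singular forms and linear algebra over the field of squares *)
Section CharTwo.
Variables (R : comNzRingType) (charR2 : 2%N \in [pchar R]).

Lemma addrr2 (x : R) : x + x = 0.
Proof. exact: addrr_pchar2. Qed.

Lemma two0 : 1 + 1 = 0 :> R. Proof. exact: addrr2. Qed.
Lemma opp1_2 : - 1 = 1 :> R. Proof. exact: oppr_pchar2. Qed.
Lemma three1 : 3 = 1 :> R.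
Proof. have -> : 3 = 1 + 1 + 1 :> R by ring. by rewrite two0 add0r. Qed.
Lemma four0 : 4 = 0 :> R.
Proof. have -> : 4 = 1 + 1 + (1 + 1) :> R by ring. by rewrite two0 addr0. Qed.
Lemma six0 : 6 = 0 :> R.
Proof.
have -> : 6 = 1 + 1 + (1 + 1) + (1 + 1) :> R by ring.
by rewrite two0 !addr0.
Qed.

Lemma sqrD2 (x y : R) : (x + y) ^+ 2 = x ^+ 2 + y ^+ 2.
Proof. exact: (pFrobenius_autD_comm charR2 (mulrC x y)). Qed.

Lemma sqr_sum2 (I : Type) (r : seq I) (P : pred I) (f : I -> R) :
  (\sum_(i <- r | P i) f i) ^+ 2 = \sum_(i <- r | P i) f i ^+ 2.
Proof. exact: (big_morph (fun x => x ^+ 2) sqrD2 (expr0n _ _)). Qed.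

Lemma add2_eq (x y : R) : x + y = 0 -> x = y.
Proof. by move=> /eqP; rewrite addr_eq0 oppr_pchar2 // => /eqP. Qed.

Lemma addr2K (x y : R) : x + y + y = x.
Proof. by rewrite -addrA addrr2 addr0. Qed.

End CharTwo.

(** Identities modulo 2: the integer coefficients that occur after expansion are reduced
one value at a time. *)
Ltac ring2 h :=
  ring: (two0 h) (opp1_2 h) (three1 h) (four0 h) (six0 h).
Ltac field2 h :=
  field: (two0 h) (opp1_2 h) (three1 h) (four0 h) (six0 h).

Section Span.
Variables (F : fieldType) (charF2 : 2%N \in [pchar F]).
Implicit Types (c d s t : seq F) (x y z : F).

Local Notation ts := totally_singular.

Definition span2 c x := exists v, x = ts c v.
Definition free2 c := qanisotropic (ts c).

Lemma ts_cons y c v :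
  ts (y :: c) v = y * v 0 0 ^+ 2 + ts c (\row_i v 0 (fintype.lift ord0 i)).
Proof.
rewrite /ts big_ord_recl; congr (_ + _).
by apply: eq_bigr => i _; rewrite mxE.
Qed.

Lemma tsD c u v : ts c (u + v) = ts c u + ts c v.
Proof.
rewrite /ts -big_split; apply: eq_bigr => i _.
by rewrite mxE sqrD2 // mulrDr.
Qed.

Lemma tsZ c k v : ts c (k *: v) = k ^+ 2 * ts c v.
Proof.
rewrite /ts mulr_sumr; apply: eq_bigr => i _.
by rewrite mxE exprMn mulrCA.
Qed.

Lemma ts0 c : ts c 0 = 0.
Proof. by have := tsZ 0 (0 : 'rV_(size c)); rewrite scale0r expr0n mul0r. Qed.

Lemma ts_delta c (i : 'I_(size c)) : ts c (delta_mx 0 i) = c`_i.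
Proof.
rewrite /ts (bigD1 i) //= mxE !eqxx expr1n mulr1 big1 ?addr0 // => j /negPf h.
by rewrite mxE h andbF expr0n mulr0.
Qed.

Lemma span2_0 c : span2 c 0.
Proof. by exists 0; rewrite ts0. Qed.

Lemma span2_D c x y : span2 c x -> span2 c y -> span2 c (x + y).
Proof. by move=> [u ->] [v ->]; exists (u + v); rewrite tsD. Qed.

Lemma span2_Z c k x : span2 c x -> span2 c (k ^+ 2 * x).
Proof. by move=> [u ->]; exists (k *: u); rewrite tsZ. Qed.

Lemma span2_mem c x : x \in c -> span2 c x.
Proof.
move=> xc; have h : (index x c < size c)%N by rewrite index_mem.
by exists (delta_mx 0 (Ordinal h)); rewrite ts_delta /= nth_index.
Qed.

Lemma span2_ind c (P : F -> Prop) :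
  P 0 -> (forall x y, P x -> P y -> P (x + y)) ->
  (forall k x, P x -> P (k ^+ 2 * x)) -> (forall x, x \in c -> P x) ->
  forall x, span2 c x -> P x.
Proof.
move=> P0 PD PZ Pc _ [v ->].
apply: (big_ind P) => // i _; rewrite mulrC; apply: PZ; apply: Pc.
exact: mem_nth.
Qed.

Lemma span2_sub c d x :
  (forall y, y \in c -> span2 d y) -> span2 c x -> span2 d x.
Proof.
move=> h; apply: span2_ind h x; [exact: span2_0|exact: span2_D|].
by move=> k y; apply: span2_Z.
Qed.

Lemma span2_subset c d x : {subset c <= d} -> span2 c x -> span2 d x.
Proof. by move=> cd; apply: span2_sub => y /cd; apply: span2_mem. Qed.

Lemma span2_sum c (I : Type) (r : seq I) (P : pred I) (f : I -> F) :
  (forall i, P i -> span2 c (f i)) -> span2 c (\sum_(i <- r | P i) f i).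
Proof. by move=> h; apply: big_ind => //; [exact: span2_0|exact: span2_D]. Qed.

Lemma span2_nil x : span2 [::] x <-> x = 0.
Proof.
split=> [[v ->]|->]; last exact: span2_0.
by rewrite /ts big_ord0.
Qed.

Lemma span2_consP y c x :
  span2 (y :: c) x <-> exists k z, span2 c z /\ x = y * k ^+ 2 + z.
Proof.
split=> [[v ->]|[k [z [zc ->]]]].
  by rewrite ts_cons; exists (v 0 0), (ts c (\row_i v 0 (fintype.lift ord0 i))); split=> //; exists (\row_i v 0 (fintype.lift ord0 i)).
apply: span2_D; first by rewrite mulrC; apply/span2_Z/span2_mem/mem_head.
by apply: span2_subset zc => w wc; rewrite inE wc orbT.
Qed.

Lemma span2_catP c d x :
  span2 (c ++ d) x <-> exists y z, [/\ span2 c y, span2 d z & x = y + z].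
Proof.
split=> [|[y [z [yc zd ->]]]]; last first.
  by apply: span2_D; [apply: span2_subset yc|apply: span2_subset zd] => w h;
    rewrite mem_cat h ?orbT.
move: x; apply: span2_ind => [|x x'|k x|x].
- by exists 0, 0; rewrite addr0; split=> //; apply: span2_0.
- move=> [y [z [yc zd ->]]] [y' [z' [yc' zd' ->]]].
  by exists (y + y'), (z + z'); rewrite addrACA; split=> //; apply: span2_D.
- move=> [y [z [yc zd ->]]]; exists (k ^+ 2 * y), (k ^+ 2 * z).
  by rewrite mulrDr; split=> //; apply: span2_Z.
rewrite mem_cat => /orP[h|h]; [exists x, 0|exists 0, x];
  by rewrite ?addr0 ?add0r; split=> //; first [exact: span2_0|exact: span2_mem].
Qed.

Lemma free2_nil : free2 [::].
Proof. by move=> v _; apply/rowP => -[]. Qed.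

Lemma free2_consP y c : free2 (y :: c) <-> ~ span2 c y /\ free2 c.
Proof.
split=> [h|[yc h] v].
  split=> [[v e]|v e].
    pose u : 'rV_(size c).+1 := \row_i (if unlift ord0 i is Some j then v 0 j else 1).
    have /h/rowP/(_ 0) : ts (y :: c) u = 0.
      rewrite ts_cons mxE unlift_none expr1n mulr1 (_ : \row_i _ = v) -?e ?addrr2 //.
      by apply/rowP => i; rewrite !mxE liftK.
    by rewrite !mxE unlift_none => /eqP; rewrite oner_eq0.
  pose u : 'rV_(size c).+1 := \row_i (if unlift ord0 i is Some j then v 0 j else 0).
  have /h/rowP hu : ts (y :: c) u = 0.
    rewrite ts_cons mxE unlift_none expr0n mulr0 add0r (_ : \row_i _ = v) //.
    by apply/rowP => i; rewrite !mxE liftK.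
  by apply/rowP => i; have := hu (fintype.lift ord0 i); rewrite !mxE liftK.
rewrite ts_cons => e; have [v0|v0] := eqVneq (v 0 0) 0.
  move: e; rewrite v0 expr0n mulr0 add0r => /h/rowP w0.
  apply/rowP => i; rewrite mxE; case: (unliftP ord0 i) => [j ->|-> //].
  by have := w0 j; rewrite !mxE.
case: yc; exists ((v 0 0)^-1 *: \row_i v 0 (fintype.lift ord0 i)).
rewrite tsZ -(add2_eq charF2 e) mulrC -mulrA -exprMn mulfV //.
by rewrite expr1n mulr1.
Qed.

Lemma free2_cat c d : free2 c -> free2 d ->
  (forall x, span2 c x -> span2 d x -> x = 0) -> free2 (c ++ d).
Proof.
move=> hc hd; elim: c hc => //= y c IH /free2_consP[yc hc] h.
apply/free2_consP; split; last first.
  apply: IH => // x xc; apply: h; apply: span2_subset xc => z zc.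
  by rewrite inE zc orbT.
move=> /span2_catP[z [w [zc wd e]]].
have w0 : w = 0.
  apply: h => //; have -> : w = y + z by rewrite e addrAC addrr2 // add0r.
  apply: span2_D; first exact/span2_mem/mem_head.
  by apply: span2_subset zc => x xc; rewrite inE xc orbT.
by case: yc; rewrite e w0 addr0.
Qed.

Lemma span2_rowsE c (e : seq F) :
  (forall y, y \in e -> span2 c y) ->
  exists X : 'M[F]_(size e, size c), forall i, ts c (row i X) = e`_i.
Proof.
move=> h; have /choice[f hf] : forall i : 'I_(size e), exists v, e`_i = ts c v.
  by move=> i; apply: h; apply: mem_nth.
by exists (\matrix_i f i) => i; rewrite rowK hf.
Qed.

(** Coordinates change semilinearly: the row vector v enters through the squares of its
entries, which is why linear algebra over k can be done with matrices over F. *)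
Lemma ts_mul c m (X : 'M[F]_(m, size c)) (v : 'rV_m) :
  ts c (v *m X) = \sum_i v 0 i ^+ 2 * ts c (row i X).
Proof.
rewrite mulmx_sum_row.
elim/big_ind2: _ => [|u x w y <- <-|i _]; rewrite ?ts0 ?tsD ?tsZ //.
Qed.

Lemma free2_rows c e (X : 'M[F]_(size e, size c)) :
  free2 e -> (forall i, ts c (row i X) = e`_i) -> row_free X.
Proof.
move=> fe hX; rewrite -kermx_eq0; apply/eqP/row_matrixP => i.
rewrite row0; apply: fe; have := mulmx_ker X.
move=> /(congr1 (row i)); rewrite row_mul row0.
move: (row i _) => v /(congr1 (ts c)); rewrite ts0 ts_mul => e0.
by rewrite -[RHS]e0; apply: eq_bigr => j _; rewrite hX mulrC.
Qed.

Lemma free2_size c e : free2 e -> (forall y, y \in e -> span2 c y) ->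
  (size e <= size c)%N.
Proof.
move=> fe /span2_rowsE[X hX]; have := free2_rows fe hX.
by rewrite /row_free => /eqP <-; apply: rank_leq_col.
Qed.

(** A free family with as many elements as a generating family generates: one more
element in the span would contradict [free2_size]. *)
Lemma free2_full c e x : free2 e -> (forall y, y \in e -> span2 c y) ->
  size e = size c -> span2 c x -> span2 e x.
Proof.
move=> fe he se xc; case: (pselect (span2 e x)) => // xe.
have : free2 (x :: e) by apply/free2_consP.
move=> /free2_size/(_ (_ : forall y, _ -> span2 c y)) /=; rewrite se ltnn.
by case/(_ _)/Bool.diff_false_true => y; rewrite inE => /predU1P[->//|/he].
Qed.

End Span.

(** * The fields generated by squares and 2-independence *)
Section Adjunction.
Variables (F : fieldType) (charF2 : 2%N \in [pchar F]).
Implicit Types (c d s t : seq F) (x y z : F).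
Local Notation ts := totally_singular.

(** The field k(s), written as an iterated extension of exponent 1.  For a in k(s') the
definition still gives k(a :: s') = k(s'). *)
Fixpoint adj2 s : F -> Prop :=
  if s is a :: s' then
    fun x => exists y z, [/\ adj2 s' y, adj2 s' z & x = y + a * z]
  else fun x => exists y, x = y ^+ 2.

Fixpoint indep2 s : Prop :=
  if s is a :: s' then ~ adj2 s' a /\ indep2 s' else True.

Lemma adj2_sqr s y : adj2 s (y ^+ 2).
Proof.
elim: s y => [|a s IH] y; first by exists y.
exists (y ^+ 2), (0 ^+ 2); split=> //; by rewrite expr0n mulr0 addr0.
Qed.

Lemma adj2_0 s : adj2 s 0. Proof. by have := adj2_sqr s 0; rewrite expr0n. Qed.
Lemma adj2_1 s : adj2 s 1. Proof. by have := adj2_sqr s 1; rewrite expr1n. Qed.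

Lemma adj2_D s x y : adj2 s x -> adj2 s y -> adj2 s (x + y).
Proof.
elim: s x y => [|a s IH] x y /=.
  by move=> [u ->] [v ->]; exists (u + v); rewrite sqrD2.
move=> [u [v [hu hv ->]]] [u' [v' [hu' hv' ->]]].
exists (u + u'), (v + v'); split; [exact: IH|exact: IH|ring].
Qed.

Lemma adj2_cons a s x : adj2 s x -> adj2 (a :: s) x.
Proof. by move=> h; exists x, 0; split=> //; [exact: adj2_0|ring]. Qed.

Lemma adj2_M s x y : adj2 s x -> adj2 s y -> adj2 s (x * y).
Proof.
elim: s x y => [|a s IH] x y /=.
  by move=> [u ->] [v ->]; exists (u * v); rewrite exprMn.
move=> [u [v [hu hv ->]]] [u' [v' [hu' hv' ->]]].
exists (u * u' + a ^+ 2 * (v * v')), (u * v' + v * u'); split; last by ring.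
  by apply: adj2_D; [exact: IH|apply: (IH); [exact: adj2_sqr|exact: IH]].
by apply: adj2_D; apply: IH.
Qed.

(** 1/x = x (1/x)^2, and squares are scalars. *)
Lemma adj2_V s x : adj2 s x -> adj2 s x^-1.
Proof.
move=> h; have [->|x0] := eqVneq x 0; first by rewrite invr0; apply: adj2_0.
have -> : x^-1 = x * x^-1 ^+ 2 by field.
by apply: adj2_M => //; apply: adj2_sqr.
Qed.

Lemma adj2_div s x y : adj2 s x -> adj2 s y -> adj2 s (x / y).
Proof. by move=> hx hy; apply: adj2_M => //; apply: adj2_V. Qed.

Lemma adj2_mem s x : x \in s -> adj2 s x.
Proof.
elim: s => //= a s IH; rewrite inE => /predU1P[->|/IH h].
  by exists 0, 1; split; [exact: adj2_0|exact: adj2_1|ring].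
exact: adj2_cons.
Qed.

Lemma adj2_ind s (P : F -> Prop) :
  (forall x, P (x ^+ 2)) -> (forall x y, P x -> P y -> P (x + y)) ->
  (forall x y, P x -> P y -> P (x * y)) -> (forall x, x \in s -> P x) ->
  forall x, adj2 s x -> P x.
Proof.
move=> Psq PD PM; elim: s => [|a s IH] Ps x /=; first by move=> [y ->].
move=> [y [z [hy hz ->]]]; apply: (PD); last apply: (PM).
- by apply: IH hy => w ws; apply: Ps; rewrite inE ws orbT.
- by apply: Ps; apply: mem_head.
by apply: IH hz => w ws; apply: Ps; rewrite inE ws orbT.
Qed.

Lemma adj2_sub s t x : (forall y, y \in s -> adj2 t y) -> adj2 s x -> adj2 t x.
Proof.
move=> h; apply: (adj2_ind (P := adj2 t)) h x.
- exact: adj2_sqr.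
- exact: adj2_D.
exact: adj2_M.
Qed.

Lemma adj2_subset s t x : {subset s <= t} -> adj2 s x -> adj2 t x.
Proof. by move=> st; apply: adj2_sub => y /st; apply: adj2_mem. Qed.

Lemma adj2_exchange s y z : adj2 (y :: s) z -> ~ adj2 s z -> adj2 (z :: s) y.
Proof.
move=> [u [v [hu hv e]]] hz.
have [v0|v0] := eqVneq v 0; first by case: hz; rewrite e v0 mulr0 addr0.
have -> : y = (z + u) / v.
  by apply: (mulIf v0); rewrite divfK // e addrAC addrr2 // add0r.
apply: adj2_div; last exact: adj2_cons.
by apply: adj2_D; [apply/adj2_mem/mem_head|exact: adj2_cons].
Qed.

Lemma indep2_exchange t s x : adj2 (t ++ s) x -> ~ adj2 t x ->
  exists y s1 s2, s = s1 ++ y :: s2 /\ adj2 (x :: t ++ s1 ++ s2) y.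
Proof.
elim: s => [|y s IH]; first by rewrite cats0.
move=> h hx; have [h'|h'] := pselect (adj2 (t ++ s) x).
  have [z [s1 [s2 [-> hz]]]] := IH h' hx.
  exists z, (y :: s1), s2; split=> //; apply: adj2_subset hz => w.
  by rewrite !(inE, mem_cat) => /or4P[]->; rewrite ?orbT.
exists y, [::], s; split=> //=; apply: adj2_exchange h'.
by apply: adj2_subset h => w; rewrite !(inE, mem_cat) orbCA.
Qed.

(** Exchange: [adj2] is the closure operator of a matroid, with [adj2_exchange] as its
exchange property, so a 2-independent family t can replace size t elements of s. *)
Lemma steinitz t s : indep2 t -> (forall x, x \in t -> adj2 s x) ->
  exists s', [/\ {subset s' <= s}, (size t + size s' = size s)%N
    & forall x, adj2 s x -> adj2 (t ++ s') x].
Proof.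
elim: t => [|x t IH] /=; first by move=> _ _; exists s; split.
move=> [xt ht] h; have [|s' [s's es cl]] := IH ht.
  by move=> y yt; apply: h; rewrite inE yt orbT.
have hx : adj2 (t ++ s') x by apply/cl/h/mem_head.
have [y [s1 [s2 [e hy]]]] := indep2_exchange hx xt.
exists (s1 ++ s2); split.
- move=> z zs; apply: s's; rewrite e; move: zs.
  by rewrite !(inE, mem_cat) => /orP[]->; rewrite ?orbT.
- by rewrite -es e !size_cat /= !addnS addSn.
move=> z /cl; rewrite e; apply: (@adj2_sub _ ((x :: t) ++ s1 ++ s2)) => w.
rewrite !(inE, mem_cat) => /or4P[wt|ws|/eqP->//|ws];
  by apply: adj2_mem; rewrite !(inE, mem_cat) ?wt ?ws ?orbT.
Qed.

Lemma indep2_full t s : indep2 t -> (forall x, x \in t -> adj2 s x) ->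
  size t = size s -> forall x, adj2 s x -> adj2 t x.
Proof.
move=> it ts est; have [s' [_ e cl]] := steinitz it ts.
by move: e cl; rewrite est -{2}[size s]addn0 => /addnI/size0nil ->; rewrite cats0.
Qed.

(** Otherwise k(t) would contain the larger 2-independent family s. *)
Lemma indep2_extend t s : indep2 s -> indep2 t -> (size t < size s)%N ->
  exists2 w, w \in s & ~ adj2 t w.
Proof.
move=> si it lts; apply: contrapT => h.
have [|s' [_ e _]] := @steinitz s t si.
  by move=> x xs; apply: contrapT => hx; apply: h; exists x.
by move: lts; rewrite -e -ltn_subRL subnn.
Qed.

Fixpoint mons s : seq F :=
  if s is a :: s' then mons s' ++ [seq a * m | m <- mons s'] else [:: 1].

Lemma size_mons s : size (mons s) = (2 ^ size s)%N.
Proof. by elim: s => //= a s IH; rewrite size_cat size_map IH addnn expnS mul2n. Qed.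

Lemma span2_scale a c x : a != 0 ->
  span2 [seq a * m | m <- c] x <-> span2 c (x / a).
Proof.
move=> a0; split.
  move: x; apply: span2_ind => // [|x y|k x|x].
  - by rewrite mul0r; apply: span2_0.
  - by rewrite mulrDl; apply: span2_D.
  - by rewrite -mulrA; apply: span2_Z.
  by move=> /mapP[m mc ->]; rewrite mulrAC mulfV // mul1r; apply: span2_mem.
rewrite -{2}[x](mulfVK a0); move: (x / a); apply: span2_ind => // [|u v|k u|u uc].
- by rewrite mul0r; apply: span2_0.
- by rewrite mulrDl; apply: span2_D.
- by rewrite -mulrA; apply: span2_Z.
by apply: span2_mem; rewrite mulrC; apply: map_f.
Qed.

Lemma free2_scale a c : a != 0 -> free2 c -> free2 [seq a * m | m <- c].
Proof.
move=> a0; elim: c => //= y c IH /(free2_consP charF2)[yc hc].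
apply/free2_consP => //; split; last exact: IH.
by move=> /span2_scale -/(_ a0); rewrite mulrAC mulfV // mul1r.
Qed.

(** The 2^n monomials span k(s) over k. *)
Lemma monsP s x : adj2 s x <-> span2 (mons s) x.
Proof.
split; last first.
  apply: span2_ind => [|||{}x].
  - exact: adj2_0.
  - exact: adj2_D.
  - by move=> k y; apply: adj2_M; apply: adj2_sqr.
  elim: s x => [|a s IH] x /=.
    by rewrite inE => /eqP ->; exists 1; rewrite expr1n.
  rewrite mem_cat => /orP[/IH|/mapP[m /IH hm ->]]; first exact: adj2_cons.
  by exists 0, m; split; rewrite ?add0r //; apply: adj2_0.
elim: s x => [|a s IH] x /=.
  move=> [y ->]; rewrite -[_ ^+ 2]mulr1; apply/span2_Z/span2_mem.
  exact: mem_head.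
move=> [y [z [/IH hy /IH hz ->]]]; apply/span2_catP => //; exists y, (a * z).
split=> //; have [->|a0] := eqVneq a 0; first by rewrite mul0r; apply: span2_0.
by apply/span2_scale; rewrite // mulrAC mulfV // mul1r.
Qed.

Lemma free2_mons s : indep2 s -> free2 (mons s).
Proof.
elim: s => [|a s IH] /=.
  move=> _; apply/free2_consP => //; split; last exact: free2_nil.
  by move=> /span2_nil/eqP; rewrite oner_eq0.
move=> [sa hs]; have a0 : a != 0.
  by apply: contraPneq sa => -> /(_ (adj2_0 s)).
apply: free2_cat => //; [exact: IH|exact/free2_scale/IH|].
move=> x hx /span2_scale-/(_ a0) hxa; apply: contrapT => /eqP x0; apply: sa.
have -> : a = x / (x / a) by field; rewrite a0.
by apply: adj2_div; apply/monsP.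
Qed.

(** The graph of the map that sends x to the square root of its coefficient at the
monomial 1. *)
Fixpoint lam_rel s x l : Prop :=
  if s is a :: s' then
    exists y z, [/\ lam_rel s' y l, adj2 s' z & x = y + a * z]
  else x = l ^+ 2.

Lemma lam_rel_ex s x : adj2 s x -> exists l, lam_rel s x l.
Proof.
elim: s x => [|a s IH] x /=; first by move=> [y ->]; exists y.
by move=> [y [z [/IH[l hl] hz ->]]]; exists l, y, z.
Qed.

Definition lam s x :=
  if pselect (exists l, lam_rel s x l) is left h then projT1 (cid h) else 0.

Lemma lam_rel_adj s x l : lam_rel s x l -> adj2 s x.
Proof.
elim: s x => [|a s IH] x /=; first by move=> ->; exists l.
by move=> [y [z [/IH hy hz ->]]]; exists y, z.
Qed.

(** If two decompositions y + a z and y' + a z' of x had z and z' different, then a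
would be the quotient (y + y') / (z + z') of elements of k(s). *)
Lemma lam_rel_uniq s x l l' :
  indep2 s -> lam_rel s x l -> lam_rel s x l' -> l = l'.
Proof.
elim: s x => [|a s IH] x /=.
  move=> _ -> e; apply: (@fmorph_inj _ _ (pFrobenius_aut charF2)).
  by rewrite /= !pFrobenius_autE.
move=> [sa hs] [y [z [hy hz ->]]] [y' [z' [hy' hz' e]]].
have [ez|ez] := eqVneq z z'; last first.
  case: sa; have -> : a = (y + y') / (z + z').
    have e1 : z + z' != 0 by rewrite addr_eq0 oppr_pchar2.
    apply: (mulIf e1); rewrite divfK //.
    have -> : y + y' = (y + a * z) + a * z + y' by ring2 charF2.
    rewrite e; ring2 charF2.
  by apply: adj2_div; apply: adj2_D => //; apply: lam_rel_adj; eassumption.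
have ey : y = y' by apply: (addIr (a * z)); rewrite e ez.
by apply: (IH y') => //; rewrite -ey.
Qed.

Lemma lamP s x : adj2 s x -> lam_rel s x (lam s x).
Proof. by move=> /lam_rel_ex h; rewrite /lam; case: pselect => // h'; case: cid. Qed.

Lemma lamE s x l : indep2 s -> lam_rel s x l -> lam s x = l.
Proof.
by move=> hs hl; apply: lam_rel_uniq hs (lamP (lam_rel_adj hl)) hl.
Qed.

Lemma lam_cons a s y z : indep2 (a :: s) -> adj2 s y -> adj2 s z ->
  lam (a :: s) (y + a * z) = lam s y.
Proof.
by move=> hs hy hz; apply: lamE => //; exists y, z; split=> //; apply: lamP.
Qed.

Lemma lam_nil y : lam [::] (y ^+ 2) = y.
Proof. exact: lamE. Qed.

Lemma lamD s x y : indep2 s -> adj2 s x -> adj2 s y ->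
  lam s (x + y) = lam s x + lam s y.
Proof.
elim: s x y => [|a s IH] x y hs.
  by move=> [u ->] [v ->]; rewrite -sqrD2 // !lam_nil.
move=> [u [v [hu hv ->]]] [u' [v' [hu' hv' ->]]].
have -> : u + a * v + (u' + a * v') = (u + u') + a * (v + v') by ring.
by rewrite !lam_cons ?IH //; [case: hs|exact: adj2_D|exact: adj2_D].
Qed.

Lemma lamZ s k x : indep2 s -> adj2 s x -> lam s (k ^+ 2 * x) = k * lam s x.
Proof.
elim: s x => [|a s IH] x hs.
  by move=> [u ->]; rewrite -exprMn !lam_nil.
move=> [u [v [hu hv ->]]].
have -> : k ^+ 2 * (u + a * v) = k ^+ 2 * u + a * (k ^+ 2 * v) by ring.
have hk w : adj2 s w -> adj2 s (k ^+ 2 * w) by apply/adj2_M/adj2_sqr.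
by rewrite !lam_cons ?IH //; [case: hs|exact: hk|exact: hk].
Qed.

Lemma lam0 s : indep2 s -> lam s 0 = 0.
Proof. by move=> hs; have := lamZ 0 hs (adj2_0 s); rewrite !mul0r mulr0. Qed.

Lemma lam1 s : indep2 s -> lam s 1 = 1.
Proof.
elim: s => [|a s IH] hs; first by rewrite -[in lam _ 1](expr1n F 2) lam_nil.
rewrite -[in lam _ 1](addr0 1) -(mulr0 a) lam_cons //.
- by apply: IH; case: hs.
- exact: adj2_1.
exact: adj2_0.
Qed.

Lemma lam_sqr s x : indep2 s -> adj2 s x -> lam s (x * x) = x.
Proof.
by move=> hs hx; rewrite -expr2 -[x ^+ 2]mulr1 lamZ ?lam1 ?mulr1 //; apply: adj2_1.
Qed.

Lemma lam_sum s (I : Type) (r : seq I) (P : pred I) (f : I -> F) :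
  indep2 s -> (forall i, P i -> adj2 s (f i)) ->
  lam s (\sum_(i <- r | P i) f i) = \sum_(i <- r | P i) lam s (f i).
Proof.
move=> hs hf; suff [] : adj2 s (\sum_(i <- r | P i) f i) /\
    lam s (\sum_(i <- r | P i) f i) = \sum_(i <- r | P i) lam s (f i) by [].
apply: (big_ind2 (fun x y => adj2 s x /\ lam s x = y)) => [|x y z w [h <-] [h' <-]|i Pi].
- by rewrite lam0 //; split=> //; apply: adj2_0.
- by rewrite lamD //; split=> //; apply: adj2_D.
by split=> //; apply: hf.
Qed.

Lemma mons_adj s m : m \in mons s -> adj2 s m.
Proof. by move=> h; apply/monsP/span2_mem. Qed.

(** The product of two distinct monomials is a square times a monomial other than 1, so
the form lam(x y) is diagonal on monomials. *)
Lemma lam_mons s : indep2 s ->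
  pairwise (fun x y => lam s (x * y) == 0) (mons s).
Proof.
elim: s => [|a s IH] //= hs; have hs' : indep2 s by case: hs.
rewrite pairwise_cat pairwise_map; apply/and3P; split.
- apply/allrelP => x _ hx /mapP[y hy ->]; apply/eqP.
  have -> : x * (a * y) = 0 + a * (x * y) by ring.
  rewrite lam_cons ?lam0 //; first exact: adj2_0.
  by apply: adj2_M; apply: mons_adj.
- apply: sub_in_pairwise (IH hs') => // x y hx hy /eqP e; apply/eqP.
  have hxy : adj2 s (x * y) by apply: adj2_M; apply: mons_adj.
  have -> : x * y = x * y + a * 0 by ring.
  by rewrite (lam_cons hs hxy (adj2_0 s)).
apply: sub_in_pairwise (IH hs') => // x y hx hy /eqP e; apply/eqP => /=.
have -> : a * x * (a * y) = a ^+ 2 * (x * y) + a * 0 by ring.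
have hxy : adj2 s (x * y) by apply: adj2_M; apply: mons_adj.
have hk : adj2 s (a ^+ 2 * (x * y)) by apply/adj2_M/hxy/adj2_sqr.
by rewrite (lam_cons hs hk (adj2_0 s)) lamZ ?e ?mulr0.
Qed.

Lemma lam_monsE s (i j : nat) : indep2 s ->
  (i < size (mons s))%N -> (j < size (mons s))%N ->
  lam s ((mons s)`_i * (mons s)`_j) = (mons s)`_i *+ (i == j).
Proof.
move=> hs hi hj; have /pairwiseP-/(_ 0) h := lam_mons hs.
case: (ltngtP i j) => [ij|ij|<-].
- by rewrite (eqP (h i j _ _ ij)).
- by rewrite mulrC (eqP (h j i _ _ ij)).
by rewrite lam_sqr //; apply/mons_adj/mem_nth.
Qed.

End Adjunction.

(** * Isometries of bilinear forms *)
Section FormAlgebra.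
Variable F : fieldType.
Implicit Types (A B C D M : bform F) (s t : seq F).

Lemma isometric_dim B C : isometric B C -> bdim B = bdim C.
Proof. by move=> [P /andP[/eqP h1 /eqP h2] _]; rewrite -h1 h2. Qed.

Lemma isometricP n (G H : 'M[F]_n) :
  isometric (BForm G) (BForm H) <-> exists2 P, P \in unitmx & G = P *m H *m P^T.
Proof.
split=> -[P hP e]; exists P => //; first by case/andP: hP; rewrite row_free_unit.
by rewrite row_free_unit row_full_unit hP.
Qed.

Lemma isometric_refl B : isometric B B.
Proof.
case: B => n G; apply/isometricP; exists 1%:M; first exact: unitmx1.
by rewrite trmx1 mul1mx mulmx1.
Qed.

Lemma isometric_sym B C : isometric B C -> isometric C B.
Proof.
move=> h; have := isometric_dim h; case: B C h => [n G] [m H] h /= e.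
case: _ / e H h => H /isometricP[P uP ->]; apply/isometricP.
exists (invmx P); first by rewrite unitmx_inv.
by rewrite !mulmxA mulVmx // mul1mx -mulmxA -trmx_mul mulVmx // trmx1 mulmx1.
Qed.

Lemma isometric_trans C B D : isometric B C -> isometric C D -> isometric B D.
Proof.
move=> h1 h2; have := isometric_dim h1; have := isometric_dim h2.
case: B C D h1 h2 => [n G] [m H] [p K] h1 h2 /= e2 e1.
subst m p; move: h1 h2 => /isometricP[P uP ->] /isometricP[Q uQ ->]; apply/isometricP.
exists (P *m Q); first by rewrite unitmx_mul uP.
by rewrite trmx_mul !mulmxA.
Qed.

(** A bijection of the basis vectors that respects the Gram matrices.  All the monoid
laws of orthogonal sums below come from it. *)
Lemma isometric_reindex B C (f : 'I_(bdim B) -> 'I_(bdim C)) :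
  bijective f -> (forall i j, gram B i j = gram C (f i) (f j)) -> isometric B C.
Proof.
move=> [g fK gK] h; pose P : 'M[F]_(bdim B, bdim C) := \matrix_(i, j) (f i == j)%:R.
pose Q : 'M[F]_(bdim C, bdim B) := \matrix_(i, j) (g i == j)%:R.
have PQ : P *m Q = 1%:M.
  apply/matrixP => i j; rewrite !mxE (bigD1 (f i)) //= !mxE eqxx mul1r fK.
  by rewrite big1 ?addr0 // => k /negPf hk; rewrite !mxE eq_sym hk mul0r.
have QP : Q *m P = 1%:M.
  apply/matrixP => i j; rewrite !mxE (bigD1 (g i)) //= !mxE eqxx mul1r gK.
  by rewrite big1 ?addr0 // => k /negPf hk; rewrite !mxE eq_sym hk mul0r.
exists P; first by apply/andP; split; [apply/row_freeP; exists Q|apply/row_fullP; exists Q].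
apply/matrixP => i j; rewrite h !mxE (bigD1 (f j)) //= !mxE eqxx mulr1.
rewrite [X in _ + X]big1 ?addr0 => [|k /negPf hk]; last first.
  by rewrite !mxE eq_sym hk mulr0.
rewrite (bigD1 (f i)) //= !mxE eqxx mul1r big1 ?addr0 // => k /negPf hk.
by rewrite !mxE eq_sym hk mul0r.
Qed.

Lemma isometric_cast B C (e : bdim B = bdim C) :
  (forall i j, gram B i j = gram C (cast_ord e i) (cast_ord e j)) -> isometric B C.
Proof.
apply: isometric_reindex; exists (cast_ord (esym e)) => i.
  exact: cast_ordK.
exact: cast_ordKV.
Qed.

Lemma bilinear_isometric B C : isometric B C -> bilinear_form C -> bilinear_form B.
Proof.
move=> h; have := isometric_dim h; case: B C h => [n G] [m H] h /= e.
case: _ / e H h => H /isometricP[P uP ->] [/= sH uH]; split=> /=.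
  by rewrite !trmx_mul trmxK sH mulmxA.
by rewrite !unitmx_mul uP uH unitmx_tr.
Qed.

Lemma bilinear_orth B C : bilinear_form B -> bilinear_form C -> bilinear_form (orth B C).
Proof.
move=> [sB uB] [sC uC]; split=> /=.
  by rewrite tr_block_mx sB sC !trmx0.
by rewrite unitmxE det_ublock unitrM -!unitmxE uB.
Qed.

Lemma isometric_orth A B C D : isometric A B -> isometric C D ->
  isometric (orth A C) (orth B D).
Proof.
move=> h1 h2; have := isometric_dim h1; have := isometric_dim h2.
case: A B C D h1 h2 => [n G] [m H] [p K] [q L] h1 h2 /= e2 e1.
case: _ / e1 H h1 => H /isometricP[P uP ->].
case: _ / e2 L h2 => L /isometricP[Q uQ ->].
apply/isometricP; exists (block_mx P 0 0 Q).
  by rewrite unitmxE det_ublock unitrM -!unitmxE uP.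
rewrite tr_block_mx !trmx0 !mulmx_block.
by rewrite !(mul0mx, mulmx0, addr0, add0r).
Qed.

Lemma isometric_orthC B C : isometric (orth B C) (orth C B).
Proof.
pose f (n m : nat) (i : 'I_(n + m)) : 'I_(m + n) :=
  match split i with inl j => rshift m j | inr j => lshift n j end.
have fK n m : cancel (f n m) (f m n).
  move=> i; rewrite /f; case: (splitP i) => j e.
    by case: (splitP (rshift m j)) => k /= h; apply: val_inj => /=;
       [case: k h => k hk /= h; move: hk; rewrite -h ltnNge leq_addr|
        move/addnI: h => <-].
  by case: (splitP (lshift n j)) => k /= h; apply: val_inj => /=;
       [rewrite e h|case: j h {e} => j hj /= h; move: hj; rewrite h ltnNge leq_addr].
apply: (@isometric_reindex (orth B C) (orth C B) (f _ _)); first by exists (f _ _).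
move=> i j; rewrite /f /=.
case: (split_ordP i) => i' ->; case: (split_ordP j) => j' -> /=;
  by rewrite ?(block_mxEul, block_mxEur, block_mxEdl, block_mxEdr).
Qed.

Lemma isometric_orthA A B C :
  isometric (orth A (orth B C)) (orth (orth A B) C).
Proof.
pose e := addnA (bdim A) (bdim B) (bdim C).
have e1 i : cast_ord e (lshift _ i) = lshift _ (lshift _ i) by apply: val_inj.
have e2 i : cast_ord e (rshift _ (lshift _ i)) = lshift _ (rshift _ i).
  exact: val_inj.
have e3 i : cast_ord e (rshift _ (rshift _ i)) = rshift _ i.
  by apply: val_inj => /=; rewrite addnA.
apply: (@isometric_cast (orth A (orth B C)) (orth (orth A B) C) e) => i j /=.
case: (split_ordP i) => i' ->; [|case: (split_ordP i') => {}i' ->];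
case: (split_ordP j) => j' ->; do ?[case: (split_ordP j') => {}j' ->];
by rewrite ?e1 ?e2 ?e3 ?(block_mxEul, block_mxEur, block_mxEdl, block_mxEdr, mxE).
Qed.

Lemma isometric_orth0 B : isometric (orth B (bzero F)) B.
Proof.
apply: (@isometric_cast (orth B (bzero F)) B (addn0 _)) => i j /=.
case: (split_ordP i) => [i' ->|[]//]; case: (split_ordP j) => [j' ->|[]//].
by rewrite block_mxEul; congr (gram B _ _); apply: val_inj.
Qed.

Lemma isometric_orthACA A B C D :
  isometric (orth (orth A B) (orth C D)) (orth (orth A C) (orth B D)).
Proof.
apply: isometric_trans (isometric_orthA _ _ _).
apply: isometric_trans (isometric_sym (isometric_orthA _ _ _)) _.
apply: isometric_orth; first exact: isometric_refl.
apply: isometric_trans (isometric_orthA _ _ _) _.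
apply: isometric_trans (isometric_sym (isometric_orthA _ _ _)).
by apply: isometric_orth; [exact: isometric_orthC|exact: isometric_refl].
Qed.

Lemma isometric_diag B s (e : bdim B = size s) :
  (forall i j, gram B i j = s`_i *+ (i == j)) -> isometric B (diagb s).
Proof.
move=> h; apply: (@isometric_cast B (diagb s) e) => i j.
by rewrite h !mxE.
Qed.

Lemma gram_diagb s i j : gram (diagb s) i j = s`_i *+ (i == j).
Proof. by rewrite /= !mxE. Qed.

Lemma isometric_diag_cat s t :
  isometric (orth (diagb s) (diagb t)) (diagb (s ++ t)).
Proof.
apply: isometric_diag => [|i j /=]; first by rewrite size_cat.
case: (split_ordP i) => i' ->; case: (split_ordP j) => j' ->;
  rewrite ?(block_mxEul, block_mxEur, block_mxEdl, block_mxEdr) ?mxE nth_cat /=.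
- by rewrite ltn_ord eq_lshift.
- by rewrite eq_lrshift.
- by rewrite eq_rlshift.
by rewrite ltnNge leq_addr /= addKn eq_rshift.
Qed.

Lemma isometric_diag_perm s t : perm_eq s t -> isometric (diagb s) (diagb t).
Proof.
move=> /[dup] /perm_size e /(tuple_permP (t := in_tuple t))[p es].
pose f (i : 'I_(size s)) : 'I_(size t) := p (cast_ord e i).
have fE (i : 'I_(size s)) : s`_i = t`_(f i).
  rewrite {1}es -[X in _`_X]/(nat_of_ord (cast_ord e i)).
  by rewrite -tnth_nth tnth_mktuple (tnth_nth 0).
apply: (@isometric_reindex (diagb s) (diagb t) f).
  exists (fun i => cast_ord (esym e) (p^-1%g i)) => i; rewrite /f.
    by rewrite permK cast_ordK.
  by rewrite cast_ordKV permKV.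
move=> i j; rewrite !gram_diagb fE; congr (_ *+ _).
by rewrite /f (inj_eq perm_inj).
Qed.

(** Equality of classes in F^*/F^*2. *)
Definition sqeq (x y : F) := exists2 r, r != 0 & x = y * r ^+ 2.

Lemma isometric_diag_sqeq s t : size s = size t ->
  (forall i, (i < size s)%N -> sqeq s`_i t`_i) -> isometric (diagb s) (diagb t).
Proof.
move=> e h; have /choice[r hr] : forall i : 'I_(size s), exists r,
    r != 0 /\ s`_i = t`_i * r ^+ 2.
  by move=> i; have [r r0 hr] := h i (ltn_ord i); exists r.
apply: isometric_trans (_ : isometric (BForm (\matrix_(i, j < size s) (t`_i *+ (i == j)))) _).
  apply/isometricP; exists (diag_mx (\row_i r i)).
    rewrite unitmxE det_diag; apply/unitrP.
    exists (\prod_i (r i)^-1); rewrite -!big_split /=.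
    by rewrite !big1 // => i _; rewrite mxE ?mulfV ?mulVf //; case: (hr i).
  apply/matrixP => i j; rewrite tr_diag_mx mul_diag_mx mul_mx_diag !mxE.
  have [<-|] := eqVneq i j; last by rewrite !mulr0n mulr0 mul0r.
  by rewrite !mulr1n; case: (hr i) => _ ->; ring.
by apply: (isometric_diag (B := BForm _) e) => i j /=; rewrite mxE.
Qed.

Lemma bilinear_diagb s : all (fun x => x != 0) s -> bilinear_form (diagb s).
Proof.
move=> /all_nthP h; split; first by rewrite /= tr_diag_mx.
rewrite unitmxE det_diag unitfE; apply/prodf_neq0 => i _; rewrite mxE.
exact: h.
Qed.

Lemma isometric_scale k B C : isometric B C -> isometric (bscale k B) (bscale k C).
Proof.
by move=> [P hP e]; exists P => //=; rewrite e -scalemxAr -scalemxAl.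
Qed.

Lemma isometric_scale_orth k B C :
  isometric (bscale k (orth B C)) (orth (bscale k B) (bscale k C)).
Proof.
apply: (@isometric_cast (bscale k (orth B C)) (orth (bscale k B) (bscale k C)) erefl) => i j.
by rewrite !cast_ord_id /= scale_block_mx !scaler0.
Qed.

Lemma isometric_scale_diag k s :
  isometric (bscale k (diagb s)) (diagb [seq k * x | x <- s]).
Proof.
apply: isometric_diag => [|i j /=]; first by rewrite size_map.
by rewrite !mxE (nth_map 0) // mulrnAr.
Qed.

Lemma isometric_scaleK k B : k != 0 -> isometric (bscale k (bscale k B)) B.
Proof.
case: B => n G k0; apply/isometricP; exists k%:M.
  by rewrite unitmxE det_scalar unitrX // unitfE.
by rewrite tr_scalar_mx mul_scalar_mx mul_mx_scalar.
Qed.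

Lemma tens1mx1 m n : 1%:M *t 1%:M = 1%:M :> 'M[F]_(m * n).
Proof.
apply/matrixP => k l; case: (mxtens_indexP k) => i j; case: (mxtens_indexP l) => i' j'.
rewrite tensmxE !mxE (can_eq (@mxtens_indexK _ _)) xpair_eqE.
by case: (i == i'); case: (j == j'); rewrite ?mulr0 ?mul0r ?mulr1.
Qed.

Lemma tens_mulV m n (G : 'M[F]_m) (H : 'M[F]_n) :
  G \in unitmx -> H \in unitmx -> (invmx G *t invmx H) *m (G *t H) = 1%:M.
Proof. by move=> uG uH; rewrite tensmx_mul !mulVmx // tens1mx1. Qed.

Lemma tens_unitmx m n (G : 'M[F]_m) (H : 'M[F]_n) :
  G \in unitmx -> H \in unitmx -> G *t H \in unitmx.
Proof. by move=> uG uH; case/mulmx1_unit: (tens_mulV uG uH). Qed.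

Lemma isometric_tensor A B C : isometric B C -> isometric (tensor A B) (tensor A C).
Proof.
move=> h; have := isometric_dim h; case: A B C h => [a A] [n G] [m H] h /= e.
case: _ / e H h => H /isometricP[P uP ->]; apply/isometricP.
exists (1%:M *t P); first by apply: tens_unitmx => //; apply: unitmx1.
by rewrite trmx_tens trmx1 !tensmx_mul mul1mx mulmx1.
Qed.

(** <1, a> tensor s is s followed by a s, because the index (i, j) of a tensor product
is numbered i * size s + j. *)
Lemma isometric_tensor1 a s :
  isometric (tensor (diagb [:: 1; a]) (diagb s)) (diagb (s ++ [seq a * x | x <- s])).
Proof.
apply: isometric_diag => [|k l].
  by rewrite size_cat size_map /= mul2n addnn.
case: (mxtens_indexP k) => i j; case: (mxtens_indexP l) => i' j'.
rewrite [LHS]/= tensmxE !mxE nth_cat.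
have -> : (mxtens_index (i, j) == mxtens_index (i', j')) = (i == i') && (j == j').
  by rewrite (can_eq (@mxtens_indexK _ _)) xpair_eqE.
case: i => -[|[|//]] hi /=.
  rewrite mul0n add0n ltn_ord; case: i' => -[|[|//]] hi' /=.
    by rewrite mulr1n mul1r.
  by rewrite mul0r.
rewrite mul1n ltnNge leq_addr /= addKn (nth_map 0) //.
case: i' => -[|[|//]] hi' /=; first by rewrite mul0r.
by rewrite mulr1n mulrnAr.
Qed.

(** The list [mons] is built by the same recursion as the Pfister form. *)
Lemma isometric_pfister s : isometric (pfister s) (diagb (mons s)).
Proof.
elim: s => [|a s IH]; first exact: isometric_refl.
exact: isometric_trans (isometric_tensor _ IH) (isometric_tensor1 _ _).
Qed.

Lemma mons_nz s : all (fun x => x != 0) s -> all (fun x => x != 0) (mons s).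
Proof.
elim: s => [|a s IH] /=; first by rewrite oner_eq0.
move=> /andP[a0 /IH hs]; rewrite all_cat hs /= all_map.
by apply: sub_all hs => x x0 /=; rewrite mulf_neq0.
Qed.

Lemma bilinear_pfister s : all (fun x => x != 0) s -> bilinear_form (pfister s).
Proof.
move=> h; apply: bilinear_isometric (isometric_pfister s) _.
exact/bilinear_diagb/mons_nz.
Qed.

Lemma bilinear_tensor B C :
  bilinear_form B -> bilinear_form C -> bilinear_form (tensor B C).
Proof.
move=> [sB uB] [sC uC]; split=> /=; first by rewrite trmx_tens sB sC.
exact: tens_unitmx.
Qed.

(** The diagonal of D + D is totally isotropic. *)
Lemma metabolic_double s : 2%N \in [pchar F] -> all (fun x => x != 0) s ->
  metabolic (orth (diagb s) (diagb s)).
Proof.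
move=> charF2 hs; have hb := bilinear_diagb hs.
split; first exact: bilinear_orth.
exists (size s), (row_mx 1%:M 1%:M); split; last by rewrite /= addnn.
  apply/row_freeP; exists (col_mx 1%:M 0).
  by rewrite mul_row_col mulmx1 mulmx0 addr0.
rewrite /= tr_row_mx !trmx1 mul_row_block !mul1mx mul_row_col !mulmx1 ?mulmx0.
by rewrite addr0 add0r -mulr2n -scaler_nat pcharf0 // scale0r.
Qed.

Lemma metabolic_zero : metabolic (bzero F).
Proof.
split; first by split; [apply/matrixP => -[]|rewrite unitmxE det_mx00 unitr1].
exists 0%N, 0; split=> //; first by rewrite /row_free mxrank0.
by apply/matrixP => -[].
Qed.

Lemma isometric_anisotropic B C : isometric B C -> anisotropic C -> anisotropic B.
Proof.
move=> [P hP e] aC [v v0 hv]; apply: aC; exists (v *m P); last first.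
  by rewrite /tilde trmx_mul !mulmxA -(mulmxA v) -(mulmxA v) -e.
apply: contra v0 => /eqP h; have /andP[/row_freeP[Q PQ] _] := hP.
by rewrite -[v]mulmx1 -PQ mulmxA h mul0mx.
Qed.

End FormAlgebra.

(** * Derivations and differential forms *)
Section Derivations.
Variables (F : fieldType) (charF2 : 2%N \in [pchar F]).
Implicit Types (s t : seq F) (x y z : F) (D : F -> F).

Definition derivation D :=
  (forall x y, D (x + y) = D x + D y) /\
  (forall x y, D (x * y) = x * D y + y * D x).

Lemma derivation0 D : derivation D -> D 0 = 0.
Proof. by move=> [hD _]; apply: (addrI (D 0)); rewrite -hD !addr0. Qed.

Lemma derivation_sqr D x : derivation D -> D (x ^+ 2) = 0.
Proof. by move=> [_ hM]; rewrite expr2 hM addrr2. Qed.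

Lemma derivationZ D k x : derivation D -> D (k ^+ 2 * x) = k ^+ 2 * D x.
Proof. by move=> hD; rewrite hD.2 derivation_sqr // mulr0 addr0. Qed.

Lemma derivation_eq0 D s x : derivation D -> (forall y, y \in s -> D y = 0) ->
  adj2 s x -> D x = 0.
Proof.
move=> hD hs; apply: (adj2_ind (P := fun x => D x = 0)) hs x => //.
- by move=> x; apply: derivation_sqr.
- by move=> x y hx hy; rewrite hD.1 hx hy addr0.
by move=> x y hx hy; rewrite hD.2 hx hy !mulr0 addr0.
Qed.

(** By Zorn, take A maximal with x outside k(A, s), and let L = k(A, s).  If w is
outside L, then x is in L(w), hence w is in L(x) by exchange.  So F = L + x L, and D can
be the coefficient of x. *)
Lemma derivation_ex s x : ~ adj2 s x -> exists D,
  [/\ derivation D, D x = 1 & forall y, adj2 s y -> D y = 0].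
Proof.
move=> sx.
(* A is represented by its finite subsets l, so that the union of a chain needs no closure *)
pose P (A : F -> Prop) := forall l, (forall y, y \in l -> A y) -> ~ adj2 (l ++ s) x.
have [|A [PA maxA]] := @classical_sets.Zorn_bigcup F P.
  move=> C CP Ctot l hl.
  have [l0|[A CA lA]] : (l = [::]) \/ exists2 A, C A & forall y, y \in l -> A y.
  - elim: l hl => [|y l IH] hl; first by left.
    right; have [A CA Ay] := hl y (mem_head _ _).
    have [z zl|->|[B CB lB]] := IH; first by apply: hl; rewrite inE zl orbT.
      by exists A => // z; rewrite inE => /eqP ->.
    have [AB|BA] := Ctot _ _ CA CB.
      by exists B => // z; rewrite inE => /predU1P[->|/lB//]; apply: AB.
    by exists A => // z; rewrite inE => /predU1P[->//|/lB/BA].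
  - by rewrite l0.
  exact: CP CA _ lA.
pose L y := exists2 l, (forall z, z \in l -> A z) & adj2 (l ++ s) y.
have L2 y z : L y -> L z -> exists l,
    [/\ (forall w, w \in l -> A w), adj2 (l ++ s) y & adj2 (l ++ s) z].
  move=> [l hl hy] [l' hl' hz]; exists (l ++ l'); split.
  - by move=> w; rewrite mem_cat => /orP[/hl|/hl'].
  - by apply: adj2_subset hy => // w; rewrite !mem_cat => /orP[]->; rewrite ?orbT.
  by apply: adj2_subset hz => // w; rewrite !mem_cat => /orP[]->; rewrite ?orbT.
have LD y z : L y -> L z -> L (y + z).
  by move=> hy hz; have [l [hl h h']] := L2 _ _ hy hz; exists l => //; apply: adj2_D.
have LM y z : L y -> L z -> L (y * z).
  by move=> hy hz; have [l [hl h h']] := L2 _ _ hy hz; exists l => //; apply: adj2_M.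
have LV y : L y -> L y^-1.
  by move=> [l hl h]; exists l => //; apply: adj2_V.
have Lsq y : L (y ^+ 2) by exists [::] => //; apply: adj2_sqr.
have L0 : L 0 by have := Lsq 0; rewrite expr0n.
have L1 : L 1 by have := Lsq 1; rewrite expr1n.
have xL : ~ L x by move=> [l /PA].
have dec w : exists yz, [/\ L yz.1, L yz.2 & w = yz.1 + x * yz.2].
  have [Aw|Aw] := pselect (A w).
    exists (w, 0); rewrite mulr0 addr0; split=> //.
      by exists [:: w]; [move=> z; rewrite inE => /eqP ->|apply/adj2_mem/mem_head].
  have [l hl hx] : exists2 l, (forall y, y \in l -> A y \/ y = w) & adj2 (l ++ s) x.
    apply: contrapT => h.
    apply: (maxA (fun y => A y \/ y = w)) => [|l hl hx]; last by apply: h; exists l.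
    by split=> [y Ay|h']; [left|apply: Aw; apply: h'; right].
  pose l' := [seq y <- l | y != w].
  have hl' y : y \in l' -> A y.
    by rewrite mem_filter => /andP[/eqP yw /hl[]].
  have /(adj2_exchange charF2) -/(_ (PA _ hl')) : adj2 (w :: l' ++ s) x.
    apply: adj2_subset hx => // y; rewrite !(inE, mem_cat, mem_filter).
    by case: eqVneq => //= _.
  by move=> [y [z [hy hz ->]]]; exists (y, z); split=> //; exists l'.
have [f hf] := choice dec.
have fE w y z : L y -> L z -> w = y + x * z -> (f w).2 = z.
  move=> Ly Lz ew; have [Ly' Lz' ew'] := hf w; move: Ly' Lz' ew'.
  move: (f w) => [y' z'] /= Ly' Lz' ew'; apply: contrapT => /eqP ne.
  apply: xL; have -> : x = (y + y') / (z + z'); last by apply: LM; [|apply: LV]; apply: LD.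
  have n0 : z + z' != 0 by rewrite addr_eq0 oppr_pchar2 // eq_sym.
  apply: (mulIf n0); rewrite divfK //.
  have -> : y + y' = w + x * z + y' by rewrite ew addr2K.
  rewrite ew'; ring2 charF2.
exists (fun w => (f w).2); split.
- split=> u v; have [h1 h2 e] := hf u; have [h1' h2' e'] := hf v;
    move: (f u) (f v) h1 h2 e h1' h2' e' => [y z] [y' z'] /= h1 h2 -> h1' h2' ->.
    apply: (fE _ (y + y')); [exact: LD|exact: LD|ring].
  rewrite (fE _ (y * y' + x ^+ 2 * (z * z')) (y * z' + y' * z)).
  + ring2 charF2.
  + by apply: LD; [apply: LM|apply: (LM); [exact: Lsq|apply: LM]].
  + by apply: LD; apply: LM.
  ring.
- by apply: (fE _ 0); rewrite ?add0r ?mulr1.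
move=> y hy; apply: (fE _ y); rewrite ?mulr0 ?addr0 //.
by exists [::].
Qed.

End Derivations.

Section LquotLift.
Variables (R : comNzRingType) (V : lmodType R) (rel : V -> Prop) (g : V -> R).
Hypotheses (gD : forall u v, g (u + v) = g u + g v)
  (gZ : forall k u, g (k *: u) = k * g u) (grel : forall u, rel u -> g u = 0).

(** A linear map that kills the relations, on the quotient; taken on a representative. *)
Definition lquot_lift (w : lquot rel) : R := g (repr w).

Lemma lquot_liftE v : lquot_lift (lpi rel v) = g v.
Proof.
have /lpiP h : lpi rel (repr (lpi rel v)) = lpi rel v by rewrite lpi_repr.
have /eqP : g (repr (lpi rel v) - v) = 0.
  elim: h => [|k u w /grel hu _ IH]; first by rewrite -(scale0r 0) gZ mul0r.
  by rewrite gD gZ hu mulr0 add0r.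
by rewrite gD -scaleN1r gZ mulN1r subr_eq0 => /eqP.
Qed.

Lemma lquot_liftD u v : lquot_lift (u + v) = lquot_lift u + lquot_lift v.
Proof. by rewrite -[u]lpi_repr -[v]lpi_repr -lpiD !lquot_liftE gD. Qed.

Lemma lquot_liftZ k u : lquot_lift (k *: u) = k * lquot_lift u.
Proof. by rewrite -[u]lpi_repr [_ *: _]lscaleE !lquot_liftE gZ. Qed.

End LquotLift.

Section LquotFacts.
Variables (R : nzRingType) (V : lmodType R) (rel : V -> Prop).

Lemma lpi_rel v : rel v -> lpi rel v = 0.
Proof.
move=> h; have e0 : lpi rel 0 = 0 by apply: (addIr (lpi rel 0)); rewrite -lpiD !add0r.
rewrite -e0; apply/lpiP; rewrite subr0 -[v]addr0 -[v]scale1r.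
by apply: lspanP => //; apply: lspan0.
Qed.

Lemma lpiZ k v : lpi rel (k *: v) = k *: lpi rel v.
Proof. by rewrite [RHS]lscaleE. Qed.

Lemma lpiB u v : lpi rel (u - v) = lpi rel u - lpi rel v.
Proof. by rewrite lpiD -scaleN1r lpiZ scaleN1r. Qed.

End LquotFacts.

Section FreegLift.
Variables (R : comNzRingType) (K : choiceType) (f : K -> R).
Implicit Types D E : {freeg K / R}.

Definition freeg_lift D : R := fglift (f : K -> R^o) D.

Lemma freeg_liftB D E : freeg_lift (D - E) = freeg_lift D - freeg_lift E.
Proof. exact: (@lift_is_additive R K R^o f). Qed.

Lemma freeg_lift0 : freeg_lift 0 = 0.
Proof. by rewrite -(subrr 0) freeg_liftB subrr. Qed.

Lemma freeg_liftD D E : freeg_lift (D + E) = freeg_lift D + freeg_lift E.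
Proof. by rewrite -[E]opprK freeg_liftB -(sub0r (- E)) freeg_liftB freeg_lift0 sub0r. Qed.

Lemma freeg_liftU k x : freeg_lift << k *g x >> = k * f x.
Proof. exact: (@liftU R R^o K f k x). Qed.

Lemma freeg_liftZ k D : freeg_lift (k *: D) = k * freeg_lift D.
Proof.
have hs := big_morph freeg_lift freeg_liftD freeg_lift0.
rewrite -[in RHS](freeg_sumE D) [k *: D]/(fgscale k D) /fgscale !hs mulr_sumr.
by apply: eq_bigr => x _; rewrite !freeg_liftU mulrA.
Qed.

End FreegLift.

Section DifferentialForms.
Variables (F : fieldType) (charF2 : 2%N \in [pchar F]).
Implicit Types (s t : seq F) (x y z : F) (D : F -> F).

(** The value of a differential 1-form on a derivation. *)
Definition pair1 D (w : Omega1 F) : F := lquot_lift (freeg_lift D) w.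

Section Pair1.
Variables (D : F -> F) (hD : derivation D).
Let gr u : kahler_rel u -> freeg_lift D u = 0.
Proof.
case=> x y; rewrite !freeg_liftB ?freeg_liftZ !freeg_liftU !mul1r.
  by rewrite hD.1; ring.
by rewrite hD.2; ring.
Qed.

Lemma pair1_kd x : pair1 D (kd x) = D x.
Proof.
rewrite /pair1 /kd lquot_liftE ?freeg_liftU ?mul1r //.
- exact: freeg_liftD.
- exact: freeg_liftZ.
Qed.

Lemma pair1D u v : pair1 D (u + v) = pair1 D u + pair1 D v.
Proof. by apply: lquot_liftD => //; [exact: freeg_liftD|exact: freeg_liftZ]. Qed.

Lemma pair1Z k u : pair1 D (k *: u) = k * pair1 D u.
Proof. by apply: lquot_liftZ => //; [exact: freeg_liftD|exact: freeg_liftZ]. Qed.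

End Pair1.

(** The value of a differential 2-form on a pair of derivations. *)
Definition pair2 D1 D2 (w : Omega2 F) : F :=
  lquot_lift (freeg_lift (fun p => pair1 D1 p.1 * pair1 D2 p.2
                                   - pair1 D2 p.1 * pair1 D1 p.2)) w.

Section Pair2.
Variables (D1 D2 : F -> F) (hD1 : derivation D1) (hD2 : derivation D2).
Let gr u : ext2_rel u ->
  freeg_lift (fun p => pair1 D1 p.1 * pair1 D2 p.2 - pair1 D2 p.1 * pair1 D1 p.2) u = 0.
Proof.
case=> [k x y z|k x y z|x];
  rewrite ?freeg_liftB ?freeg_liftZ !freeg_liftU !mul1r /= ?(pair1D hD1)
    ?(pair1D hD2) ?(pair1Z hD1) ?(pair1Z hD2); ring.
Qed.

Lemma pair2_wedge u v :
  pair2 D1 D2 (wedge u v) = pair1 D1 u * pair1 D2 v - pair1 D2 u * pair1 D1 v.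
Proof.
rewrite /pair2 /wedge lquot_liftE ?freeg_liftU ?mul1r //.
- exact: freeg_liftD.
- exact: freeg_liftZ.
Qed.

Lemma pair2D u v : pair2 D1 D2 (u + v) = pair2 D1 D2 u + pair2 D1 D2 v.
Proof. by apply: lquot_liftD => //; [exact: freeg_liftD|exact: freeg_liftZ]. Qed.

Lemma pair2Z k u : pair2 D1 D2 (k *: u) = k * pair2 D1 D2 u.
Proof. by apply: lquot_liftZ => //; [exact: freeg_liftD|exact: freeg_liftZ]. Qed.

Lemma pair2_0 : pair2 D1 D2 0 = 0.
Proof. by rewrite -(scale0r 0) pair2Z mul0r. Qed.

Lemma pair2_dlog x y : x != 0 -> y != 0 ->
  pair2 D1 D2 (wedge (dlog x) (dlog y)) = (D1 x * D2 y - D2 x * D1 y) / (x * y).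
Proof.
by move=> x0 y0; rewrite pair2_wedge /dlog !pair1Z // !pair1_kd //; field; rewrite x0 y0.
Qed.

End Pair2.

Lemma kdD x y : kd (x + y) = kd x + kd y.
Proof.
have := lpi_rel (kahlerD x y); rewrite !lpiB => /eqP.
by rewrite subr_eq0 subr_eq => /eqP e; rewrite [LHS]e addrC.
Qed.

Lemma kdM x y : kd (x * y) = x *: kd y + y *: kd x.
Proof.
have := lpi_rel (kahlerM x y); rewrite !lpiB !lpiZ => /eqP.
by rewrite subr_eq0 subr_eq => /eqP e; rewrite [LHS]e addrC.
Qed.

Lemma addvv2 (V : lmodType F) (v : V) : v + v = 0.
Proof. by rewrite -mulr2n -scaler_nat pcharf0 // scale0r. Qed.

Lemma kd_sqr x : kd (x ^+ 2) = 0.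
Proof. by rewrite expr2 kdM addvv2. Qed.

Lemma wedgeDZl k u v (w : Omega1 F) : wedge (k *: u + v) w = k *: wedge u w + wedge v w.
Proof.
have := lpi_rel (ext2_l k u v w); rewrite !lpiB !lpiZ => /eqP.
by rewrite subr_eq0 subr_eq => /eqP e; rewrite [LHS]e addrC.
Qed.

Lemma wedgeDZr k u v (w : Omega1 F) : wedge w (k *: u + v) = k *: wedge w u + wedge w v.
Proof.
have := lpi_rel (ext2_r k u v w); rewrite !lpiB !lpiZ => /eqP.
by rewrite subr_eq0 subr_eq => /eqP e; rewrite [LHS]e addrC.
Qed.

Lemma wedge_alt (u : Omega1 F) : wedge u u = 0.
Proof. exact: lpi_rel (ext2_alt u). Qed.

Lemma wedgeDl u v (w : Omega1 F) : wedge (u + v) w = wedge u w + wedge v w.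
Proof. by have := wedgeDZl 1 u v w; rewrite !scale1r. Qed.

Lemma wedgeDr u v (w : Omega1 F) : wedge w (u + v) = wedge w u + wedge w v.
Proof. by have := wedgeDZr 1 u v w; rewrite !scale1r. Qed.

Lemma wedge0l (w : Omega1 F) : wedge 0 w = 0.
Proof. by apply: (addIr (wedge 0 w)); rewrite -wedgeDl !add0r. Qed.

Lemma wedge0r (w : Omega1 F) : wedge w 0 = 0.
Proof. by apply: (addIr (wedge w 0)); rewrite -wedgeDr !add0r. Qed.

Lemma wedgeZl k u (w : Omega1 F) : wedge (k *: u) w = k *: wedge u w.
Proof. by have := wedgeDZl k u 0 w; rewrite wedge0l !addr0. Qed.

Lemma wedgeZr k u (w : Omega1 F) : wedge w (k *: u) = k *: wedge w u.
Proof. by have := wedgeDZr k u 0 w; rewrite wedge0r !addr0. Qed.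

Lemma wedgeC (u v : Omega1 F) : wedge u v = wedge v u.
Proof.
have := wedge_alt (u + v); rewrite wedgeDl !wedgeDr !wedge_alt add0r addr0 => e.
by rewrite -[RHS]add0r -e -addrA addvv2 addr0.
Qed.

Lemma dlogM x y : x != 0 -> y != 0 -> dlog (x * y) = dlog x + dlog y.
Proof.
move=> x0 y0; rewrite /dlog kdM scalerDr !scalerA [LHS]addrC.
by congr (_ *: _ + _ *: _); field; rewrite x0 y0.
Qed.

Lemma dlog_sqr x : dlog (x ^+ 2) = 0.
Proof. by rewrite /dlog kd_sqr scaler0. Qed.

(** The relation behind the isometry of <x, y> with <x + y, (x + y) x y>. *)
Lemma wedge_dlogD x y : x != 0 -> y != 0 -> x + y != 0 ->
  wedge (dlog (x + y)) (dlog (x * y)) = wedge (dlog x) (dlog y).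
Proof.
move=> x0 y0 xy0; rewrite dlogM // /dlog kdD !wedgeDr !wedgeZl !wedgeZr !wedgeDl.
rewrite !wedge_alt add0r addr0 (wedgeC (kd y)) -scalerDr !scalerA -scalerDl.
by rewrite scalerA; congr (_ *: _); field; rewrite x0 y0 xy0.
Qed.

(** The span of the differentials of the elements of s, and below the span of the
products of two of them, in a shape that allows induction on s. *)
Fixpoint dspan1 s (w : Omega1 F) : Prop :=
  if s is x :: s' then exists c w', dspan1 s' w' /\ w = c *: kd x + w'
  else w = 0.

Fixpoint dspan2 s (w : Omega2 F) : Prop :=
  if s is x :: s' then exists u w',
    [/\ dspan1 s' u, dspan2 s' w' & w = wedge (kd x) u + w']
  else w = 0.

Lemma dspan1_0 s : dspan1 s 0.
Proof. by elim: s => //= x s IH; exists 0, 0; rewrite scale0r add0r. Qed.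

Lemma dspan1_DZ s k u v : dspan1 s u -> dspan1 s v -> dspan1 s (k *: u + v).
Proof.
elim: s u v => [|x s IH] u v /=; first by move=> -> ->; rewrite scaler0 addr0.
move=> [c [u' [hu ->]]] [d [v' [hv ->]]]; exists (k * c + d), (k *: u' + v').
by split; [exact: IH|rewrite scalerDr scalerA scalerDl addrACA].
Qed.

Lemma dspan1_Z s k u : dspan1 s u -> dspan1 s (k *: u).
Proof. by move=> h; rewrite -[_ *: _]addr0; apply: dspan1_DZ => //; apply: dspan1_0. Qed.

Lemma dspan1_D s u v : dspan1 s u -> dspan1 s v -> dspan1 s (u + v).
Proof. by move=> hu hv; rewrite -[u]scale1r; apply: dspan1_DZ. Qed.

Lemma dspan1_kd s x : adj2 s x -> dspan1 s (kd x).
Proof.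
elim: s x => [|a s IH] x /=; first by move=> [y ->]; rewrite kd_sqr.
move=> [y [z [/IH hy /IH hz ->]]]; exists z, (kd y + a *: kd z).
split; last by rewrite kdD kdM addrCA (addrC (a *: _)) addrCA addrA addrAC -addrA.
by apply: dspan1_D => //; apply: dspan1_Z.
Qed.

Lemma dspan2_0 s : dspan2 s 0.
Proof.
elim: s => //= x s IH; exists 0, 0; rewrite wedge0r add0r; split=> //.
exact: dspan1_0.
Qed.

Lemma dspan2_D s u v : dspan2 s u -> dspan2 s v -> dspan2 s (u + v).
Proof.
elim: s u v => [|x s IH] u v /=; first by move=> -> ->; rewrite addr0.
move=> [c [u' [hc hu ->]]] [d [v' [hd hv ->]]]; exists (c + d), (u' + v').
by split; [exact: dspan1_D|exact: IH|rewrite wedgeDr addrACA].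
Qed.

Lemma dspan2_wedge s u v : dspan1 s u -> dspan1 s v -> dspan2 s (wedge u v).
Proof.
elim: s u v => [|x s IH] u v /=; first by move=> -> ->; rewrite wedge0l.
move=> [c [u' [hu ->]]] [d [v' [hv ->]]]; exists (c *: v' + d *: u'), (wedge u' v').
split; [exact/dspan1_DZ/dspan1_Z|exact: IH|].
rewrite !wedgeDl !wedgeDr !wedgeZl !wedgeZr wedge_alt !scaler0 add0r addrA.
by rewrite (wedgeC u').
Qed.

Lemma pair1_vanish s D w : derivation D -> (forall y, y \in s -> D y = 0) ->
  dspan1 s w -> pair1 D w = 0.
Proof.
move=> hD; elim: s w => [|y t IHt] w Dt /=.
  by move=> ->; rewrite -(scale0r 0) pair1Z // mul0r.
move=> [d [u' [hu ->]]]; rewrite pair1D // pair1Z // pair1_kd // Dt ?mem_head //.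
by rewrite mulr0 add0r IHt // => z hz; apply: Dt; rewrite inE hz orbT.
Qed.

Lemma dspan1_sep s w : dspan1 s w ->
  (forall D, derivation D -> pair1 D w = 0) -> w = 0.
Proof.
elim: s w => [|x s IH] w //= [c [w' [hw ->]]] h.
have [sx|sx] := pselect (adj2 s x).
  by apply: IH h; apply: dspan1_DZ => //; apply: dspan1_kd.
have [D [hD Dx Ds]] := derivation_ex charF2 sx.
have Ds' y : y \in s -> D y = 0 by move=> hy; apply/Ds/adj2_mem.
have := h D hD; rewrite pair1D // pair1Z // pair1_kd // Dx mulr1.
rewrite (pair1_vanish hD Ds' hw) addr0 => c0.
by move: h; rewrite c0 scale0r add0r => h; apply: IH.
Qed.

Lemma pair2_vanish s D1 D2 w : derivation D1 -> derivation D2 ->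
  (forall y, y \in s -> D1 y = 0) -> dspan2 s w -> pair2 D1 D2 w = 0.
Proof.
move=> hD1 hD2; elim: s w => [|y t IHt] w Dt /=.
  by move=> ->; rewrite pair2_0.
have Dt' z : z \in t -> D1 z = 0 by move=> hz; apply: Dt; rewrite inE hz orbT.
move=> [u [w' [hu hw ->]]]; rewrite pair2D // pair2_wedge // (IHt w') // addr0.
by rewrite (pair1_vanish hD1 Dt' hu) pair1_kd // Dt ?mem_head // mul0r mulr0 subrr.
Qed.

(** Induction on the list.  If x is in k(s), then dx is in the span of ds.  Otherwise
some derivation D has D x = 1 and D s = 0; contracting dx u + w' with D leaves u, so u
pairs to zero with every derivation and vanishes. *)
Lemma dspan2_sep s w : dspan2 s w ->
  (forall D1 D2, derivation D1 -> derivation D2 -> pair2 D1 D2 w = 0) -> w = 0.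
Proof.
elim: s w => [|x s IH] w //= [u [w' [hu hw ->]]] h.
have [sx|sx] := pselect (adj2 s x).
  by apply: IH h; apply: dspan2_D => //; apply: dspan2_wedge => //; apply: dspan1_kd.
have [D [hD Dx Ds]] := derivation_ex charF2 sx.
have Ds' y : y \in s -> D y = 0 by move=> hy; apply/Ds/adj2_mem.
have u0 : u = 0.
  apply: (dspan1_sep hu) => E hE; rewrite -[RHS](h D E hD hE) pair2D // pair2_wedge //.
  rewrite (pair2_vanish hD hE Ds' hw) (pair1_vanish hD Ds' hu) pair1_kd // Dx; ring.
by move: h; rewrite u0 wedge0r add0r => h; apply: IH.
Qed.

Lemma dspan1_sub s t w : {subset s <= t} -> dspan1 s w -> dspan1 t w.
Proof.
elim: s w => [|x s IH] w st /=; first by move=> ->; apply: dspan1_0.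
move=> [c [w' [hw ->]]]; apply: dspan1_DZ.
  by apply/dspan1_kd/adj2_mem/st/mem_head.
by apply: IH hw => z hz; apply: st; rewrite inE hz orbT.
Qed.

Lemma dspan2_sub s t w : {subset s <= t} -> dspan2 s w -> dspan2 t w.
Proof.
elim: s w => [|x s IH] w st /=; first by move=> ->; apply: dspan2_0.
have st' : {subset s <= t} by move=> z hz; apply: st; rewrite inE hz orbT.
move=> [u [w' [hu hw ->]]]; apply: dspan2_D; last exact: IH hw.
apply: dspan2_wedge; last exact: dspan1_sub hu.
by apply/dspan1_kd/adj2_mem/st/mem_head.
Qed.

Lemma symbol_sum_span (s : seq (F * F)) : exists t, dspan2 t (symbol_sum s).
Proof.
rewrite /symbol_sum; elim: s => [|p s [t IH]]; first by exists [::]; rewrite big_nil.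
exists (p.1 :: p.2 :: t); rewrite big_cons; apply: dspan2_D.
  by apply: dspan2_wedge; apply/dspan1_Z/dspan1_kd/adj2_mem;
    rewrite !inE eqxx ?orbT.
by apply: dspan2_sub IH => z hz; rewrite !inE hz !orbT.
Qed.

(** Pairs of derivations separate sums of symbols. *)
Lemma symbol_sum_eq (s t : seq (F * F)) :
  (forall D1 D2, derivation D1 -> derivation D2 ->
     pair2 D1 D2 (symbol_sum s) = pair2 D1 D2 (symbol_sum t)) ->
  symbol_sum s = symbol_sum t.
Proof.
move=> h; have [u hu] := symbol_sum_span (s ++ t).
have cat0 : symbol_sum (s ++ t) = symbol_sum s + symbol_sum t.
  exact: big_cat.
have /eqP : symbol_sum s + symbol_sum t = 0.
  rewrite -cat0; apply: dspan2_sep hu _ => D1 D2 hD1 hD2.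
  by rewrite cat0 pair2D // (h _ _ hD1 hD2) addrr2.
by rewrite addr_eq0 => /eqP ->; apply/esym/eqP; rewrite -addr_eq0 addvv2.
Qed.

End DifferentialForms.

(** * The invariant e2 is well defined *)
Section MatrixDerivation.
Variables (F : fieldType) (D : F -> F) (hD : derivation D).
Local Notation "A ^D" := (map_mx D A) (at level 2, format "A ^D").

Lemma derivation_sum (I : Type) (r : seq I) (P : pred I) (f : I -> F) :
  D (\sum_(i <- r | P i) f i) = \sum_(i <- r | P i) D (f i).
Proof. exact: (big_morph D hD.1 (derivation0 hD)). Qed.

Lemma map_deriv_mulmx m n p (A : 'M[F]_(m, n)) (B : 'M_(n, p)) :
  (A *m B)^D = A *m B^D + A^D *m B.
Proof.
apply/matrixP => i j; rewrite !mxE derivation_sum -big_split.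
by apply: eq_bigr => k _; rewrite !mxE hD.2 (mulrC (B k j)).
Qed.

Lemma derivation1 : D 1 = 0.
Proof.
have := hD.2 1 1; rewrite !mul1r => e; apply: (addrI (D 1)).
by rewrite -e addr0.
Qed.

Lemma map_deriv1 n : (1%:M : 'M[F]_n)^D = 0.
Proof.
apply/matrixP => i j; rewrite !mxE; case: (i == j); first exact: derivation1.
exact: derivation0.
Qed.

Lemma map_deriv0 m n : (0 : 'M[F]_(m, n))^D = 0.
Proof. by apply/matrixP => i j; rewrite !mxE derivation0. Qed.

Lemma map_deriv_tens m n p q (A : 'M[F]_(m, n)) (B : 'M_(p, q)) :
  (A *t B)^D = A *t B^D + A^D *t B.
Proof. by apply/matrixP => i j; rewrite !mxE hD.2 (mulrC (B _ _)). Qed.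

End MatrixDerivation.

Section Invariants.
Variables (F : fieldType) (charF2 : 2%N \in [pchar F]).
Implicit Types (D : F -> F) (C M : bform F).

(** Since D(det G) / det G = tr(G^-1 D G), this is the value at D of the logarithmic
differential of the determinant. *)
Definition e1_at D (B : bform F) := \tr (invmx (gram B) *m map_mx D (gram B)).
(** For a diagonal form <a_1, ..., a_n> this is the sum of D1(a_i) D2(a_i) / a_i^2.  On
I^2 it is the value at (D1, D2) of the invariant e^2, by [e2_at_pfister] and
[e_at_Ipow]. *)
Definition e2_at D1 D2 (B : bform F) :=
  \tr (invmx (gram B) *m map_mx D1 (gram B) *m (invmx (gram B) *m map_mx D2 (gram B))).

Section Invariance.
Variables (n : nat) (S : 'M[F]_n).
Hypothesis symS : S^T = S.
Let f (A B : 'M[F]_n) := \tr (S *m A *m (S *m B)).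
Let fC (A B : 'M[F]_n) : f A B = f B A. Proof. exact: mxtrace_mulC. Qed.
Let fT (A B : 'M[F]_n) : f A^T B^T = f A B.
Proof.
rewrite fC /f -mxtrace_tr !trmx_mul !trmxK symS mulmxA mxtrace_mulC.
by rewrite !mulmxA.
Qed.
Let fDl (A A' B : 'M[F]_n) : f (A + A') B = f A B + f A' B.
Proof. by rewrite /f mulmxDr mulmxDl raddfD. Qed.
Let fDr (A A' B : 'M[F]_n) : f B (A + A') = f B A + f B A'.
Proof. by rewrite fC fDl !(fC B). Qed.

Lemma trace_sym1 (Y E : 'M[F]_n) :
  \tr (S *m (Y + E + Y^T)) = \tr (S *m E).
Proof.
rewrite !mulmxDr !raddfD /= addrAC -(mxtrace_tr (S *m Y^T)) trmx_mul trmxK symS.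
by rewrite mxtrace_mulC addrr2 // add0r.
Qed.

(** The bilinear form f(A, B) = tr(S A S B) is symmetric and invariant under
transposition of both arguments.  So all terms that involve Y1 or Y2 occur twice. *)
Lemma trace_sym2 (Y1 E1 Y2 E2 : 'M[F]_n) : E1^T = E1 -> E2^T = E2 ->
  \tr (S *m (Y1 + E1 + Y1^T) *m (S *m (Y2 + E2 + Y2^T))) =
  \tr (S *m E1 *m (S *m E2)).
Proof.
move=> s1 s2; rewrite -![\tr _]/(f _ _) !(fDl, fDr).
have -> : f Y1^T E2 = f Y1 E2 by rewrite -[in LHS]s2 fT.
have -> : f E1 Y2^T = f E1 Y2 by rewrite -[in LHS]s1 fT.
have -> : f Y1^T Y2 = f Y1 Y2^T by rewrite -[in RHS]fT trmxK.
rewrite fT; ring2 charF2.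
Qed.
End Invariance.

Lemma map_deriv_congr D n (G P : 'M[F]_n) : derivation D -> P \in unitmx ->
  map_mx D (P *m G *m P^T) =
  P *m (invmx P *m map_mx D P *m G + map_mx D G
        + G *m (invmx P *m map_mx D P)^T) *m P^T.
Proof.
move=> hD uP; set X := invmx P *m map_mx D P.
have eX : map_mx D P = P *m X by rewrite mulKVmx.
move: X eX => X eX; rewrite !(map_deriv_mulmx hD) -map_trmx eX trmx_mul.
rewrite !(mulmxDr, mulmxDl) !mulmxA [LHS]addrC.
by congr (_ + _); apply: addrC.
Qed.

Lemma invmx_congr n (G P : 'M[F]_n) : G \in unitmx -> P \in unitmx ->
  invmx (P *m G *m P^T) = invmx P^T *m invmx G *m invmx P.
Proof.
move=> uG uP; have uT : P^T \in unitmx by rewrite unitmx_tr.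
have uGP : P *m G *m P^T \in unitmx by rewrite !unitmx_mul uP uG.
apply: (can_inj (mulKmx uGP)); rewrite mulmxV // !mulmxA mulmxK //.
by rewrite mulmxK // mulmxV.
Qed.

(** With X = P^-1 D P, the logarithmic derivative of P G P^T is conjugate to G^-1 (X G +
D G + (X G)^T), to which [trace_sym2] applies. *)
Lemma log_deriv_congr D n (G P : 'M[F]_n) : derivation D ->
  G \in unitmx -> P \in unitmx ->
  invmx (P *m G *m P^T) *m map_mx D (P *m G *m P^T) =
  invmx P^T *m (invmx G *m (invmx P *m map_mx D P *m G + map_mx D G
     + G *m (invmx P *m map_mx D P)^T)) *m P^T.
Proof.
move=> hD uG uP; rewrite map_deriv_congr // invmx_congr //.
by rewrite -!mulmxA mulKmx.
Qed.

Lemma e_at_isometric B C D1 D2 : derivation D1 -> derivation D2 ->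
  bilinear_form C -> isometric B C ->
  e1_at D1 B = e1_at D1 C /\ e2_at D1 D2 B = e2_at D1 D2 C.
Proof.
move=> hD1 hD2; case: C => m H [/= sH uH] h; have := isometric_dim h.
case: B h => [n G] h /= e; subst n; move: h => /isometricP[P uP ->].
rewrite /e1_at /e2_at /= !log_deriv_congr //.
have uT : P^T \in unitmx by rewrite unitmx_tr.
have sV : (invmx H)^T = invmx H by rewrite trmx_inv sH.
have sD D : (map_mx D H)^T = map_mx D H by rewrite map_trmx sH.
have eT (X : 'M[F]_m) : H *m X^T = (X *m H)^T by rewrite trmx_mul sH.
have trJ (A : 'M[F]_m) : \tr (invmx P^T *m A *m P^T) = \tr A.
  by rewrite mxtrace_mulC mulKVmx.
have mulJ (A B : 'M[F]_m) : invmx P^T *m A *m P^T *m (invmx P^T *m B *m P^T) =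
    invmx P^T *m (A *m B) *m P^T by rewrite !mulmxA mulmxK.
by rewrite !eT mulJ !trJ trace_sym1 // trace_sym2.
Qed.

Lemma e1_at_orth D (B C : bform F) : bilinear_form B -> bilinear_form C -> derivation D ->
  e1_at D (orth B C) = e1_at D B + e1_at D C.
Proof.
move=> [_ uB] [_ uC] hD; rewrite /e1_at /= invmx_block_diag; last first.
  by rewrite unitmxE det_ublock unitrM -!unitmxE uB.
rewrite map_block_mx !(map_deriv0 hD) mulmx_block mxtrace_block.
by rewrite !(mul0mx, mulmx0, addr0, add0r).
Qed.

Lemma e2_at_orth D1 D2 (B C : bform F) : bilinear_form B -> bilinear_form C ->
  derivation D1 -> derivation D2 ->
  e2_at D1 D2 (orth B C) = e2_at D1 D2 B + e2_at D1 D2 C.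
Proof.
move=> [_ uB] [_ uC] hD1 hD2; rewrite /e2_at /= invmx_block_diag; last first.
  by rewrite unitmxE det_ublock unitrM -!unitmxE uB.
rewrite !map_block_mx (map_deriv0 hD1) (map_deriv0 hD2) !mulmx_block.
rewrite mxtrace_block.
by rewrite !(mul0mx, mulmx0, addr0, add0r).
Qed.

(** Read off from the elimination W = L (1 0) R: keep the last k rows of R. *)
Lemma row_free_extend r k (W : 'M[F]_(r, r + k)) : row_free W ->
  exists V : 'M_(k, r + k), col_mx W V \in unitmx.
Proof.
move=> fW; have := mulmx_ebase W; rewrite (eqP fW) pid_mx_row => eW.
exists (dsubmx (row_ebase W)).
rewrite -{1}eW mul_mx_row mulmx1 mulmx0.
have -> : col_mx (row_mx (col_ebase W) 0 *m row_ebase W) (dsubmx (row_ebase W)) =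
    block_mx (col_ebase W) 0 0 1%:M *m row_ebase W.
  rewrite -[row_ebase W in RHS]vsubmxK mul_block_col !mul0mx mul1mx add0r addr0.
  by rewrite -{1}[row_ebase W]vsubmxK mul_row_col mul0mx addr0.
rewrite unitmx_mul row_ebase_unit andbT unitmxE det_ublock det1 mulr1.
by rewrite -unitmxE col_ebase_unit.
Qed.

(** Extend a basis of the totally isotropic half to a basis of the whole space and
normalize the off-diagonal block. *)
Lemma metabolic_split M : metabolic M -> exists r (Z : 'M[F]_r),
  isometric M (BForm (block_mx 0 1%:M 1%:M Z)).
Proof.
move=> [[sM uM] [r [W [fW W0 dM]]]]; case: M sM uM W fW W0 dM => n G /= sG uG W fW W0 dM.
have e : n = (r + r)%N by rewrite dM addnn.
move: sG uG W fW W0 {dM}; move: G; rewrite e => G sG uG W fW W0.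
have [V uP] := row_free_extend fW.
pose A := W *m G *m V^T; pose Z := V *m G *m V^T.
have eN : col_mx W V *m G *m (col_mx W V)^T = block_mx 0 A A^T Z.
  rewrite mul_col_mx tr_col_mx mul_col_row W0 /A /Z.
  by rewrite !trmx_mul trmxK sG mulmxA.
have uN : block_mx 0 A A^T Z \in unitmx by rewrite -eN !unitmx_mul uP uG unitmx_tr.
have uA : A \in unitmx.
  rewrite -row_free_unit -kermx_eq0; apply/eqP/row_matrixP => i; rewrite row0.
  have := mulmx_ker A => /(congr1 (row i)); rewrite row_mul row0.
  move: (row i _) => u uA0.
  have : row_mx u 0 *m block_mx 0 A A^T Z = 0.
    by rewrite mul_row_block mulmx0 uA0 !mul0mx !addr0 row_mx0.
  move=> /(congr1 (mulmx^~ (invmx (block_mx 0 A A^T Z)))).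
  by rewrite mulmxK // mul0mx -row_mx0 => /eq_row_mx[].
exists r, Z; apply: isometric_sym; apply/isometricP.
exists (block_mx (invmx A) 0 0 1%:M *m col_mx W V).
  by rewrite unitmx_mul uP andbT unitmxE det_ublock det1 mulr1 -unitmxE unitmx_inv.
rewrite trmx_mul !mulmxA -(mulmxA _ (col_mx W V)) -(mulmxA _ (_ *m G)) eN.
rewrite tr_block_mx !mulmx_block trmx1 !trmx0.
rewrite !(mul0mx, mulmx0, addr0, add0r, mul1mx, mulmx1) mulVmx //.
by rewrite trmx_inv mulmxV ?unitmx_tr.
Qed.

(** For the Gram matrix of [metabolic_split], G^-1 D G is strictly block triangular. *)
Lemma e_at_metabolic D1 D2 M : derivation D1 -> derivation D2 -> metabolic M ->
  e1_at D1 M = 0 /\ e2_at D1 D2 M = 0.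
Proof.
move=> hD1 hD2 mM; have [r [Z iZ]] := metabolic_split mM.
have bZ := bilinear_isometric (isometric_sym iZ) mM.1.
have [-> ->] := e_at_isometric hD1 hD2 bZ iZ.
have eV : block_mx Z 1%:M 1%:M 0 *m block_mx 0 1%:M 1%:M Z = 1%:M.
  rewrite mulmx_block !(mulmx0, mul0mx, mulmx1, mul1mx, addr0, add0r).
  by rewrite addvv2 // -scalar_mx_block.
have iV : invmx (block_mx 0 1%:M 1%:M Z) = block_mx Z 1%:M 1%:M 0.
  by apply: (can_inj (mulmxK bZ.2)); rewrite eV mulVmx // bZ.2.
rewrite /e1_at /e2_at /= iV !map_block_mx !(map_deriv0 hD1) !(map_deriv0 hD2).
rewrite !(map_deriv1 hD1) !(map_deriv1 hD2) !mulmx_block !mxtrace_block.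
by rewrite !(mulmx0, mul0mx, addr0, mxtrace0).
Qed.

Lemma mxtrace_tens m n (A : 'M[F]_m) (B : 'M_n) : \tr (A *t B) = \tr A * \tr B.
Proof. by rewrite /mxtrace mulr_sum; apply: eq_bigr => k _; rewrite mxE. Qed.

Lemma invmx_tens m n (G : 'M[F]_m) (H : 'M_n) : G \in unitmx -> H \in unitmx ->
  invmx (G *t H) = invmx G *t invmx H.
Proof.
move=> uG uH; have uT := tens_unitmx uG uH.
by apply: (can_inj (mulmxK uT)); rewrite tens_mulV // mulVmx.
Qed.

Lemma log_deriv_tens D m n (G : 'M[F]_m) (H : 'M_n) : derivation D ->
  G \in unitmx -> H \in unitmx ->
  invmx (G *t H) *m map_mx D (G *t H) =
  1%:M *t (invmx H *m map_mx D H) + (invmx G *m map_mx D G) *t 1%:M.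
Proof.
move=> hD uG uH; rewrite invmx_tens // (map_deriv_tens hD) mulmxDr !tensmx_mul.
by rewrite !mulVmx.
Qed.

Lemma e1_at_tensor D (B C : bform F) : derivation D -> bilinear_form B -> bilinear_form C ->
  e1_at D (tensor B C) = (bdim B)%:R * e1_at D C + e1_at D B * (bdim C)%:R.
Proof.
move=> hD [_ uB] [_ uC]; rewrite /e1_at /= log_deriv_tens // raddfD /= !mxtrace_tens.
by rewrite !mxtrace1.
Qed.

(** The logarithmic derivative of G tensor H is 1 tensor (H^-1 D H) + (G^-1 D G) tensor
1. *)
Lemma e2_at_tensor D1 D2 (B C : bform F) : derivation D1 -> derivation D2 ->
  bilinear_form B -> bilinear_form C ->
  e2_at D1 D2 (tensor B C) =
    (bdim B)%:R * e2_at D1 D2 C + e1_at D2 B * e1_at D1 C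
    + e1_at D1 B * e1_at D2 C + e2_at D1 D2 B * (bdim C)%:R.
Proof.
move=> hD1 hD2 [_ uB] [_ uC]; rewrite /e2_at /e1_at /= !log_deriv_tens //.
rewrite !mulmxDr !mulmxDl !tensmx_mul !mulmx1 !mul1mx !raddfD /= !mxtrace_tens.
rewrite !mxtrace1; ring.
Qed.

Lemma natr_even n : ~~ odd n -> n%:R = 0 :> F.
Proof. by move=> /even_halfK <-; rewrite -muln2 natrM [2%:R]pcharf0 // mulr0. Qed.

Lemma e_at_witt B C D1 D2 : derivation D1 -> derivation D2 ->
  bilinear_form B -> bilinear_form C -> witt_equiv B C ->
  [/\ odd (bdim B) = odd (bdim C), e1_at D1 B = e1_at D1 C &
      e2_at D1 D2 B = e2_at D1 D2 C].
Proof.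
move=> hD1 hD2 bB bC [M [M' [mM mM' h]]].
have bCM := bilinear_orth bC mM'.1.
have [] := e_at_isometric hD1 hD2 bCM h.
rewrite !e1_at_orth ?e2_at_orth //; try exact: mM.1; try exact: mM'.1.
have [-> ->] := e_at_metabolic hD1 hD2 mM; have [-> ->] := e_at_metabolic hD1 hD2 mM'.
rewrite !addr0 => -> ->; split=> //.
have := isometric_dim h => /= /(congr1 odd); rewrite !oddD.
by case: mM => _ [r [W [_ _ ->]]]; case: mM' => _ [r' [W' [_ _ ->]]]; rewrite !odd_double !addbF.
Qed.

(** By induction, with [e1_at_tensor] and [e2_at_tensor]: each tensor factor of even
dimension kills one more invariant among the dimension, [e1_at] and [e2_at]. *)
Lemma e_at_Ipow n B : in_Ipow n B ->
  [/\ bilinear_form B, (0 < n)%N -> ~~ odd (bdim B),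
    (1 < n)%N -> forall D, derivation D -> e1_at D B = 0 &
    (2 < n)%N -> forall D1 D2, derivation D1 -> derivation D2 -> e2_at D1 D2 B = 0].
Proof.
elim=> {n B} [B bB|n B C bB oB hC [bC o1 i1 i2]|n|n B C _ [bB oB B1 B2] _ [bC oC C1 C2]|n B C bC w _ [bB oB B1 B2]].
- by [].
- split=> [|_|hn D hD|hn D1 D2 hD1 hD2]; first exact: bilinear_tensor.
  + by rewrite /= oddM negb_and oB.
  + by rewrite e1_at_tensor // (natr_even oB) (natr_even (o1 hn)) mul0r mulr0 addr0.
  rewrite e2_at_tensor // !i1 // (natr_even oB) (natr_even (o1 _)) ?mulr0 ?mul0r ?addr0 //.
  exact: ltnW hn.
- have h0 := metabolic_zero F; split=> // [|_ D hD|_ D1 D2 hD1 hD2]; first exact: h0.1.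
    by have [] := e_at_metabolic hD hD h0.
  by have [] := e_at_metabolic hD1 hD2 h0.
- split=> [|h|h D hD|h D1 D2 hD1 hD2]; first exact: bilinear_orth.
  + by rewrite /= oddD (negPf (oB h)) (negPf (oC h)).
  + by rewrite e1_at_orth // B1 // C1 // addr0.
  by rewrite e2_at_orth // B2 // C2 // addr0.
split=> // [h|h D hD|h D1 D2 hD1 hD2].
- have d0 : derivation (fun _ : F => 0) by split=> *; rewrite ?mulr0 ?addr0.
  by have [<- _ _] := e_at_witt d0 d0 bB bC w; apply: oB.
- by have [_ <- _] := e_at_witt hD hD bB bC w; apply: B1.
by have [_ _ <-] := e_at_witt hD1 hD2 bB bC w; apply: B2.
Qed.

Lemma e2_at_diagb D1 D2 s : derivation D1 -> derivation D2 -> all (fun x => x != 0) s ->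
  e2_at D1 D2 (diagb s) = \sum_(x <- s) D1 x * D2 x / x ^+ 2.
Proof.
move=> hD1 hD2 hs; have [_ us] := bilinear_diagb hs.
have nz (i : 'I_(size s)) : s`_i != 0 by apply: (allP hs); apply: mem_nth.
have eV : invmx (gram (diagb s)) = diag_mx (\row_(i < size s) (s`_i)^-1).
  apply: (can_inj (mulmxK us)); rewrite mulVmx //=.
  apply/matrixP => i j; rewrite mul_diag_mx !mxE; case: eqVneq => [->|_]; last by rewrite mulr0.
  by rewrite mulVf.
have eD D : derivation D -> map_mx D (gram (diagb s)) = diag_mx (\row_(i < size s) D s`_i).
  move=> hD; apply/matrixP => i j; rewrite !mxE; case: (i == j) => //.
  exact: derivation0.
rewrite /e2_at eV !eD // (big_nth 0) big_mkord /mxtrace; apply: eq_bigr => i _.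
rewrite !mulmx_diag !mxE eqxx mulr1n; field; exact: nz.
Qed.

Lemma e2_at_pfister D1 D2 x y : derivation D1 -> derivation D2 -> x != 0 -> y != 0 ->
  e2_at D1 D2 (pfister [:: x; y]) = pair2 D1 D2 (wedge (dlog x) (dlog y)).
Proof.
move=> hD1 hD2 x0 y0; have hm : all (fun z => z != 0) (mons [:: x; y]).
  by apply: mons_nz; rewrite /= x0 y0.
have [_ ->] := e_at_isometric hD1 hD2 (bilinear_diagb hm) (isometric_pfister [:: x; y]).
rewrite e2_at_diagb // pair2_dlog //= !big_cons big_nil !mulr1 hD1.2 hD2.2.
rewrite (derivation1 hD1) mul0r mul0r add0r addr0.
by apply/(add2_eq charF2); field2 charF2; rewrite x0 y0.
Qed.

Lemma e2_graph_at (B : bform F) w D1 D2 : derivation D1 -> derivation D2 -> bilinear_form B ->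
  e2_graph B w -> pair2 D1 D2 w = e2_at D1 D2 B.
Proof.
move=> hD1 hD2 bB [s [psi [ss ipsi h ->]]].
have [bpsi _ _ /(_ isT) i2] := e_at_Ipow ipsi.
have [bP e] : bilinear_form (orths [seq pfister [:: p.1; p.2] | p <- s]) /\
    e2_at D1 D2 (orths [seq pfister [:: p.1; p.2] | p <- s]) = pair2 D1 D2 (symbol_sum s).
  rewrite /symbol_sum; elim: s ss {h} => [_|p s IH /= /andP[/andP[p1 p2] /IH[b e]]].
    have h0 := metabolic_zero F; rewrite big_nil pair2_0 //; split; first exact: h0.1.
    by have [] := e_at_metabolic hD1 hD2 h0.
  have bp : bilinear_form (pfister [:: p.1; p.2]) by apply: bilinear_pfister; rewrite /= p1 p2.
  split; first exact: bilinear_orth.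
  by rewrite e2_at_orth // e e2_at_pfister // big_cons pair2D.
have [_ _ ->] := e_at_witt hD1 hD2 bB (bilinear_orth bP bpsi) h.
by rewrite e2_at_orth // e i2 // addr0.
Qed.

(** Both values pair with (D1, D2) to [e2_at] of B, by [e2_graph_at]. *)
Lemma e2_graph_uniq (B : bform F) w w' : bilinear_form B -> e2_graph B w -> e2_graph B w' -> w = w'.
Proof.
move=> bB h h'; have [s [psi [_ _ _ e]]] := h; have [s' [psi' [_ _ _ e']]] := h'.
rewrite e e'; apply: symbol_sum_eq => // D1 D2 hD1 hD2.
by rewrite -e -e' (e2_graph_at hD1 hD2 bB h) (e2_graph_at hD1 hD2 bB h').
Qed.

End Invariants.

(** * When a sum of two symbols is a symbol *)
Section Linkage.
Variables (F : fieldType) (charF2 : 2%N \in [pchar F]).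
Implicit Types (s t : seq F) (x y z : F) (D E : F -> F).

(** If some element of t were in the field of the following ones, it could be left out,
and [steinitz] would bound size s by size t - 1. *)
Lemma indep2_span s t : indep2 s -> (forall x, x \in s -> adj2 t x) ->
  (size t <= size s)%N -> indep2 t.
Proof.
move=> hs st lts.
suff h t1 t2 : t = t1 ++ t2 -> indep2 t2 by apply: (h [::]).
elim: t2 t1 => //= y t2 IH t1 e; split; last first.
  by apply: (IH (rcons t1 y)); rewrite cat_rcons.
move=> hy; have [|s' [_ e' _]] := steinitz charF2 (s := t1 ++ t2) hs.
  move=> x /st; apply: adj2_sub => // z; rewrite e mem_cat inE => /or3P[h|/eqP->|h].
  - by apply: adj2_mem => //; rewrite mem_cat h.
  - by apply: adj2_subset hy => // w hw; rewrite mem_cat hw orbT.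
  by apply: adj2_mem => //; rewrite mem_cat h orbT.
move: lts; rewrite e size_cat /= addnS -size_cat -e'.
by rewrite ltnNge leq_addr.
Qed.

Lemma indep2_perm s t : perm_eq s t -> indep2 s -> indep2 t.
Proof.
move=> p /indep2_span; apply; last by rewrite (perm_size p).
by move=> x; rewrite (perm_mem p); apply: adj2_mem.
Qed.

Lemma indep2_nz s x : indep2 s -> x \in s -> x != 0.
Proof.
elim: s => //= y s IH [hy hs]; rewrite inE => /predU1P[->|/IH]; last exact.
by apply: contraPneq hy => -> /(_ (adj2_0 s)).
Qed.

Lemma derivation_stable s D z : derivation D -> (forall y, y \in s -> adj2 s (D y)) ->
  adj2 s z -> adj2 s (D z).
Proof.
move=> hD hs hz; suff [] : adj2 s z /\ adj2 s (D z) by [].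
apply: (adj2_ind (P := fun x => adj2 s x /\ adj2 s (D x))) hz.
- move=> x; rewrite derivation_sqr //; split; [exact: adj2_sqr|exact: adj2_0].
- by move=> x y [h1 h2] [h3 h4]; rewrite hD.1; split; apply: adj2_D.
- move=> x y [h1 h2] [h3 h4]; rewrite hD.2; split; first exact: adj2_M.
  by apply: adj2_D => //; apply: adj2_M.
by move=> x hx; split; [exact: adj2_mem|exact: hs].
Qed.

Section Frame.
Variables (u v c : F).
Hypothesis ind : indep2 [:: c; u; v].
Variables (E1 E2 E3 : F -> F).
Hypotheses (hE1 : derivation E1) (hE2 : derivation E2) (hE3 : derivation E3).
Hypotheses (E1u : E1 u = 1) (E1v : E1 v = 0) (E1c : E1 c = 0).
Hypotheses (E2u : E2 u = 0) (E2v : E2 v = 1) (E2c : E2 c = 0).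
Hypotheses (E3u : E3 u = 0) (E3v : E3 v = 0) (E3c : E3 c = 1).
Local Notation M := (adj2 [:: c; u; v]).
Implicit Types w : Omega2 F.

(** Contraction of the 2-form w with the trivector E1 E2 E3, for derivations E1, E2, E3
dual to a 2-basis (u, v, c) of M.  It turns 2-forms on M into derivations. *)
Definition contr w z :=
  pair2 E2 E3 w * E1 z + pair2 E1 E3 w * E2 z + pair2 E1 E2 w * E3 z.

Lemma derivation_contr w : derivation (contr w).
Proof.
split=> x y; rewrite /contr ?hE1.1 ?hE2.1 ?hE3.1 ?hE1.2 ?hE2.2 ?hE3.2; ring.
Qed.

Lemma contrD w w' z : contr (w + w') z = contr w z + contr w' z.
Proof. by rewrite /contr !pair2D //; ring. Qed.

Lemma derivation_frame D z : derivation D -> M z ->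
  D z = D u * E1 z + D v * E2 z + D c * E3 z.
Proof.
move=> hD hz; apply: (add2_eq charF2).
pose T z := D z + (D u * E1 z + D v * E2 z + D c * E3 z).
apply: (derivation_eq0 (D := T) charF2 _ _ hz).
  split=> x y; rewrite /T ?hD.1 ?hE1.1 ?hE2.1 ?hE3.1 ?hD.2 ?hE1.2 ?hE2.2 ?hE3.2; ring.
move=> y; rewrite !inE /T => /or3P[]/eqP->;
  rewrite ?E1u ?E1v ?E1c ?E2u ?E2v ?E2c ?E3u ?E3v ?E3c; ring2 charF2.
Qed.

Lemma frame_stable z : M z -> [/\ M (E1 z), M (E2 z) & M (E3 z)].
Proof.
have M0 := adj2_0 [:: c; u; v]; have M1 := adj2_1 [:: c; u; v].
by move=> hz; split; apply: derivation_stable => // y; rewrite !inE;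
  move=> /or3P[]/eqP->; rewrite ?E1u ?E1v ?E1c ?E2u ?E2v ?E2c ?E3u ?E3v ?E3c.
Qed.

Local Notation symb x y := (wedge (dlog x) (dlog y)).

(** The Jacobian determinant of (x, y, z), divided by x y. *)
Lemma contr_symb x y z : x != 0 -> y != 0 -> contr (symb x y) z =
  (E1 x * (E2 y * E3 z + E3 y * E2 z) + E2 x * (E3 y * E1 z + E1 y * E3 z)
   + E3 x * (E1 y * E2 z + E2 y * E1 z)) / (x * y).
Proof.
move=> x0 y0; rewrite /contr !pair2_dlog //; apply: (add2_eq charF2).
by field2 charF2; rewrite x0 y0.
Qed.

Lemma contr_symb_l x y : x != 0 -> y != 0 -> contr (symb x y) x = 0.
Proof. by move=> x0 y0; rewrite contr_symb //; field2 charF2; rewrite x0 y0. Qed.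

Lemma contr_symb_r x y : x != 0 -> y != 0 -> contr (symb x y) y = 0.
Proof. by move=> x0 y0; rewrite contr_symb //; field2 charF2; rewrite x0 y0. Qed.

(** D kills x and y.  If D is not zero on M, then D w is nonzero for some w, so M = k(x,
y)(w), and D(e + e' w) = e' D w for e, e' in k(x, y); thus D D w / D w works. *)
Lemma contr_symb_sqr x y : x != 0 -> y != 0 -> M x -> M y ->
  exists h, forall z, M z -> contr (symb x y) (contr (symb x y) z) = h * contr (symb x y) z.
Proof.
move=> x0 y0 Mx My; pose D := contr (symb x y); have hD : derivation D by apply: derivation_contr.
have [[w Mw Dw]|h] := pselect (exists2 w, M w & D w != 0); last first.
  exists 0 => z Mz; have D0 : D z = 0 by apply: contrapT => /eqP ?; apply: h; exists z.
  by rewrite -!/(D _) D0 mul0r derivation0.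
have Dyx : forall z, z \in [:: y; x] -> D z = 0.
  by move=> z; rewrite !inE => /orP[]/eqP->; rewrite /D ?contr_symb_l ?contr_symb_r.
have iw : indep2 [:: w; y; x].
  split; first by move=> /(derivation_eq0 charF2 hD Dyx) e; rewrite e eqxx in Dw.
  have Dw0 : D w = 0 -> False by move=> e; rewrite e eqxx in Dw.
  split=> [[s' [t' [[s es] [t et] e]]]|].
    have Ey E : derivation E -> E y = t ^+ 2 * E x.
      by move=> hE; rewrite e es et hE.1 (derivation_sqr charF2) // add0r mulrC derivationZ.
    apply: Dw0; rewrite /D contr_symb // (Ey E1) // (Ey E2) // (Ey E3) //.
    by field2 charF2; rewrite x0 y0.
  split=> // -[s e]; apply: Dw0; rewrite /D contr_symb // e.
  rewrite (derivation_sqr charF2 _ hE1) (derivation_sqr charF2 _ hE2) (derivation_sqr charF2 _ hE3).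
  by rewrite !mul0r !addr0 mul0r.
have full z : M z -> adj2 [:: w; y; x] z.
  apply: (indep2_full charF2 iw) => // z'; rewrite !inE => /or3P[]/eqP-> //.
exists (D (D w) / D w) => z /full [e [e' [he he' ->]]]; rewrite -!/(D _).
have De : D e = 0 by apply: derivation_eq0 Dyx he.
have De' : D e' = 0 by apply: derivation_eq0 Dyx he'.
rewrite hD.1 De add0r hD.2 De' mulr0 add0r hD.2 De' mulr0 addr0.
by rewrite mulrCA divfK // mulrC.
Qed.

(** If x is not in M, evaluate at a derivation D that kills M and has D x = 1: this
gives E y = D(y) E x for every derivation E, and the Jacobian of (x, y, z) vanishes. *)
Lemma contr_outside x y z : x != 0 -> y != 0 -> ~ M x ->
  (forall D D', derivation D -> derivation D' -> (forall z, M z -> D z = 0) ->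
     pair2 D D' (symb x y) = 0) -> contr (symb x y) z = 0.
Proof.
move=> x0 y0 Mx h; have [D [hD Dx DM]] := derivation_ex charF2 Mx.
have hE E : derivation E -> E y = E x * D y.
  move=> hE; have := h D E hD hE DM; rewrite pair2_dlog // Dx mul1r.
  move=> /eqP; rewrite mulf_eq0 invr_eq0 mulf_eq0 (negPf x0) (negPf y0) !orbF.
  by rewrite subr_eq0 => /eqP.
by rewrite contr_symb // (hE E1) // (hE E2) // (hE E3) //; field2 charF2; rewrite x0 y0.
Qed.

(** Complete (p, q) by w to a 2-basis of M.  By the chain rule the Jacobian of (p, q, w)
is invertible, so D w is nonzero, and D(e + e' w) = e' D w vanishes only if e' = 0. *)
Lemma contr_kernel p q z : indep2 [:: p; q] -> M p -> M q -> M z ->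
  contr (symb p q) z = 0 -> adj2 [:: p; q] z.
Proof.
move=> ipq Mp Mq Mz; pose D := contr (symb p q).
have hD : derivation D by apply: derivation_contr.
have p0 : p != 0 by apply: indep2_nz ipq _; rewrite inE eqxx.
have q0 : q != 0 by apply: indep2_nz ipq _; rewrite !inE eqxx orbT.
have [w hw nw] := @indep2_extend F charF2 [:: p; q] [:: c; u; v] ind ipq isT.
have Mw : M w by apply: adj2_mem.
have iw : indep2 [:: w; p; q] by split.
have full z' : M z' -> adj2 [:: w; p; q] z'.
  by apply: (indep2_full charF2 iw) => // y; rewrite !inE => /or3P[]/eqP->.
have Dpq : forall z, z \in [:: p; q] -> D z = 0.
  by move=> y; rewrite !inE => /orP[]/eqP->; rewrite /D ?contr_symb_l ?contr_symb_r.
have Dw : D w != 0.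
  apply/eqP => Dw.
  have [G1 [hG1 G1w G1pq]] := derivation_ex charF2 nw.
  have [G2 [hG2 G2p G2wq]] : exists G, [/\ derivation G, G p = 1 & forall y, adj2 [:: w; q] y -> G y = 0].
    by apply: derivation_ex => //; case: (@indep2_perm [:: w; p; q] [:: p; w; q] _ iw) => //; apply/seq.permP => ? /=; rewrite addnCA.
  have [G3 [hG3 G3q G3wp]] : exists G, [/\ derivation G, G q = 1 & forall y, adj2 [:: w; p] y -> G y = 0].
    apply: derivation_ex => //; case: (@indep2_perm [:: w; p; q] [:: q; w; p] _ iw) => //.
    by apply/seq.permP => ? /=; rewrite !addn0 addnA addnC.
  have e x G : derivation G -> M x -> G x = G u * E1 x + G v * E2 x + G c * E3 x.
    exact: derivation_frame.
  have G1p : G1 p = 0 by apply/G1pq/adj2_mem; rewrite // inE eqxx.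
  have G1q : G1 q = 0 by apply/G1pq/adj2_mem; rewrite // !inE eqxx orbT.
  have G2w : G2 w = 0 by apply/G2wq/adj2_mem; rewrite // inE eqxx.
  have G2q : G2 q = 0 by apply/G2wq/adj2_mem; rewrite // !inE eqxx orbT.
  have G3w : G3 w = 0 by apply/G3wp/adj2_mem; rewrite // inE eqxx.
  have G3p : G3 p = 0 by apply/G3wp/adj2_mem; rewrite // !inE eqxx orbT.
  (* the chain rule: det (G_i p_j) = det (G_i u_j) * det (E_i p_j), where G is dual to (p, q, w) *)
  pose det (A B C D E F' G H I : F) :=
    A * (E * I + F' * H) + B * (F' * G + D * I) + C * (D * H + E * G).
  have d1 : det (G2 p) (G2 q) (G2 w) (G3 p) (G3 q) (G3 w) (G1 p) (G1 q) (G1 w) = 1.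
    rewrite /det G1p G1q G2w G2q G3w G3p G1w G2p G3q; ring.
  have d2 : det (E1 p) (E1 q) (E1 w) (E2 p) (E2 q) (E2 w) (E3 p) (E3 q) (E3 w) = 0.
    move: Dw; rewrite /D contr_symb // => /eqP; rewrite mulf_eq0 invr_eq0 mulf_eq0.
    rewrite (negPf p0) (negPf q0) !orbF => /eqP <-; rewrite /det; ring.
  have : det (G2 p) (G2 q) (G2 w) (G3 p) (G3 q) (G3 w) (G1 p) (G1 q) (G1 w) =
     det (G2 u) (G2 v) (G2 c) (G3 u) (G3 v) (G3 c) (G1 u) (G1 v) (G1 c) *
     det (E1 p) (E1 q) (E1 w) (E2 p) (E2 q) (E2 w) (E3 p) (E3 q) (E3 w).
    rewrite (e p G1) // (e q G1) // (e w G1) // (e p G2) // (e q G2) // (e w G2) //.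
    rewrite (e p G3) // (e q G3) // (e w G3) // /det; apply: (add2_eq charF2).
    ring2 charF2.
  by rewrite d1 d2 mulr0 => /eqP; rewrite oner_eq0.
have [e [e' [he he' ->]]] := full z Mz; rewrite -/(D _).
rewrite hD.1 hD.2 (derivation_eq0 charF2 hD Dpq he) (derivation_eq0 charF2 hD Dpq he').
rewrite mulr0 !add0r => /eqP; rewrite mulf_eq0 (negPf Dw) orbF => /eqP ->.
by rewrite mulr0 addr0.
Qed.

End Frame.

Local Notation symb x y := (wedge (dlog x) (dlog y)).

Lemma symbol_vanish s x y D D' : derivation D -> derivation D' ->
  (forall z, adj2 s z -> D z = 0) -> adj2 s x -> adj2 s y ->
  pair2 D D' (symb x y) = 0.
Proof.
move=> hD hD' Ds sx sy; rewrite pair2_wedge // /dlog !pair1Z // !pair1_kd // !Ds //.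
ring.
Qed.

(** Let D1, D2, D3 be the contractions of the three symbols; D3 = D1 + D2.  Each D_i
satisfies D_i D_i = h_i D_i on M, so D1 D2 + D2 D1 is a combination of D1 and D2.  On
the kernel k(u, v) of D1 this reads D1 D2 e = (h2 + h3) D2 e.  Hence both D1 and D2 kill
the quotient r of D2 u and D2 v, and r lies in k(u, v) and in k(p, q).  If r is in k,
use u + r v instead. *)
Lemma common_subfield c u v p q x y :
  indep2 [:: c; u; v] -> adj2 [:: c; u; v] p -> adj2 [:: c; u; v] q ->
  indep2 [:: p; q] -> x != 0 -> y != 0 ->
  symb u v + symb p q = symb x y ->
  exists e, [/\ adj2 [:: u; v] e, adj2 [:: p; q] e & ~ adj2 [::] e].
Proof.
move=> ind Mp Mq ipq x0 y0 ew.
have [u0 v0 p0 q0] : [/\ u != 0, v != 0, p != 0 & q != 0].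
  by split; [apply: indep2_nz ind _|apply: indep2_nz ind _|apply: indep2_nz ipq _|apply: indep2_nz ipq _]; rewrite !inE eqxx ?orbT.
have Mu : adj2 [:: c; u; v] u by apply: adj2_mem; rewrite // !inE eqxx orbT.
have Mv : adj2 [:: c; u; v] v by apply: adj2_mem; rewrite // !inE eqxx !orbT.
have [E3 [hE3 E3c E3uv]] := derivation_ex charF2 ind.1.
have [E1 [hE1 E1u E1cv]] : exists G, [/\ derivation G, G u = 1 & forall y, adj2 [:: c; v] y -> G y = 0].
  apply: derivation_ex => //; case: (@indep2_perm [:: c; u; v] [:: u; c; v] _ ind) => //.
  by apply/seq.permP => ? /=; rewrite addnCA.
have [E2 [hE2 E2v E2cu]] : exists G, [/\ derivation G, G v = 1 & forall y, adj2 [:: c; u] y -> G y = 0].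
  apply: derivation_ex => //; case: (@indep2_perm [:: c; u; v] [:: v; c; u] _ ind) => //.
  by apply/seq.permP => ? /=; rewrite !addn0 addnA addnC.
have E1v : E1 v = 0 by apply/E1cv/adj2_mem; rewrite // !inE eqxx orbT.
have E1c : E1 c = 0 by apply/E1cv/adj2_mem; rewrite // !inE eqxx.
have E2u : E2 u = 0 by apply/E2cu/adj2_mem; rewrite // !inE eqxx orbT.
have E2c : E2 c = 0 by apply/E2cu/adj2_mem; rewrite // !inE eqxx.
have E3u : E3 u = 0 by apply/E3uv/adj2_mem; rewrite // !inE eqxx.
have E3v : E3 v = 0 by apply/E3uv/adj2_mem; rewrite // !inE eqxx orbT.
pose D1 := contr E1 E2 E3 (symb u v); pose D2 := contr E1 E2 E3 (symb p q).
pose D3 := contr E1 E2 E3 (symb x y).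
have hD w : derivation (contr E1 E2 E3 w) by apply: derivation_contr.
have eD z : D3 z = D1 z + D2 z by rewrite /D3 -ew contrD.
have [h2 D2sq] : exists h, forall z, adj2 [:: c; u; v] z -> D2 (D2 z) = h * D2 z.
  exact: contr_symb_sqr.
have vanish D D' : derivation D -> derivation D' ->
    (forall z, adj2 [:: c; u; v] z -> D z = 0) -> pair2 D D' (symb x y) = 0.
  by move=> hd hd' Dz; rewrite -ew pair2D // !(symbol_vanish _ _ Dz) // addr0.
have [h3 D3sq] : exists h, forall z, adj2 [:: c; u; v] z -> D3 (D3 z) = h * D3 z.
  have [Mx|Mx] := pselect (adj2 [:: c; u; v] x); last first.
    have D30 z : D3 z = 0 by apply: (contr_outside (u := u) (v := v) (c := c)).
    by exists 0 => z _; rewrite !D30 mulr0.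
  have [My|My] := pselect (adj2 [:: c; u; v] y); last first.
    have D30 z : D3 z = 0.
      rewrite /D3 wedgeC //; apply: (contr_outside (u := u) (v := v) (c := c)) => // D D'.
      by rewrite wedgeC //; apply: vanish.
    by exists 0 => z _; rewrite !D30 mulr0.
  exact: contr_symb_sqr.
have D1uv z : adj2 [:: u; v] z -> D1 z = 0.
  apply: (derivation_eq0 charF2 (hD _)) => w; rewrite !inE => /orP[]/eqP->.
    exact: contr_symb_l.
  exact: contr_symb_r.
have D2M z : adj2 [:: c; u; v] z -> adj2 [:: c; u; v] (D2 z).
  have st := frame_stable hE1 hE2 hE3 E1u E1v E1c E2u E2v E2c E3u E3v E3c.
  move=> /st[z1 z2 z3]; have [p1 p2 p3] := st _ Mp; have [q1 q2 q3] := st _ Mq.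
  rewrite /D2 contr_symb //; apply: adj2_div => //; last exact: adj2_M.
  by do ?apply: adj2_D => //; apply: adj2_M => //; apply: adj2_D => //; apply: adj2_M.
have sub z : adj2 [:: u; v] z -> adj2 [:: c; u; v] z by apply: adj2_cons.
have D12 z : adj2 [:: u; v] z -> D1 (D2 z) = (h3 + h2) * D2 z.
  move=> hz; have Mz := sub z hz; have := D3sq z Mz.
  rewrite [D3 z]eD D1uv // add0r eD (D2sq z Mz).
  by move=> e; rewrite mulrDl -e addr2K.
have ker1 z : adj2 [:: c; u; v] z -> D1 z = 0 -> adj2 [:: u; v] z.
  by move=> Mz; apply: (contr_kernel ind (E1 := E1) (E2 := E2) (E3 := E3)) => //; case: ind.
have ker2 z : adj2 [:: c; u; v] z -> D2 z = 0 -> adj2 [:: p; q] z.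
  by move=> Mz; apply: (contr_kernel ind (E1 := E1) (E2 := E2) (E3 := E3)).
have uE : adj2 [:: u; v] u by apply: adj2_mem; rewrite // !inE eqxx.
have vE : adj2 [:: u; v] v by apply: adj2_mem; rewrite // !inE eqxx orbT.
have [_ [iu [iv _]]] := ind.
have [D2v|D2v] := eqVneq (D2 v) 0; first by exists v; split=> //; apply: ker2.
pose r := D2 u / D2 v; have Mr : adj2 [:: c; u; v] r by apply: adj2_div => //; apply: D2M.
have er : D2 u = r * D2 v by rewrite divfK.
have ker D k : derivation D -> D (D2 u) = k * D2 u -> D (D2 v) = k * D2 v -> D r = 0.
  move=> hd e1 e2; apply: (mulIf D2v); rewrite mul0r.
  move: e1; rewrite er hd.2 e2 mulrCA => /eqP.
  by rewrite addrC -subr_eq0 addrK mulrC => /eqP.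
have r1 : adj2 [:: u; v] r by apply: ker1 => //; apply: (ker _ (h3 + h2) (hD _)); apply: D12.
have r2 : adj2 [:: p; q] r by apply: ker2 => //; apply: (ker _ h2 (hD _)); apply: D2sq.
have [[s es]|nr] := pselect (adj2 [::] r); last by exists r.
have e1 : adj2 [:: u; v] (u + s ^+ 2 * v).
  by apply: adj2_D => //; apply: adj2_M => //; apply: adj2_sqr.
exists (u + s ^+ 2 * v); split=> //.
  apply: ker2; first exact: sub.
  by rewrite /D2 (hD _).1 derivationZ // -/D2 er es addrr2.
move=> h; apply: iu; rewrite -(addr2K charF2 u (s ^+ 2 * v)); apply: adj2_D => //.
  exact: adj2_subset h.
by apply: adj2_M => //; [exact: adj2_sqr|apply/adj2_mem/mem_head].
Qed.

Lemma symbol_sqr_l r x y : r != 0 -> x != 0 -> symb (x * r ^+ 2) y = symb x y.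
Proof. by move=> r0 x0; rewrite dlogM ?expf_neq0 // dlog_sqr // addr0. Qed.

(** With m = y^2 + z^2 a one has dlog a dlog m = 0, so dlog a dlog b = dlog(a x^2)
dlog(m b), and [wedge_dlogD] makes a x^2 + m b a slot.  Note that m is zero only if y
and z are. *)
Lemma symbol_slot a b x y z : indep2 [:: b; a] ->
  x ^+ 2 * a + y ^+ 2 * b + z ^+ 2 * (a * b) != 0 ->
  exists2 f, f != 0 &
    symb a b = symb (x ^+ 2 * a + y ^+ 2 * b + z ^+ 2 * (a * b)) f.
Proof.
move=> iab e0; have a0 : a != 0 by apply: indep2_nz iab _; rewrite !inE eqxx orbT.
have b0 : b != 0 by apply: indep2_nz iab _; rewrite !inE eqxx.
have [_ [na _]] := iab.
pose m := y ^+ 2 + z ^+ 2 * a.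
have -> : x ^+ 2 * a + y ^+ 2 * b + z ^+ 2 * (a * b) = a * x ^+ 2 + m * b.
  by rewrite /m; ring.
have [m0|m0] := eqVneq m 0.
  have x0 : x != 0.
    apply: contraNneq e0 => x0; apply/eqP.
    transitivity (x ^+ 2 * a + m * b); first by rewrite /m; ring.
    by rewrite m0 x0 expr0n !mul0r addr0.
  by exists b; rewrite // m0 mul0r addr0 symbol_sqr_l.
have ea : symb a b = symb a (m * b).
  rewrite dlogM // wedgeDr //; suff -> : symb a m = 0 by rewrite add0r.
  rewrite /dlog /m kdD // kd_sqr // add0r kdM // kd_sqr // scaler0 addr0.
  by rewrite !wedgeZl // !wedgeZr // wedge_alt !scaler0.
have [x0|x0] := eqVneq x 0.
  by exists a; rewrite // x0 expr0n mulr0 add0r ea wedgeC.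
exists (a * x ^+ 2 * (m * b)); first by rewrite !mulf_neq0 ?expf_neq0.
have ax0 : a * x ^+ 2 != 0 by rewrite mulf_neq0 ?expf_neq0.
have s0 : a * x ^+ 2 + m * b != 0.
  by move: e0; congr (_ != 0); rewrite /m; ring.
by rewrite wedge_dlogD ?mulf_neq0 // symbol_sqr_l.
Qed.

End Linkage.

(** * Chains and lines *)
Section Chain.
Variables (F : fieldType) (charF2 : 2%N \in [pchar F]).
Variables (a b : F) (c : seq F) (d : nat -> F).
Hypotheses (iab : indep2 [:: a; b]) (fc : free2 c) (c5 : (size c <= 5)%N).
Local Notation E := (adj2 [:: a; b]).
Hypotheses (dV : forall i, span2 c (d i)) (bdV : span2 c (b * d 0%N))
  (adV : forall i, span2 c (a * d i + b * d i.+1)).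

Let Ea : E a. Proof. by apply: adj2_mem; rewrite // !inE eqxx. Qed.
Let Eb : E b. Proof. by apply: adj2_mem; rewrite // !inE eqxx orbT. Qed.
Let nab : ~ adj2 [:: b] a. Proof. by case: iab. Qed.
Let nb : ~ adj2 [::] b. Proof. by case: iab => _ []. Qed.

(** The element a d_(r-1) + b d_r, with d_(-1) = 0. *)
Definition link r := if r is r'.+1 then a * d r' + b * d r else b * d 0%N.

(** Let Y be an E-subspace that contains d_i for i < r but not d_r.  Modulo Y the
elements d_r and [link r] are d_r and b d_r.  If d_(r+1) is not in Y + k(b) d_r, it is a
third independent element. Otherwise a d_r + b d_(r+1) is congruent to (a + b g) d_r
with g in k(b), and it is one because a is not in k(b). *)
Lemma chain_step (Y : F -> Prop) l r :
  (forall x y, Y x -> Y y -> Y (x + y)) -> (forall e y, E e -> Y y -> Y (e * y)) ->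
  Y 0 -> free2 l -> (forall x, x \in l -> Y x) ->
  ~ Y (d r) -> (forall i, (i < r)%N -> Y (d i)) ->
  exists f, [/\ span2 c f, free2 [:: f, link r, d r & l]
    & f = d r.+1 \/ f = a * d r + b * d r.+1].
Proof.
move=> YD YM Y0 fl lY Ydr Yr.
have spY z : span2 l z -> Y z.
  apply: span2_ind => // k x; apply: YM; exact: adj2_sqr.
have Yd e : E e -> Y (e * d r) -> e = 0.
  move=> Ee Ye; apply: contrapT => /eqP e0; apply: Ydr.
  by rewrite -[d r](mulKf e0); apply: YM => //; apply: adj2_V.
have [y [Yy ey]] : exists y, Y y /\ link r = b * d r + y.
  case: (r) Yr => [|r'] Yr; first by exists 0; rewrite addr0.
  by exists (a * d r'); rewrite addrC; split=> //; apply: YM => //; apply: Yr.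
have f2 : free2 [:: link r, d r & l].
  apply/free2_consP => //; split; last by apply/free2_consP => //; split=> // /spY.
  move=> /(span2_consP charF2)[k [z [/spY Yz ez]]]; apply: nb.
  exists k; apply: (add2_eq charF2); apply: Yd.
    by apply: adj2_D => //; apply: adj2_sqr.
  have -> : (b + k ^+ 2) * d r = y + z.
    have ek : d r * k ^+ 2 = b * d r + y + z by rewrite -ey ez (addr2K charF2).
    rewrite mulrDl (mulrC (k ^+ 2)) ek; apply: (add2_eq charF2); ring2 charF2.
  exact: YD.
have [[z [g [Yz [p [q [[s ep] [t eq'] eg]]] e1]]]|h] :=
    pselect (exists z g, [/\ Y z, adj2 [:: b] g & d r.+1 = g * d r + z]).
  exists (a * d r + b * d r.+1); split=> //; last by right.
  apply/free2_consP => //; split=> // /(span2_consP charF2)[k [z' [zz e2]]].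
  move: zz e2 => /(span2_consP charF2)[k' [z'' [/spY Yz'' ->]]] e2.
  apply: nab; have gb : adj2 [:: b] g by rewrite eg; exists p, q; split=> //; [exists s|exists t].
  have bb : adj2 [:: b] b by apply/adj2_mem/mem_head.
  have -> : a = b * g + (b * k ^+ 2 + k' ^+ 2).
    apply: (add2_eq charF2); apply: Yd.
      apply: adj2_D => //; apply: adj2_D => //.
        by apply: adj2_M => //; apply: adj2_subset gb => // w; rewrite !inE orbC => ->.
      apply: adj2_D => //; last exact: adj2_sqr.
      by apply: adj2_M => //; apply: adj2_sqr.
    have -> : (a + (b * g + (b * k ^+ 2 + k' ^+ 2))) * d r = b * z + k ^+ 2 * y + z''.
      move: e2; rewrite e1 ey => e2.
      have ea : a * d r = (b * d r + y) * k ^+ 2 + (d r * k' ^+ 2 + z'')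
        + b * (g * d r + z) by rewrite -e2 (addr2K charF2).
      rewrite mulrDl ea; apply: (add2_eq charF2); ring2 charF2.
    apply: (YD) => //; apply: YD; apply: YM => //; exact: adj2_sqr.
  apply: adj2_D => //; first exact: adj2_M.
  by apply: adj2_D => //; [apply: adj2_M => //|]; apply: adj2_sqr.
exists (d r.+1); split=> //; last by left.
apply/free2_consP => //; split=> // /(span2_consP charF2)[k [z' [zz e2]]].
move: zz e2 => /(span2_consP charF2)[k' [z'' [/spY Yz'' ->]]] e2.
apply: h; exists (k ^+ 2 * y + z''), (b * k ^+ 2 + k' ^+ 2); split.
- by apply: YD => //; apply: YM => //; apply: adj2_sqr.
- apply: adj2_D => //; last exact: adj2_sqr.
  by apply: adj2_M => //; [apply/adj2_mem/mem_head|apply: adj2_sqr].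
by rewrite e2 ey; ring.
Qed.

Lemma link_span r : span2 c (link r).
Proof. by case: r => [|r] /=. Qed.

Lemma first_exit (Y : F -> Prop) : (exists i, ~ Y (d i)) ->
  exists r, ~ Y (d r) /\ forall i, (i < r)%N -> Y (d i).
Proof.
move=> [i hi]; have ex : exists i, `[< ~ Y (d i) >] by exists i; apply/asboolP.
case: (ex_minnP ex) => r /asboolP hr' hm.
exists r; split=> // j jr; apply: contrapT => hj.
by have := hm j (introT (asboolP _) hj); rewrite leqNgt jr.
Qed.

(** If all d_i are in E d_0, apply [chain_step] once, to Y = 0.  Otherwise apply it
again, to Y = E d_0; this gives five independent elements.  If they did not lie in one
plane over E, a third application would give seven independent elements. *)
Lemma chain_lines_lead : d 0%N != 0 -> exists e,
  [/\ free2 e, forall x, x \in e -> span2 c x &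
     (size e = 3%N /\ exists2 g, g != 0 & forall x, x \in e -> E (x / g)) \/
     (size e = 5%N /\ exists g c', g != 0 /\ forall x, x \in e -> adj2 [:: c'; a; b] (x / g))].
Proof.
move=> d0.
have [|||||||f0 [sf0 ff0 ef0]] := @chain_step (fun x => x = 0) [::] 0.
- by move=> x y -> ->; rewrite addr0.
- by move=> e y _ ->; rewrite mulr0.
- by [].
- exact: free2_nil.
- by [].
- exact/eqP.
- by [].
pose Y1 x := E (x / d 0%N).
have Y1D x y : Y1 x -> Y1 y -> Y1 (x + y) by rewrite /Y1 mulrDl; apply: adj2_D.
have Y1M e y : E e -> Y1 y -> Y1 (e * y) by rewrite /Y1 -mulrA; apply: adj2_M.
have Y1d : Y1 (d 0%N) by rewrite /Y1 mulfV //; apply: adj2_1.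
have Y1t : Y1 (link 0) by apply: Y1M.
have [h1|h1] := pselect (forall i, Y1 (d i)).
  exists [:: f0; link 0; d 0%N]; split=> //.
    by move=> x; rewrite !inE => /or3P[]/eqP-> //; apply: link_span.
  left; split=> //; exists (d 0%N) => // x; rewrite !inE => /or3P[]/eqP->//.
  by case: ef0 => ->; [apply: h1|apply: Y1D; apply: Y1M => //; apply: h1].
have [r [Yr rmin]] : exists r, ~ Y1 (d r) /\ forall i, (i < r)%N -> Y1 (d i).
  by apply: first_exit; apply: contrapT => h; apply: h1 => i; apply: contrapT => hi; apply: h; exists i.
have f2 : free2 [:: link 0; d 0%N] by case/(free2_consP charF2): ff0.
have [|||||||f1 [sf1 ff1 ef1]] := @chain_step Y1 [:: link 0; d 0%N] r => //.
- by rewrite /Y1 mul0r; apply: adj2_0.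
- by move=> x; rewrite !inE => /orP[]/eqP->.
pose c' := d r / d 0%N; pose Y2 x := adj2 [:: c'; a; b] (x / d 0%N).
have Y2D x y : Y2 x -> Y2 y -> Y2 (x + y) by rewrite /Y2 mulrDl; apply: adj2_D.
have Y2M e y : E e -> Y2 y -> Y2 (e * y).
  by rewrite /Y2 -mulrA => Ee; apply: adj2_M => //; apply: adj2_cons.
have Y12 x : Y1 x -> Y2 x by apply: adj2_cons.
have Y2r : Y2 (d r) by apply/adj2_mem/mem_head.
have Y2t : Y2 (link r).
  case: (r) Y2r rmin => [|r'] Y2r rmin; first exact: Y12.
  by apply: Y2D; apply: Y2M => //; apply/Y12/rmin.
have [h2|h2] := pselect (forall i, Y2 (d i)).
  exists [:: f1; link r; d r; link 0; d 0%N]; split=> //.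
    move=> x; rewrite !inE => /or4P[/eqP->|/eqP->|/eqP->|/orP[]/eqP->] //; exact: link_span.
  right; split=> //; exists (d 0%N), c'; split=> // x.
  rewrite !inE => /or4P[/eqP->|/eqP->|/eqP->|/orP[]/eqP->] //; try exact: Y12.
  by case: ef1 => ->; [apply: h2|apply: Y2D; apply: Y2M => //; apply: h2].
have [s [Ys smin]] : exists s, ~ Y2 (d s) /\ forall i, (i < s)%N -> Y2 (d i).
  by apply: first_exit; apply: contrapT => h; apply: h2 => i; apply: contrapT => hi; apply: h; exists i.
have f4 : free2 [:: link r; d r; link 0; d 0%N] by case/(free2_consP charF2): ff1.
have [|||||||f3 [sf3 ff3 _]] := @chain_step Y2 [:: link r; d r; link 0; d 0%N] s => //.
- by rewrite /Y2 mul0r; apply: adj2_0.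
- move=> x; rewrite !inE => /or4P[]/eqP-> //; exact: Y12.
suff /leq_trans/(_ c5) : (7 <= size c)%N by [].
apply: (free2_size charF2 ff3).
move=> x; rewrite !inE => /or4P[/eqP->|/eqP->|/eqP->|/or4P[]/eqP->] //;
  exact: link_span.
Qed.

End Chain.

Section TrimmedChain.
Variables (F : fieldType) (charF2 : 2%N \in [pchar F]).

(** Drop the leading zeros: if d_n is the first nonzero term, then a d_(n-1) + b d_n = b
d_n. *)
Lemma chain_lines (a b : F) (c : seq F) (d : nat -> F) :
  indep2 [:: a; b] -> free2 c -> (size c <= 5)%N ->
  (forall i, span2 c (d i)) -> span2 c (b * d 0%N) ->
  (forall i, span2 c (a * d i + b * d i.+1)) -> (exists i, d i != 0) ->
  exists e, [/\ free2 e, forall x, x \in e -> span2 c x &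
     (size e = 3%N /\ exists2 g, g != 0 & forall x, x \in e -> adj2 [:: a; b] (x / g)) \/
     (size e = 5%N /\ exists g c', g != 0 /\ forall x, x \in e -> adj2 [:: c'; a; b] (x / g))].
Proof.
move=> iab fc c5 dV bdV adV ex; case: (ex_minnP ex) => n dn hn.
apply: (@chain_lines_lead F charF2 a b c (fun i => d (n + i)%N)) => //; rewrite ?addn0 //.
  case: n {dn} hn => [//|n] hn; have := adV n.
  have -> : d n = 0 by apply/eqP; apply: contraTT (ltnSn n) => /hn; rewrite -leqNgt.
  by rewrite mulr0 add0r.
by move=> i; rewrite addnS.
Qed.

End TrimmedChain.

(** * Isotropy over the function field of Q *)
Section FunctionField.
Variables (F : fieldType) (charF2 : 2%N \in [pchar F]) (a b : F).
Hypothesis anisoQ : qanisotropic (totally_singular [:: 1; a; b]).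
Variables (K : fieldType) (iota : {rmorphism F -> K}).
Hypothesis FQ : is_function_field a b iota.
Local Notation ts := totally_singular.
Implicit Types (s c e : seq F).

Let charK2 : 2%N \in [pchar K]. Proof. exact: (rmorph_pchar iota). Qed.

Lemma indep2_Q : indep2 [:: a; b].
Proof.
have h y : (forall x, x \in [:: a; b] -> adj2 [:: y] x) -> False.
  move=> hy; suff : (3 <= size (mons [:: y]))%N by [].
  apply: (free2_size charF2 (e := [:: 1; a; b])) => // x; rewrite in_cons => /predU1P[->|/hy];
    last by move/(monsP charF2).
  by apply/(monsP charF2)/adj2_1.
split=> [ab|]; last split=> // bs.
  apply: (h b) => x; rewrite !inE => /orP[]/eqP->//; exact/adj2_mem/mem_head.
apply: (h a) => x; rewrite !inE => /orP[]/eqP->; first exact/adj2_mem/mem_head.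
exact: adj2_cons.
Qed.

Local Notation Xv i := ('X_(inord i) : {mpoly F[3]}).

(** The class of the variable z is nonzero, as no multiple of the form Q is z. *)
Lemma function_field_point : exists x y z : K,
  z != 0 /\ x ^+ 2 + iota a * y ^+ 2 + iota b * z ^+ 2 = 0.
Proof.
have [ev [evC ev0 _]] := FQ; exists (ev (Xv 0)), (ev (Xv 1)), (ev (Xv 2)); split.
  apply/eqP => /ev0/(FunctionFieldExistence.phi_eq0 charF2 anisoQ).
  rewrite FunctionFieldExistence.phiX inordK //= => /mpolyP/(_ (U_(inord 2) *+ 2)%MM).
  by rewrite mcoeffXn eqxx mcoeff0 => /eqP; rewrite oner_eq0.
have /ev0 : exists q, Qpoly a b = q * Qpoly a b by exists 1; rewrite mul1r.
rewrite /Qpoly /= -!mul_mpolyC !rmorphD /= !(rmorphXn ev) !(rmorphM ev) /= !evC => h; exact: h.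
Qed.

(** Over K, b is a sum of a square and of a times a square. *)
Lemma adj2_ext s x : adj2 (s ++ [:: a; b]) x -> adj2 (map iota s ++ [:: iota a]) (iota x).
Proof.
have [u [v [w [w0 e]]]] := function_field_point.
apply: (adj2_ind (P := fun x => adj2 (map iota s ++ [:: iota a]) (iota x))).
- by move=> y; rewrite /= rmorphXn; apply: adj2_sqr.
- by move=> y z hy hz; rewrite /= rmorphD; apply: adj2_D.
- by move=> y z hy hz; rewrite /= rmorphM; apply: adj2_M.
move=> y; rewrite mem_cat !inE => /or3P[ys|/eqP->|/eqP->].
- by apply: adj2_mem => //; rewrite mem_cat map_f.
- by apply: adj2_mem => //; rewrite mem_cat mem_head orbT.
have -> : iota b = (u / w) ^+ 2 + iota a * (v / w) ^+ 2.
  have w20 : w ^+ 2 != 0 by rewrite expf_neq0.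
  apply: (mulIf w20); transitivity (u ^+ 2 + iota a * v ^+ 2).
    by apply: (add2_eq charK2); rewrite addrC.
  by field.
apply: adj2_D => //; first exact: adj2_sqr.
apply: adj2_M => //; last exact: adj2_sqr.
by apply: adj2_mem => //; rewrite mem_cat mem_head orbT.
Qed.

(** The field generated over the squares of K by s, a and b has degree at most 2 ^ (size
s + 1). *)
Lemma dependent_ext s e g : g != 0 ->
  (forall x, x \in e -> adj2 (s ++ [:: a; b]) (x / g)) ->
  (2 ^ (size s).+1 < size e)%N -> ~ free2 (map iota e).
Proof.
move=> g0 he se fe; have ig0 : iota g != 0 by rewrite fmorph_eq0.
have := free2_size charK2 (c := [seq iota g * m | m <- mons (map iota s ++ [:: iota a])]) fe.
rewrite !size_map size_mons size_cat size_map addn1 leqNgt se => /(_ _)/notF; apply.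
move=> _ /mapP[x xe ->]; apply/span2_scale => //; apply/monsP => //.
by rewrite -fmorphV -rmorphM; apply/adj2_ext/he.
Qed.

Import FunctionFieldExistence.
Local Notation phi := (FunctionFieldExistence.phi a b charF2).

Lemma coefMU0 (p : {mpoly F[3]}) (i : 'I_3) (m : 'X_{1..3}) : m i = 0%N -> (p * 'X_i)@_m = 0.
Proof.
move=> mi; rewrite [p]mpolyE mulr_suml raddf_sum big1 // => k _ /=.
rewrite -scalerAl -mpolyXD mcoeffZ mcoeffX; case: eqVneq; last by rewrite mulr0.
by move=> e; move: mi; rewrite -e mnmDE mnm1E eqxx addn1.
Qed.

(** Clear denominators in an isotropic vector over K.  The map phi squares a polynomial
and replaces x^2 by w = a y^2 + b z^2; it turns the vector into an identity sum c_i
(f_i^2 + w g_i^2) = 0 of polynomials.  Compare coefficients at squares of monomials: the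
sums of the c_i times the squared coefficients of g_i at the monomials x^m y^j z^(N-j),
for fixed m and N, form a chain indexed by j. *)
Lemma isotropic_chain c : free2 c -> ~ free2 (map iota c) -> exists d : nat -> F,
  [/\ forall i, span2 c (d i), span2 c (b * d 0%N),
      forall i, span2 c (a * d i + b * d i.+1) & exists i, d i != 0].
Proof.
move=> fc nfc; have [ev [evC ev0 evf]] := FQ.
have [v [v0 ev_v]] : exists v : 'rV[K]_(size (map iota c)), v != 0 /\ ts (map iota c) v = 0.
  apply: contrapT => h; apply: nfc => v e; apply: contrapT => /eqP v0; apply: h; by exists v.
have /choice[pq hpq] : forall i, exists pq : {mpoly F[3]} * {mpoly F[3]},
    ev pq.2 != 0 /\ v 0 i = ev pq.1 / ev pq.2.
  by move=> i; have [p [q [h1 h2]]] := evf (v 0 i); exists (p, q).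
pose P i := (pq i).1 * \prod_(j | j != i) (pq j).2.
pose r := \prod_j ev (pq j).2.
have r0 : r != 0 by apply/prodf_neq0 => j _; case: (hpq j).
have evP i : ev (P i) = r * v 0 i.
  have [q0 ->] := hpq i; rewrite /P rmorphM rmorph_prod /=.
by rewrite /r [X in _ = X * _](bigD1 i) //=; field.
have sz : size (map iota c) = size c by rewrite size_map.
have phi0 : \sum_(i < size (map iota c)) (c`_i)%:MP * phi (P i) = 0.
  have : phi (\sum_(i < size (map iota c)) (c`_i)%:MP * P i ^+ 2) = 0.
    apply/(FunctionFieldExistence.phi_eq0 charF2 anisoQ)/ev0.
    transitivity (r ^+ 2 * ts (map iota c) v); last by rewrite ev_v mulr0.
    rewrite rmorph_sum mulr_sumr; apply: eq_bigr => i _ /=.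
    rewrite rmorphM rmorphXn /= evC evP (nth_map 0) -?sz //; ring.
  rewrite rmorph_sum /=.
  under eq_bigr => i _ do rewrite rmorphM rmorphXn /= FunctionFieldExistence.phiC -exprMn.
  rewrite -(sqr_sum2 (FunctionFieldExistence.pcharP3 charF2)) => /eqP.
  by rewrite expf_eq0 /= => /eqP.
have /choice[f hf] : forall i, exists f : {mpoly F[3]} * {mpoly F[3]},
    phi (P i) = f.1 ^+ 2 + f.2 ^+ 2 * FunctionFieldExistence.w a b.
  move=> i; have [f0 [f1 [h [e0 e1 ->]]]] := FunctionFieldExistence.reduce a b charF2 (P i).
  exists (f0, f1); rewrite !rmorphD !rmorphM /= e0 e1 FunctionFieldExistence.phi_q //.
  by rewrite mulr0 addr0 FunctionFieldExistence.phiX inordK.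
pose W (g : 'I_(size (map iota c)) -> {mpoly F[3]}) m :=
  \sum_(i < size (map iota c)) c`_i * (g i)@_m ^+ 2.
have Wspan g m : span2 c (W g m).
  apply: span2_sum => // i _; rewrite mulrC; apply/span2_Z/span2_mem/mem_nth => //.
  by rewrite -sz.
have W0 g : (forall m, W g m = 0) -> forall i, g i = 0.
  move=> hg i; apply/mpolyP => m; rewrite mcoeff0.
  have /fc/rowP/(_ (cast_ord sz i)) : ts c (\row_j (g (cast_ord (esym sz) j))@_m) = 0.
    rewrite -[RHS](hg m) /W /ts (reindex (cast_ord sz)) /=; last first.
      by exists (cast_ord (esym sz)) => j _; rewrite ?cast_ordK ?cast_ordKV.
    by apply: eq_bigr => j _; rewrite mxE cast_ordK.
  by rewrite !mxE cast_ordK.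
pose f0 i := (f i).1; pose f1 i := (f i).2.
(* the coefficient of the identity at the square of the monomial m *)
have rel m : W f0 m = a * W (fun i => f1 i * Xv 1) m + b * W (fun i => f1 i * Xv 2) m.
  apply: (add2_eq charF2).
  transitivity ((\sum_(i < size (map iota c)) (c`_i)%:MP * phi (P i))@_(m + m)%MM);
    last by rewrite phi0 mcoeff0.
  rewrite raddf_sum /= /W !mulr_sumr -!big_split; apply: eq_bigr => i _ /=.
  rewrite mcoeffCM hf /FunctionFieldExistence.w mulrDr -!scalerAr -!exprMn.
  rewrite !mcoeffD !mcoeffZ !(FunctionFieldExistence.coef_sqr charF2) /f0 /f1; ring.
have [m0 Vm0] : exists m, W f1 m != 0.
  apply: contrapT => h; have f10 : forall i, f1 i = 0.
    by apply: W0 => m; apply: contrapT => /eqP hm; apply: h; exists m.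
  have f00 : forall i, f0 i = 0.
    apply: W0 => m; rewrite rel /W !big1 ?mulr0 ?addr0 // => i _;
    by rewrite f10 mul0r mcoeff0 expr0n mulr0.
  case/eqP: v0; apply/rowP => i; rewrite mxE; apply: (mulfI r0); rewrite mulr0 -evP.
  apply/ev0/(FunctionFieldExistence.phi_eq0 charF2 anisoQ); rewrite hf.
  by rewrite -/(f0 i) -/(f1 i) f00 f10 expr0n mul0r addr0.
pose mk x y z : 'X_{1..3} := (U_(inord 0) *+ x + (U_(inord 1) *+ y + U_(inord 2) *+ z))%MM.
have mk1 x y z : W (fun i => f1 i * Xv 1) (mk x y.+1 z) = W f1 (mk x y z).
  apply: eq_bigr => i _; rewrite -[in RHS](mcoeffMX _ U_(inord 1)) /mk.
  congr (_ * (_@_ _ ^+ 2)); apply/mnmP => j; rewrite !mnmDE !mulmnE mulnS; ring.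
have mk2 x y z : W (fun i => f1 i * Xv 2) (mk x y z.+1) = W f1 (mk x y z).
  apply: eq_bigr => i _; rewrite -[in RHS](mcoeffMX _ U_(inord 2)) /mk.
  congr (_ * (_@_ _ ^+ 2)); apply/mnmP => j; rewrite !mnmDE !mulmnE mulnS; ring.
have mkE x y z : [/\ mk x y z (inord 0) = x, mk x y z (inord 1) = y & mk x y z (inord 2) = z].
  by split; rewrite /mk !mnmDE !mulmnE !mnm1E -!val_eqE /= !inordK //= !(mul1n, mul0n, addn0).
have mk10 x z : W (fun i => f1 i * Xv 1) (mk x 0%N z) = 0.
  by apply: big1 => i _; rewrite coefMU0 ?expr0n ?mulr0 //; case: (mkE x 0%N z).
have mk20 x y : W (fun i => f1 i * Xv 2) (mk x y 0%N) = 0.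
  by apply: big1 => i _; rewrite coefMU0 ?expr0n ?mulr0 //; case: (mkE x y 0%N).
(* the line of monomials through m0 along which the degree in y grows *)
pose x := m0 (inord 0); pose N := (m0 (inord 1) + m0 (inord 2))%N.
exists (fun j => if (j <= N)%N then W f1 (mk x j (N - j)%N) else 0); split.
- by move=> j; case: ifP => // _; apply: span2_0.
- by rewrite leq0n subn0 -mk2 -[b * _]add0r -(mulr0 a) -(mk10 x N.+1) -rel.
- move=> j; case: (ltngtP j N) => [jN|jN|->].
  + by rewrite -(subnSK jN) -mk1 -mk2 -rel.
  + by rewrite !mulr0 addr0; apply: span2_0.
  by rewrite subnn -mk1 -(mk20 x N.+1) -rel.
exists (m0 (inord 1)); rewrite leq_addr /N addKn.
suff -> : mk x (m0 (inord 1)) (m0 (inord 2)) = m0 by [].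
apply/mnmP => i; have [e0 e1 e2] := mkE x (m0 (inord 1)) (m0 (inord 2)).
case: i => -[|[|[|//]]] hi.
- by rewrite (_ : Ordinal hi = inord 0) ?e0 //; apply: val_inj; rewrite /= inordK.
- by rewrite (_ : Ordinal hi = inord 1) ?e1 //; apply: val_inj; rewrite /= inordK.
by rewrite (_ : Ordinal hi = inord 2) ?e2 //; apply: val_inj; rewrite /= inordK.
Qed.

End FunctionField.

(** * Diagonal values and subforms *)
Section Diagonal.
Variables (F : fieldType) (charF2 : 2%N \in [pchar F]).
Local Notation ts := totally_singular.
Implicit Types (B C : bform F).

(** The values of the form on the standard basis; they span all its values over k
([span2_tilde]). *)
Definition diag_values B : seq F := [seq gram B i i | i <- enum 'I_(bdim B)].

Lemma size_diag_values B : size (diag_values B) = bdim B.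
Proof. by rewrite size_map size_enum_ord. Qed.

Lemma nth_diag_values B (i : 'I_(bdim B)) : (diag_values B)`_i = gram B i i.
Proof. by rewrite (nth_map i) ?size_enum_ord // nth_ord_enum. Qed.

Lemma sum_sym n (f : 'I_n -> 'I_n -> F) : (forall i j, f i j = f j i) ->
  \sum_i \sum_j f i j = \sum_i f i i.
Proof.
elim: n f => [|n IH] f sf; first by rewrite !big_ord0.
rewrite big_ord_recl [RHS]big_ord_recl [X in X + _]big_ord_recl -addrA; congr (_ + _).
under [X in _ + X]eq_bigr => i _ do rewrite big_ord_recl.
rewrite big_split /= IH // addrA.
under [X in _ + X + _]eq_bigr => i _ do rewrite sf.
by rewrite addrr2 // add0r.
Qed.

Lemma tilde_diag B v : (gram B)^T = gram B -> tilde B v = \sum_i gram B i i * v 0 i ^+ 2.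
Proof.
move=> sB; rewrite /tilde !mxE.
under eq_bigr => i _ do rewrite !mxE mulr_suml.
rewrite sum_sym; first by apply: eq_bigr => i _; ring.
by move=> i j; rewrite -[in LHS]sB mxE; ring.
Qed.

Lemma tilde_ts B v : (gram B)^T = gram B ->
  tilde B v = ts (diag_values B) (\row_i v 0 (cast_ord (size_diag_values B) i)).
Proof.
move=> sB; rewrite tilde_diag // /ts (reindex (cast_ord (size_diag_values B))) /=.
  by apply: eq_bigr => i _; rewrite mxE -nth_diag_values.
by exists (cast_ord (esym (size_diag_values B))) => i _; rewrite ?cast_ordK ?cast_ordKV.
Qed.

Lemma ts_tilde B w : (gram B)^T = gram B -> ts (diag_values B) w =
  tilde B (\row_i w 0 (cast_ord (esym (size_diag_values B)) i)).
Proof.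
by move=> sB; rewrite tilde_ts //; congr ts; apply/rowP => i; rewrite !mxE cast_ordK.
Qed.

Lemma anisotropic_free B : (gram B)^T = gram B ->
  anisotropic B <-> free2 (diag_values B).
Proof.
move=> sB; split=> [aB w e|fB [v v0 e]].
  apply: contrapT => /eqP w0; apply: aB.
  exists (\row_i w 0 (cast_ord (esym (size_diag_values B)) i)); last by rewrite -ts_tilde.
  apply: contra w0 => /eqP/rowP h; apply/eqP/rowP => i.
  by have := h (cast_ord (size_diag_values B) i); rewrite !mxE cast_ordK.
case/eqP: v0; move: e; rewrite tilde_ts // => /fB/rowP h; apply/rowP => i.
by have := h (cast_ord (esym (size_diag_values B)) i); rewrite !mxE cast_ordKV.
Qed.

Lemma span2_tilde B x : (gram B)^T = gram B ->
  span2 (diag_values B) x <-> exists v, x = tilde B v.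
Proof.
move=> sB; split=> [[w ->]|[v ->]]; first by rewrite ts_tilde //; eexists.
by rewrite tilde_ts //; eexists.
Qed.

Lemma diag_values_diagb s : diag_values (diagb s) = s.
Proof.
apply: (@eq_from_nth _ 0) => [|i]; rewrite size_diag_values //= => hi.
by rewrite (nth_diag_values (B := diagb s) (Ordinal hi)) /= !mxE eqxx.
Qed.

Lemma diag_values_scale k B : diag_values (bscale k B) = [seq k * x | x <- diag_values B].
Proof.
apply: (@eq_from_nth _ 0) => [|i]; first by rewrite size_diag_values size_map size_diag_values.
rewrite size_diag_values => hi.
rewrite (nth_diag_values (B := bscale k B) (Ordinal hi)) (nth_map 0) ?size_diag_values //.
by rewrite (nth_diag_values (B := B) (Ordinal hi)) /= mxE.
Qed.

Lemma diag_values_qisometric B C : (gram B)^T = gram B -> (gram C)^T = gram C ->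
  diag_values B = diag_values C -> qisometric (tilde B) (tilde C).
Proof.
move=> sB sC e; have d : bdim B = bdim C by rewrite -!size_diag_values e.
exists (castmx (erefl, d) 1%:M).
  by case: (bdim C) / d; rewrite castmx_id row_free_unit row_full_unit unitmx1.
move=> v; rewrite !tilde_diag // (reindex (cast_ord (esym d))) /=; last first.
  by exists (cast_ord d) => i _; rewrite ?cast_ordK ?cast_ordKV.
apply: eq_bigr => i _; rewrite -!nth_diag_values e /=; congr (_ * _ ^+ 2).
rewrite mxE (bigD1 (cast_ord (esym d) i)) //= castmxE !mxE /= cast_ord_id eqxx mulr1.
rewrite big1 ?addr0 // => k hk; rewrite castmxE !mxE /= cast_ord_id.
by rewrite (negPf hk) mulr0.
Qed.

(** An anisotropic form is nondegenerate on every subspace, and the subspace splits off: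
subtract from a complement V its projection to the row space of X. *)
Lemma subform_rows B r (X : 'M[F]_(r, bdim B)) : bilinear_form B -> anisotropic B ->
  row_free X -> subform (BForm (X *m gram B *m X^T)) B.
Proof.
case: B X => n G /= X [/= sG uG] aB fX.
have rn : (r <= n)%N by rewrite -(eqP fX) rank_leq_col.
have e : n = (r + (n - r))%N by rewrite subnKC.
move: (n - r)%N e => k e; subst n; have [V uP] := row_free_extend fX.
pose G0 := X *m G *m X^T.
have sG0 : G0^T = G0 by rewrite /G0 !trmx_mul trmxK sG mulmxA.
have uG0 : G0 \in unitmx.
  rewrite -row_free_unit -kermx_eq0; apply/eqP/row_matrixP => i; rewrite row0.
  have := mulmx_ker G0 => /(congr1 (row i)); rewrite row_mul row0.
  move: (row i _) => u uG0; apply: contrapT => /eqP u0; apply: aB; exists (u *m X).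
    apply: contra u0 => /eqP h; have /row_freeP[Q PQ] := fX.
    by rewrite -[u]mulmx1 -PQ mulmxA h mul0mx.
  by rewrite /tilde /= trmx_mul !mulmxA -(mulmxA u) -(mulmxA u) -/G0 uG0 mul0mx mxE.
pose V' := V - V *m G *m X^T *m invmx G0 *m X.
have eP : col_mx X V' = block_mx 1%:M 0 (- (V *m G *m X^T *m invmx G0)) 1%:M *m col_mx X V.
  by rewrite mul_block_col !mul1mx mul0mx addr0 addrC mulNmx.
have uP' : col_mx X V' \in unitmx.
  by rewrite eP unitmx_mul uP andbT unitmxE det_lblock !det1 mulr1 unitr1.
have VX : V' *m G *m X^T = 0.
  by rewrite /V' !mulmxBl -!mulmxA (mulmxA X) -/G0 mulVmx // mulmx1 subrr.
have XV : X *m G *m V'^T = 0.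
  by apply: trmx_inj; rewrite trmx0 !trmx_mul trmxK sG mulmxA VX.
have eN : col_mx X V' *m G *m (col_mx X V')^T = block_mx G0 0 0 (V' *m G *m V'^T).
  by rewrite mul_col_mx tr_col_mx mul_col_row VX XV.
have uN : block_mx G0 0 0 (V' *m G *m V'^T) \in unitmx.
  by rewrite -eN !unitmx_mul uP' uG unitmx_tr.
split; first by [].
exists (BForm (V' *m G *m V'^T)); split.
  split; first by rewrite /= !trmx_mul trmxK sG mulmxA.
  by move: uN; rewrite unitmxE det_ublock unitrM -!unitmxE => /andP[].
by apply: isometric_sym; apply/isometricP; exists (col_mx X V').
Qed.

Lemma subform_rowsP C B : subform C B ->
  exists2 X : 'M[F]_(bdim C, bdim B), row_free X & gram C = X *m gram B *m X^T.
Proof.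
move=> [_ [C' [_ /isometric_sym[P /andP[/row_freeP[Q PQ] _] e]]]].
exists (usubmx P).
  apply/row_freeP; exists (Q *m col_mx 1%:M 0); rewrite mulmxA.
  have -> : usubmx P *m Q = row_mx 1%:M 0.
    move: PQ; rewrite -{1}[P]vsubmxK mul_col_mx scalar_mx_block /block_mx.
    by move=> /eq_col_mx[].
  by rewrite mul_row_col mul1mx mul0mx addr0.
move: e; rewrite /= -{1 2}[P]vsubmxK mul_col_mx tr_col_mx mul_col_row.
by move=> /eq_block_mx[].
Qed.

Lemma subform_isometric C C1 B B1 : isometric C1 C -> isometric B B1 ->
  subform C B -> subform C1 B1.
Proof.
move=> iC iB [bC [C' [bC' h]]]; split; first exact: bilinear_isometric iC bC.
exists C'; split=> //; apply: isometric_trans (isometric_sym iB) _.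
apply: isometric_trans h _; apply: isometric_orth (isometric_sym iC) _.
exact: isometric_refl.
Qed.

Lemma isometric_det B C : isometric B C -> \det (gram C) != 0 ->
  sqeq (\det (gram B)) (\det (gram C)).
Proof.
move=> h; have := isometric_dim h; case: B C h => [n G] [m H] h /= e; subst m.
move: h => /isometricP[P uP ->] _; exists (\det P).
  by rewrite -unitfE -unitmxE.
by rewrite !det_mulmx det_tr; ring.
Qed.

Lemma bilinear_scale k B : k != 0 -> bilinear_form B -> bilinear_form (bscale k B).
Proof.
move=> k0 [sB uB]; split; first by rewrite /= linearZ /= sB.
by rewrite unitmxE /= detZ unitrM unitrX ?unitfE // -unitfE -unitmxE.
Qed.

End Diagonal.

(** * The trace form of k(a, b, c) *)
Section TraceForm.
Variables (F : fieldType) (charF2 : 2%N \in [pchar F]) (s : seq F).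
Hypothesis ind : indep2 s.
Local Notation ts := totally_singular.
Local Notation M := (adj2 s).
Local Notation lam := (lam s).
Implicit Types (n t e : seq F).

(** The restriction of the form (x, y) |-> lam(x y) to the span of n. *)
Definition trace_gram n := BForm (\matrix_(i, j < size n) lam (n`_i * n`_j)).

Lemma lam_ts c v y : (forall x, x \in c -> M x) -> M y ->
  lam (ts c v * y) = \sum_i v 0 i * lam (c`_i * y).
Proof.
move=> cM My; have ci (i : 'I_(size c)) : M (c`_i * y).
  by apply: adj2_M => //; apply/cM/mem_nth.
rewrite /ts mulr_suml lam_sum // => [|i _]; last first.
  rewrite mulrAC mulrC; apply: adj2_M => //; exact: adj2_sqr.
by apply: eq_bigr => i _; rewrite mulrAC mulrC lamZ.
Qed.

Lemma ts_mons_mem v : M (ts (mons s) v).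
Proof. by apply/monsP => //; exists v. Qed.

Lemma lam_gram (u v : 'rV_(size (mons s))) :
  lam (ts (mons s) u * ts (mons s) v) = (u *m gram (diagb (mons s)) *m v^T) 0 0.
Proof.
rewrite lam_ts //; [|exact: mons_adj|exact: ts_mons_mem].
rewrite /= mul_mx_diag !mxE; apply: eq_bigr => i _.
rewrite mulrC [_ * ts _ _]mulrC lam_ts; [|exact: mons_adj|exact/mons_adj/mem_nth].
rewrite (bigD1 i) //= big1 => [|j ji]; last first.
  by rewrite lam_monsE // val_eqE (negPf ji) mulr0.
by rewrite lam_monsE // eqxx mulr1n !mxE addr0; ring.
Qed.

Lemma trace_gram_rows n (X : 'M[F]_(size n, size (mons s))) :
  (forall i, ts (mons s) (row i X) = n`_i) ->
  gram (trace_gram n) = X *m gram (diagb (mons s)) *m X^T.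
Proof.
move=> hX; apply/matrixP => i j; rewrite [LHS]mxE -!hX lam_gram.
by rewrite -row_mul [LHS]mxE [RHS]mxE; apply: eq_bigr => k _; rewrite !mxE.
Qed.

Lemma diag_mons_anisotropic : anisotropic (diagb (mons s)).
Proof.
apply/anisotropic_free => //; first by rewrite /= tr_diag_mx.
by rewrite diag_values_diagb; apply: free2_mons.
Qed.

Lemma indep2_all_nz : all (fun x => x != 0) s.
Proof. by apply/allP => x; apply: indep2_nz. Qed.

Lemma diag_mons_bilinear : bilinear_form (diagb (mons s)).
Proof. exact/bilinear_diagb/mons_nz/indep2_all_nz. Qed.

(** Coordinates with respect to the monomials embed the restricted form into rho. *)
Lemma trace_gram_subform n : free2 n -> (forall x, x \in n -> M x) ->
  subform (trace_gram n) (pfister s).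
Proof.
move=> fn nM; have [X hX] : exists X : 'M[F]_(size n, size (mons s)), forall i, ts (mons s) (row i X) = n`_i.
  by apply: span2_rowsE => y /nM /monsP; apply.
apply: subform_isometric (isometric_refl _) (isometric_sym (isometric_pfister s)) _.
rewrite (_ : trace_gram n = BForm (X *m gram (diagb (mons s)) *m X^T)); last first.
  by rewrite -trace_gram_rows.
apply: subform_rows => //; [exact: diag_mons_bilinear|exact: diag_mons_anisotropic|].
exact: free2_rows fn hX.
Qed.

Lemma diag_values_trace_gram n : (forall x, x \in n -> M x) -> diag_values (trace_gram n) = n.
Proof.
move=> nM; apply: (@eq_from_nth _ 0) => [|i]; rewrite size_diag_values //= => hi.
rewrite (nth_diag_values (B := trace_gram n) (Ordinal hi)) mxE lam_sqr //.
exact/nM/mem_nth.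
Qed.

Definition lam_orth n t := forall x y, x \in n -> y \in t -> lam (x * y) = 0.

(** Coordinates with respect to the monomials and the family n ++ t are related by a
square matrix, which is invertible because the Gram matrix of n ++ t is. *)
Lemma trace_gram_split n t : bilinear_form (trace_gram n) ->
  (forall x, x \in n ++ t -> M x) -> all (fun x => x != 0) t -> lam_orth n t ->
  pairwise (fun x y => lam (x * y) == 0) t -> (size n + size t = size (mons s))%N ->
  isometric (pfister s) (orth (trace_gram n) (diagb t)).
Proof.
move=> bn ntM t0 nt /pairwiseP-/(_ 0) pt sz.
have nM x : x \in n -> M x by move=> h; apply: ntM; rewrite mem_cat h.
have tM x : x \in t -> M x by move=> h; apply: ntM; rewrite mem_cat h orbT.
have [X hX] : exists X : 'M[F]_(size n, size (mons s)), forall i, ts (mons s) (row i X) = n`_i.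
  by apply: span2_rowsE => y /nM /monsP; apply.
have [Y hY] : exists Y : 'M[F]_(size t, size (mons s)), forall i, ts (mons s) (row i Y) = t`_i.
  by apply: span2_rowsE => y /tM /monsP; apply.
pose G := gram (diagb (mons s)).
have XY i j : (X *m G *m Y^T) i j = 0.
  have := nt n`_i t`_j (mem_nth _ (ltn_ord i)) (mem_nth _ (ltn_ord j)).
  rewrite -hX -hY lam_gram -row_mul => <-; rewrite !mxE.
  by apply: eq_bigr => k _; rewrite !mxE.
have YY i j : (Y *m G *m Y^T) i j = t`_i *+ (i == j).
  transitivity (lam (t`_i * t`_j)).
    rewrite -!hY lam_gram -row_mul !mxE.
    by apply: eq_bigr => k _; rewrite !mxE.
  case: (ltngtP i j) => [ij|ij|/val_inj->].
  - by rewrite (eqP (pt i j _ _ ij)) ?inE // -val_eqE (ltn_eqF ij).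
  - by rewrite mulrC (eqP (pt j i _ _ ij)) ?inE // -val_eqE (gtn_eqF ij).
  by rewrite eqxx lam_sqr //; apply/tM/mem_nth.
have sG : G^T = G by rewrite /G /= tr_diag_mx.
have e : col_mx X Y *m G *m (col_mx X Y)^T = gram (orth (trace_gram n) (diagb t)).
  rewrite mul_col_mx tr_col_mx mul_col_row /= -(trace_gram_rows hX).
  have XY0 : X *m G *m Y^T = 0 by apply/matrixP => i j; rewrite XY mxE.
  have -> : Y *m G *m X^T = 0.
    by apply: trmx_inj; rewrite trmx0 !trmx_mul trmxK sG mulmxA XY0.
  rewrite XY0; congr block_mx; apply/matrixP => i j; rewrite YY !mxE.
  by case: eqVneq => [->|].
apply: isometric_trans (isometric_pfister s) _; apply: isometric_sym.
have [_ uO] := bilinear_orth bn (bilinear_diagb t0).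
have fP : row_free (col_mx X Y).
  apply/row_freeP; exists (G *m (col_mx X Y)^T *m invmx (gram (orth (trace_gram n) (diagb t)))).
  by rewrite !mulmxA e mulmxV.
exists (col_mx X Y); last exact: esym e.
by rewrite fP /row_full (eqP fP) /= sz.
Qed.

(** The orthogonality conditions are fewer than the coordinates. *)
Lemma exists_orth n : (forall x, x \in n -> M x) -> (size n < size (mons s))%N ->
  exists x, [/\ x != 0, M x & forall y, y \in n -> lam (y * x) = 0].
Proof.
move=> nM sn; pose N : 'M[F]_(size (mons s), size n) :=
  \matrix_(j, i) lam ((mons s)`_j * n`_i).
have : kermx N != 0.
  rewrite -mxrank_eq0 mxrank_ker subn_eq0 -ltnNge.
  exact: leq_ltn_trans (rank_leq_col N) sn.
case/rowV0Pn => v /sub_kermxP vN v0; exists (ts (mons s) v); split.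
- apply: contra v0 => /eqP; move: v => v in vN *; move=> /(free2_mons charF2 ind) ->.
  by [].
- exact: ts_mons_mem.
move=> y yn; have hi : (index y n < size n)%N by rewrite index_mem.
rewrite mulrC lam_ts; [|exact: mons_adj|exact: nM].
move/rowP: vN => /(_ (Ordinal hi)); rewrite !mxE => e; rewrite -[RHS]e.
by apply: eq_bigr => j _; rewrite mxE /= nth_index.
Qed.

Lemma free2_ts n r (X : 'M[F]_(r, size n)) : free2 n -> row_free X ->
  free2 [seq ts n (row i X) | i <- enum 'I_r].
Proof.
move=> fn fX v; set e := [seq _ | i <- _]; have se : size e = r.
  by rewrite size_map size_enum_ord.
move=> ev; pose w : 'rV_r := \row_i v 0 (cast_ord (esym se) i).
have : ts n (w *m X) = 0.
  rewrite ts_mul // -[RHS]ev /ts [RHS](reindex (cast_ord (esym se))) /=; last first.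
    by exists (cast_ord se) => i _; rewrite ?cast_ordK ?cast_ordKV.
  apply: eq_bigr => i _; rewrite mxE mulrC (nth_map i) ?size_enum_ord //.
  by rewrite nth_ord_enum.
move=> /fn /eqP; rewrite mulmx_free_eq0 // => /eqP/rowP w0.
by apply/rowP => i; have := w0 (cast_ord se i); rewrite !mxE cast_ordK.
Qed.

Lemma row_free_sub r m p (A : 'M[F]_(m, p)) : (r <= \rank A)%N ->
  exists2 Y : 'M[F]_(r, p), row_free Y & (Y <= A)%MS.
Proof.
move=> rA; exists (pid_mx r *m row_base A).
  rewrite /row_free mxrankMfree ?row_base_free // rank_pid_mx //.
by rewrite (submx_trans (submxMl _ _)) // eq_row_base.
Qed.

End TraceForm.

Section Lines.
Variables (F : fieldType) (charF2 : 2%N \in [pchar F]) (a b c : F).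
Hypothesis ind : indep2 [:: a; b; c].
Local Notation ts := totally_singular.
Local Notation M := (adj2 [:: a; b; c]).
Local Notation E := (adj2 [:: a; b]).
Local Notation lam := (lam [:: a; b; c]).
Implicit Types (n t e : seq F).

Lemma line_adj x : E x -> M x.
Proof. by apply: adj2_subset => // y; rewrite !inE => /orP[]->; rewrite ?orbT. Qed.

Lemma last_adj : M c. Proof. by apply: adj2_mem; rewrite // !inE eqxx !orbT. Qed.

Lemma indep_cab : indep2 [:: c; a; b].
Proof.
apply: indep2_perm ind => //; apply/seq.permP => ? /=; rewrite !addn0.
by rewrite [RHS]addnC addnA.
Qed.

Lemma indep_ab : indep2 [:: a; b]. Proof. by case: indep_cab. Qed.

Lemma line_decomposition x : M x -> exists y z, [/\ E y, E z & x = y + c * z].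
Proof.
apply: (@adj2_subset _ charF2 _ [:: c; a; b]) => y; rewrite !inE.
by rewrite orbA orbC.
Qed.

Lemma lam_E (s0 s1 s2 s3 : F) :
  lam ((s0 ^+ 2 + b * s1 ^+ 2) + a * (s2 ^+ 2 + b * s3 ^+ 2)) = s0.
Proof.
have sq t y : adj2 t (y ^+ 2) by exact: adj2_sqr.
have bc x y : adj2 [:: b; c] (x ^+ 2 + b * y ^+ 2).
  by exists (x ^+ 2), (y ^+ 2).
have [_ [i2 i3]] := ind.
rewrite lam_cons // lam_cons // -[s0 ^+ 2]mulr1 lamZ ?lam1 ?mulr1 //.
exact: adj2_1.
Qed.

Lemma E_coord x : E x -> exists s0 s1 s2 s3 : F,
  x = (s0 ^+ 2 + b * s1 ^+ 2) + a * (s2 ^+ 2 + b * s3 ^+ 2).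
Proof.
move=> [y [z [[_ [_ [[s0 ->] [s1 ->] ->]]] [_ [_ [[s2 ->] [s3 ->] ->]]] ->]]].
by exists s0, s1, s2, s3.
Qed.

Lemma lam_cE x : E x -> lam (c * x) = 0.
Proof.
move=> /E_coord[s0 [s1 [s2 [s3 ->]]]].
have -> : c * (s0 ^+ 2 + b * s1 ^+ 2 + a * (s2 ^+ 2 + b * s3 ^+ 2)) =
    ((0 + c * s0 ^+ 2) + b * (0 + c * s1 ^+ 2)) + a * ((0 + c * s2 ^+ 2) + b * (0 + c * s3 ^+ 2)).
  ring.
have cc y : adj2 [:: c] (0 + c * y ^+ 2).
  by exists 0, (y ^+ 2); split=> //; [exact: adj2_0|exact: adj2_sqr].
have bc y z : adj2 [:: b; c] ((0 + c * y ^+ 2) + b * (0 + c * z ^+ 2)).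
  by exists (0 + c * y ^+ 2), (0 + c * z ^+ 2).
have [_ [i2 i3]] := ind.
rewrite lam_cons // lam_cons // lam_cons //; [|exact: adj2_0|exact: adj2_sqr].
by rewrite lam0 //; case: i3.
Qed.

(** lam(gx gcy) = g lam(cxy), and the coefficient of c x y at 1 is zero for x, y in E. *)
Lemma lam_line_orth g x y : M g -> E x -> E y -> lam ((g * x) * (g * c * y)) = 0.
Proof.
move=> Mg Ex Ey; have -> : (g * x) * (g * c * y) = g ^+ 2 * (c * (x * y)) by ring.
have Exy : E (x * y) by apply: adj2_M.
rewrite lamZ // ?lam_cE ?mulr0 //; apply: adj2_M => //; [exact: last_adj|exact: line_adj].
Qed.

(** Write w / g = y + c z with y, z in E.  Then lam(w g y) = g lam(y y) = g y. *)
Lemma orth_line g w : M g -> g != 0 -> M w ->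
  (forall x, E x -> lam (w * (g * x)) = 0) -> E (w / (g * c)).
Proof.
move=> Mg g0 Mw h; have Mwg : M (w / g) by apply: adj2_div.
have [y [z [Ey Ez e]]] := line_decomposition Mwg.
have c0 : c != 0 by apply: indep2_nz ind _; rewrite !inE eqxx !orbT.
have y0 : y = 0.
  apply: (mulfI g0); rewrite mulr0 -(h y Ey).
  have -> : w * (g * y) = g ^+ 2 * (y * y + c * (z * y)).
    have -> : w = g * (y + c * z) by rewrite -e mulrC divfK.
    ring.
  have Ezy : E (z * y) by apply: adj2_M.
  have Myy : M (y * y) by apply: adj2_M => //; apply: line_adj.
  have Mcz : M (c * (z * y)) by apply: adj2_M => //; [exact: last_adj|exact: line_adj].
  have Ms : M (y * y + c * (z * y)) by apply: adj2_D.
  by rewrite lamZ // lamD // lam_cE // addr0 lam_sqr //; apply: line_adj.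
rewrite invfM mulrA e y0 add0r mulrAC mulfV // mul1r.
exact: Ez.
Qed.

Lemma monsE_mem x : x \in mons [:: a; b] -> E x. Proof. exact: mons_adj. Qed.

Lemma lam_mons_sum g y v : M g -> M y ->
  lam (y * (g * ts (mons [:: a; b]) v)) =
  \sum_j v 0 j * lam ((mons [:: a; b])`_j * (g * y)).
Proof.
move=> Mg My; have -> : y * (g * ts (mons [:: a; b]) v) = ts (mons [:: a; b]) v * (g * y) by ring.
by apply: lam_ts => //; [move=> x /monsE_mem/line_adj|apply: adj2_M].
Qed.

(** The form pairs span n with the line gE.  The family t gives a subspace of gE that
pairs to zero with span n, so the rank is at most 4 - size t, and the left kernel, which
is the part of span n orthogonal to gE, has dimension at least size n - (4 - size t). 
By [orth_line] it lies in gcE. *)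
Lemma orth_to_line g n t : M g -> g != 0 -> (forall x, x \in n -> M x) -> free2 n ->
  free2 t -> (forall x, x \in t -> E x) ->
  (forall x y, x \in n -> y \in t -> lam (x * (g * y)) = 0) ->
  exists e, [/\ free2 e, size e = (size n + size t - 4)%N &
    forall x, x \in e -> span2 n x /\ E (x / (g * c))].
Proof.
move=> Mg g0 nM fn ft tE nt; pose m := mons [:: a; b].
have [X hX] : exists X : 'M[F]_(size t, size m), forall i, ts m (row i X) = t`_i.
  by apply: span2_rowsE => y /tE /monsP; apply.
have fX := free2_rows charF2 ft hX.
pose N : 'M[F]_(size n, size m) := \matrix_(i, j) lam (m`_j * (g * n`_i)).
have nMi (i : 'I_(size n)) : M n`_i by apply/nM/mem_nth.
have NX : N *m X^T = 0.
  apply/matrixP => i j; rewrite [RHS]mxE -(nt _ _ (mem_nth 0 (ltn_ord i)) (mem_nth 0 (ltn_ord j))).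
  rewrite -hX lam_mons_sum // mxE; apply: eq_bigr => k _.
  by rewrite !mxE mulrC.
have rN : (size n + size t - 4 <= \rank (kermx N))%N.
  have := mulmx0_rank_max NX; rewrite mxrank_tr (eqP fX) mxrank_ker => h.
  have h4 : (\rank N + size t <= 4)%N := h.
  have := rank_leq_row N; lia.
have [Y fY YN] := row_free_sub rN.
exists [seq ts n (row i Y) | i <- enum 'I_(size n + size t - 4)%N]; split.
- exact: free2_ts.
- by rewrite size_map size_enum_ord.
move=> _ /mapP[i _ ->]; set y := row i Y.
have yN : y *m N = 0 by apply/sub_kermxP/(submx_trans (row_sub i Y)).
split; first by exists y.
apply: orth_line => //.
  rewrite /ts; apply: (big_ind M) => [|u v|k _]; [exact: adj2_0|exact: adj2_D|].
  by apply: adj2_M => //; apply: adj2_sqr.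
move=> x Ex; have /monsP-/(_ charF2)[v ->] := Ex.
rewrite lam_ts //; last first.
  apply: adj2_M => //; apply: line_adj; apply/monsP => //; by exists v.
transitivity ((y *m N *m v^T) 0 0); last by rewrite yN mul0mx mxE.
rewrite -mulmxA mxE; apply: eq_bigr => k _; congr (_ * _).
rewrite lam_mons_sum // mxE; apply: eq_bigr => j _.
by rewrite !mxE mulrC.
Qed.

(** The form pairs span n with the line gcE.  The family e spans a subspace of span n in
gE, which pairs to zero with gcE, so the rank is at most size n - size e, and the right
kernel has dimension at least 4 - (size n - size e). *)
Lemma line_to_orth g n e : M g -> g != 0 -> (forall x, x \in n -> M x) ->
  free2 e -> (forall x, x \in e -> span2 n x /\ E (x / g)) ->
  exists t, [/\ free2 t, size t = (4 + size e - size n)%N &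
    forall y, y \in t -> E y /\ forall x, x \in n -> lam (x * (g * c * y)) = 0].
Proof.
move=> Mg g0 nM fe he; pose m := mons [:: a; b].
have Mgc : M (g * c) by apply: adj2_M => //; exact: last_adj.
have [Y hY] : exists Y : 'M[F]_(size e, size n), forall i, ts n (row i Y) = e`_i.
  by apply: span2_rowsE => y /he[].
have fY := free2_rows charF2 fe hY.
pose N : 'M[F]_(size n, size m) := \matrix_(i, j) lam (m`_j * (g * c * n`_i)).
have nMi (i : 'I_(size n)) : M n`_i by apply/nM/mem_nth.
have mE (j : 'I_(size m)) : E m`_j by apply/monsE_mem/mem_nth.
have YN : Y *m N = 0.
  apply/matrixP => k j; rewrite [RHS]mxE.
  have [_ Ee] := he _ (mem_nth 0 (ltn_ord k)).
  rewrite -(lam_line_orth Mg Ee (mE j)) (mulrC g (_ / g)) divfK // -hY lam_ts //; last first.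
    by apply: adj2_M => //; apply: line_adj.
  rewrite mxE; apply: eq_bigr => i _; rewrite !mxE; congr (_ * lam _); ring.
have rN : (4 + size e - size n <= \rank (kermx N^T))%N.
  have := mulmx0_rank_max YN; rewrite (eqP fY) mxrank_ker mxrank_tr /= => h.
  have h4 : (\rank N <= 4)%N := rank_leq_col N.
  lia.
have [X fX XN] := row_free_sub rN.
exists [seq ts m (row i X) | i <- enum 'I_(4 + size e - size n)%N]; split.
- by apply: free2_ts => //; apply: free2_mons => //; exact: indep_ab.
- by rewrite size_map size_enum_ord.
move=> _ /mapP[i _ ->]; set x := row i X.
have xN : x *m N^T = 0 by apply/sub_kermxP/(submx_trans (row_sub i X)).
split; first by apply/monsP => //; exists x.
move=> y yn; have hi : (index y n < size n)%N by rewrite index_mem.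
rewrite lam_mons_sum //; last exact: nM.
move/rowP: xN => /(_ (Ordinal hi)); rewrite !mxE => e0; rewrite -[RHS]e0.
by apply: eq_bigr => j _; rewrite !mxE /= nth_index.
Qed.

End Lines.

(** * The class of C + det C + <<u, v>> *)
Section Triple.
Variables (F : fieldType) (charF2 : 2%N \in [pchar F]).
Variables (a b c alpha x y z u v : F) (C : bform F).
Hypotheses (a0 : a != 0) (b0 : b != 0) (c0 : c != 0) (alpha0 : alpha != 0)
  (x0 : x != 0) (y0 : y != 0) (z0 : z != 0) (u0 : u != 0) (v0 : v != 0).
Hypotheses (bC : bilinear_form C) (C5 : bdim C = 5%N).
Hypothesis split : isometric (pfister [:: a; b; c]) (orth (bscale alpha C) (diagb [:: x; y; z])).

Let k := alpha * (x * y * z).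
Let k0 : k != 0. Proof. by rewrite !mulf_neq0. Qed.

(** The determinant of rho is the square of (abc)^2, and det(alpha C) = alpha^5 det C. *)
Lemma triple_det : sqeq (\det (gram C)) k.
Proof.
have xyz0 : all (fun t => t != 0) [:: x; y; z] by rewrite /= x0 y0 z0.
have hm : all (fun t => t != 0) (mons [:: a; b; c]) by apply: mons_nz; rewrite /= a0 b0 c0.
have iso := isometric_trans (isometric_sym (isometric_pfister _)) split.
have detd (s : seq F) : \det (gram (diagb s)) = \prod_(i < size s) s`_i.
  by rewrite det_diag; apply: eq_bigr => i _; rewrite mxE.
have d0 : \det (gram C) != 0 by case: bC => _; rewrite unitmxE unitfE.
have [|r r0] := isometric_det iso.
  have [_] := bilinear_orth (bilinear_scale alpha0 bC) (bilinear_diagb xyz0).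
  by rewrite unitmxE unitfE.
have C5' : alpha ^+ bdim C = alpha ^+ 5 by rewrite C5.
rewrite detd /= det_ublock detZ C5' [\det (diag_mx _)](detd [:: x; y; z]).
rewrite !big_ord_recl !big_ord0 /= => e.
have e' : (a * b * c) ^+ 4 = alpha ^+ 5 * \det (gram C) * (x * y * z) * r ^+ 2.
  by move: e => /= e; transitivity (alpha ^+ 5 * \det (gram C) * (x * (y * (z * 1))) * r ^+ 2); [rewrite -e; ring|ring].
exists ((a * b * c) ^+ 2 / (alpha ^+ 3 * (x * y * z) * r)).
  by rewrite !mulf_neq0 ?invr_eq0 ?mulf_neq0 ?expf_neq0 // !mulf_neq0.
have -> : k * ((a * b * c) ^+ 2 / (alpha ^+ 3 * (x * y * z) * r)) ^+ 2 =
    (a * b * c) ^+ 4 / (alpha ^+ 5 * (x * y * z) * r ^+ 2).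
  by rewrite /k; field; rewrite r0 z0 y0 x0 alpha0.
by rewrite e'; field; rewrite r0 z0 y0 x0 alpha0.
Qed.

Local Notation pf1 := (pfister [:: y * z; x * z]).
Local Notation L3 := [:: alpha * x; alpha * y; alpha * z].
Local Notation m1 := (mons [:: y * z; x * z]).

(** In the Witt ring, C = alpha rho + alpha <x, y, z>, since 2 C = 0 for every form. 
With k = alpha x y z this gives C + <k> = alpha rho + k <<yz, xz>>, because k <<yz, xz>>
= <k, alpha y, alpha x, alpha z> up to squares.  Hence C + <det C> = <<yz, xz>> + alpha
rho + <<k, yz, xz>>, and the last two terms are in I^3. *)
Lemma e2_graph_triple :
  e2_graph (orth (orth C (diagb [:: \det (gram C)])) (pfister [:: u; v]))
    (wedge (dlog (y * z)) (dlog (x * z)) + wedge (dlog u) (dlog v)).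
Proof.
set d := \det (gram C); have [r r0 ed] := triple_det.
have d0 : d != 0 by case: bC => _; rewrite unitmxE unitfE.
pose psi1 := tensor (diagb [:: 1; a]) (tensor (diagb [:: 1; b]) (tensor (diagb [:: 1; c]) (diagb [:: alpha]))).
pose psi2 := tensor (diagb [:: 1; k]) pf1.
have bd1 (t : F) : t != 0 -> bilinear_form (diagb [:: 1; t]).
  by move=> t0; apply: bilinear_diagb; rewrite /= oner_eq0 t0.
have bs1 (t : F) : t != 0 -> bilinear_form (diagb [:: t]).
  by move=> t0; apply: bilinear_diagb; rewrite /= t0.
exists [:: (y * z, x * z); (u, v)], (orth psi1 psi2); split.
- by rewrite /= !mulf_neq0 // u0 v0.
- apply: Ipow_add; apply: Ipow_mul => //; try exact: bd1.
    apply: Ipow_mul => //; first exact: bd1.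
    by apply: Ipow_mul => //; [exact: bd1|apply/Ipow_all/bs1].
  apply: Ipow_mul => //; first by apply/bd1/mulf_neq0.
  apply: Ipow_mul => //; first by apply/bd1/mulf_neq0.
  exact/Ipow_all/bs1/oner_neq0.
  (* the metabolic form to add on the left is the double of alpha <x, y, z> + <<yz, xz>> *)
- pose L := L3 ++ m1.
  have L0 : all (fun t => t != 0) L.
    rewrite all_cat; apply/andP; split; first by rewrite /= !mulf_neq0.
    by apply: mons_nz; rewrite /= !mulf_neq0.
  exists (orth (diagb L) (diagb L)), (bzero F); split.
  + exact: metabolic_double.
  + exact: metabolic_zero.
  pose A := [seq alpha * t | t <- mons [:: a; b; c]].
  have CA : isometric (orth C (diagb L3)) (diagb A).
    apply: isometric_trans (isometric_scale_diag _ _).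
    apply: isometric_trans (isometric_scale alpha (isometric_pfister _)).
    apply: isometric_trans (isometric_scale alpha (isometric_sym split)).
    apply: isometric_trans (isometric_sym (isometric_scale_orth _ _ _)).
    apply: isometric_orth; last exact: isometric_sym (isometric_scale_diag alpha [:: x; y; z]).
    exact: isometric_sym (isometric_scaleK C alpha0).
  have lhs : isometric (orth (orth (orth C (diagb [:: d])) (pfister [:: u; v])) (orth (diagb L) (diagb L)))
      (diagb (A ++ (([:: d] ++ mons [:: u; v]) ++ (m1 ++ L)))).
    apply: isometric_trans (isometric_diag_cat _ _).
    apply: isometric_trans (isometric_orth CA (isometric_diag_cat _ _)).
    apply: isometric_trans (isometric_orth (isometric_refl _) (isometric_orth (isometric_diag_cat _ _) (isometric_refl _))).
    apply: isometric_trans (isometric_orthACA _ _ _ _).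
    apply: isometric_orth.
      apply: isometric_trans (isometric_sym (isometric_orthA _ _ _)) _.
      apply: isometric_orth; first exact: isometric_refl.
      by apply: isometric_orth; [exact: isometric_refl|exact: isometric_pfister].
    apply: isometric_trans (isometric_diag_cat _ _) _.
    apply: isometric_trans (isometric_sym (isometric_diag_cat L3 _)).
    by rewrite /L -catA; exact: isometric_refl.
  have p1 : isometric psi1 (diagb A).
    apply: isometric_trans (isometric_tensor _ (isometric_tensor _ (isometric_tensor1 _ _))) _.
    apply: isometric_trans (isometric_tensor _ (isometric_tensor1 _ _)) _.
    apply: isometric_trans (isometric_tensor1 _ _) _.
    rewrite (_ : _ ++ _ = A); first exact: isometric_refl.
    by rewrite /A /=; do ?congr cons; ring.
  have p2 : isometric psi2 (diagb (m1 ++ [:: d; alpha * y; alpha * x; alpha * z])).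
    apply: isometric_trans (isometric_tensor _ (isometric_pfister _)) _.
    apply: isometric_trans (isometric_tensor1 _ _) _.
    apply: isometric_trans (isometric_sym (isometric_diag_cat _ _)) _.
    apply: isometric_trans (isometric_diag_cat _ _).
    apply: isometric_orth; first exact: isometric_refl.
    apply: isometric_diag_sqeq => // -[|[|[|[|//]]]] _ /=.
    + by exists r^-1; rewrite ?invr_eq0 // (ed : d = _); field.
    + by exists (x * z); rewrite ?mulf_neq0 // /k; ring.
    + by exists (y * z); rewrite ?mulf_neq0 // /k; ring.
    by exists (x * y * z); rewrite ?mulf_neq0 // /k; ring.
  apply: isometric_trans lhs _; apply: isometric_sym.
  apply: isometric_trans (isometric_orth0 _) _.
  apply: isometric_trans (isometric_orth (isometric_orth (isometric_pfister _)
    (isometric_trans (isometric_orth0 _) (isometric_pfister _))) (isometric_orth p1 p2)) _.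
  apply: isometric_trans (isometric_orth (isometric_diag_cat _ _) (isometric_diag_cat _ _)) _.
  apply: isometric_trans (isometric_diag_cat _ _) _.
  apply: isometric_diag_perm; apply/seq.permP => P.
  rewrite !count_cat /=; ring.
by rewrite /symbol_sum !big_cons big_nil addr0.
Qed.

End Triple.

(** * The two implications *)
Section Conclusion.
Variables (F : fieldType) (charF2 : 2%N \in [pchar F]).
Local Notation ts := totally_singular.
Local Notation symb x y := (wedge (dlog x) (dlog y)).
Implicit Types (e n t : seq F).

Lemma dlog1 : dlog (1 : F) = 0.
Proof. by rewrite -[1](expr1n F 2) dlog_sqr. Qed.

Lemma symbols_le1 (w : Omega2 F) : (exists s, [/\ symbols s, (size s <= 1)%N & symbol_sum s = w]) ->
  exists x y, [/\ x != 0, y != 0 & w = symb x y].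
Proof.
move=> [s [hs s1 <-]]; case: s hs s1 => [|[x y] [|//]] hs _.
  exists 1, 1; rewrite oner_neq0 /symbol_sum big_nil dlog1; split=> //.
  by rewrite wedge0l.
move: hs => /= /andP[/andP[x0 y0] _]; exists x, y; split=> //.
by rewrite /symbol_sum big_seq1.
Qed.

(** At most one symbol amounts to exactly one, as dlog 1 dlog 1 = 0. *)
Lemma nu2_length2 (x y u v : F) : x != 0 -> y != 0 -> u != 0 -> v != 0 ->
  (forall x' y', x' != 0 -> y' != 0 -> symb x y + symb u v <> symb x' y') ->
  nu2_length (symb x y + symb u v) 2.
Proof.
move=> x0 y0 u0 v0 h; split.
  exists [:: (x, y); (u, v)]; split=> //; first by rewrite /= x0 y0 u0 v0.
  by rewrite /symbol_sum !big_cons big_nil addr0.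
move=> s hs e; rewrite ltnNge; apply/negP => s1.
have [|x' [y' [x'0 y'0 e']]] := @symbols_le1 (symb x y + symb u v); first by exists s.
exact: h e'.
Qed.

Lemma in_F2_adj2 (a b x : F) : in_F2 a b x -> adj2 [:: a; b] x.
Proof.
elim=> {x} [x [[y ->]|[->|->]]||x y _ hx _ hy|x y _ hx _ hy|x _ hx].
- exact: adj2_sqr.
- exact/adj2_mem/mem_head.
- by apply/adj2_mem; rewrite // !inE eqxx orbT.
- exact: adj2_1.
- by rewrite oppr_pchar2 //; apply: adj2_D.
- exact: adj2_M.
exact: adj2_V.
Qed.

(** Otherwise u, v and uv would lie in a field of degree 2 over k. *)
Lemma free2_indep (u v : F) : free2 [:: u; v; u * v] -> indep2 [:: u; v].
Proof.
move=> fr; have h y : (forall x, x \in [:: u; v] -> adj2 [:: y] x) -> False.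
  move=> hy; suff : (3 <= size (mons [:: y]))%N by [].
  apply: (free2_size charF2 (e := [:: u; v; u * v])) => // x; rewrite !inE => hx.
  have yu : adj2 [:: y] u by apply: hy; rewrite !inE eqxx.
  have yv : adj2 [:: y] v by apply: hy; rewrite !inE eqxx orbT.
  by apply/monsP => //; case/or3P: hx => /eqP-> //; apply: adj2_M.
split=> [uv|]; last split=> // vs.
  apply: (h v) => x; rewrite !inE => /orP[]/eqP->//; exact/adj2_mem/mem_head.
apply: (h u) => x; rewrite !inE => /orP[]/eqP->; first exact/adj2_mem/mem_head.
exact: adj2_cons.
Qed.

Lemma free2_perm e t : perm_eq e t -> free2 e -> free2 t.
Proof.
move=> p fe; have ie := isometric_sym (isometric_diag_perm p).
have sd (s : seq F) : (gram (diagb s))^T = gram (diagb s) by rewrite /= tr_diag_mx.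
rewrite -[t]diag_values_diagb; apply/anisotropic_free => //.
apply: isometric_anisotropic ie _; apply/anisotropic_free => //.
by rewrite diag_values_diagb.
Qed.

Lemma free2_indep_mons (a b : F) : indep2 [:: a; b] -> free2 [:: a; b; a * b].
Proof.
move=> /(free2_mons charF2); rewrite /= !mulr1 => /(free2_consP charF2)[_ h].
by apply: free2_perm h; apply/seq.permP => P /=; ring.
Qed.

(** Let p = yz, q = xz and P = k p + k q + k pq, so that xyz P = kx + ky + kz.  Write e
= s0^2 + s1^2 q + s2^2 p + s3^2 pq.  The element (s1 q)^2 p + (s2 p)^2 q of P, or p if
s1 = s2 = 0, stays in P when multiplied by e: the two terms without p, q or pq cancel. *)
Lemma pure_line (x y z e : F) : x != 0 -> y != 0 -> z != 0 ->
  indep2 [:: y * z; x * z] -> adj2 [:: y * z; x * z] e ->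
  exists g, [/\ g != 0, span2 [:: x; y; z] g & span2 [:: x; y; z] (g * e)].
Proof.
move=> x0 y0 z0 ind [_ [_ [[_ [_ [[s0 ->] [s1 ->] ->]]] [_ [_ [[s2 ->] [s3 ->] ->]]] ->]]].
have sx r : span2 [:: x; y; z] (r ^+ 2 * x) by apply/span2_Z/span2_mem; rewrite // !inE eqxx.
have sy r : span2 [:: x; y; z] (r ^+ 2 * y) by apply/span2_Z/span2_mem; rewrite // !inE eqxx orbT.
have sz r : span2 [:: x; y; z] (r ^+ 2 * z) by apply/span2_Z/span2_mem; rewrite // !inE eqxx !orbT.
have sD := @span2_D F charF2 [:: x; y; z].
have [/eqP|] := boolP ((s1 == 0) && (s2 == 0)).
  rewrite eqb_id => /andP[/eqP-> /eqP->].
  exists (x * y * z * (y * z)); split; first by rewrite !mulf_neq0.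
    by have := sx (y * z); congr (span2 _ _); ring.
  have := sD _ _ (sx (s0 * (y * z))) (sy (s3 * (x * y * z ^+ 2))).
  by congr (span2 _ _); ring.
rewrite negb_and => s12; pose u := y * z; pose v := x * z.
have u0 : u != 0 by rewrite mulf_neq0.
have v0 : v != 0 by rewrite mulf_neq0.
exists (x * y * z * ((s1 * v) ^+ 2 * u + (s2 * u) ^+ 2 * v)); split.
- rewrite !mulf_neq0 //; apply/eqP => /(add2_eq charF2) e0.
  have [s10|s10] := eqVneq s1 0.
    move: s12 e0; rewrite s10 eqxx /= mul0r expr0n mul0r => s20 /esym/eqP.
    by rewrite mulf_eq0 expf_eq0 mulf_eq0 (negPf s20) (negPf u0) (negPf v0).
  case: ind => nu _; apply: nu; rewrite -/u -/v.
  have sv0 : (s1 * v) ^+ 2 != 0 by rewrite expf_neq0 // mulf_neq0.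
  have -> : u = (s2 * u / (s1 * v)) ^+ 2 * v.
    by apply: (mulfI sv0); rewrite e0; field; rewrite ?s10 ?v0 ?x0 ?z0.
  by apply: adj2_M => //; [exact: adj2_sqr|apply/adj2_mem/mem_head].
- have := sD _ _ (sx (s1 * v * (y * z))) (sy (s2 * u * (x * z))).
  by congr (span2 _ _); rewrite /u /v; ring.
have := sD _ _ (sD _ _ (sx (s0 * s1 * v * (y * z))) (sy (s0 * s2 * u * (x * z))))
  (sD _ _ (sD _ _ (sz (s1 ^+ 2 * v * (x * y * z))) (sz (s2 ^+ 2 * u * (x * y * z))))
     (sD _ _ (sy (s3 * s1 * u * v * (x * z))) (sx (s3 * s2 * u * v * (y * z))))).
congr (span2 _ _); rewrite /u /v; apply: (add2_eq charF2); ring2 charF2.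
Qed.

(** The fraction y / z or x / z would be a combination of squares that makes x, y, z
dependent. *)
Lemma indep2_slots (x y z : F) : z != 0 -> free2 [:: x; y; z] ->
  indep2 [:: y * z; x * z].
Proof.
move=> z0 fr; have [nx _] := (free2_consP charF2 _ _).1 fr.
have pz r : z * (r / z) ^+ 2 = r ^+ 2 / z by field.
have [ny _] : ~ span2 [:: x; z] y /\ free2 [:: x; z].
  apply/free2_consP => //; apply: free2_perm fr; apply/seq.permP => P /=; ring.
have sz (l : seq F) r : z \in l -> span2 l (r ^+ 2 / z).
  by move=> zl; rewrite -pz mulrC; apply/span2_Z/span2_mem.
split=> [[_ [_ [[s ->] [t ->] e]]]|]; last split=> // -[s e].
  apply: ny; have -> : y = t ^+ 2 * x + s ^+ 2 / z.
    by apply: (mulIf z0); rewrite e; field.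
  apply: span2_D => //; last by apply: sz; rewrite !inE eqxx orbT.
  by apply/span2_Z/span2_mem; rewrite // !inE eqxx.
apply: nx; have -> : x = s ^+ 2 / z by rewrite -e; field.
by apply: sz; rewrite !inE eqxx orbT.
Qed.

(** The matrix that expresses e in terms of c is invertible. *)
Lemma free2_spanning c e : free2 e -> (forall y, y \in e -> span2 c y) ->
  size e = size c -> free2 c.
Proof.
move=> fe ec sz; have [X hX] := span2_rowsE ec.
have fX := free2_rows charF2 fe hX.
have /row_fullP[Q QX] : row_full X by rewrite /row_full (eqP fX) sz.
move=> w; rewrite -[w]mulmx1 -QX mulmxA ts_mul // => e0.
suff -> : w *m Q = 0 by rewrite mul0mx.
by apply: fe; rewrite -[RHS]e0; apply: eq_bigr => i _; rewrite hX mulrC.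
Qed.

Lemma subform_of_values (B : bform F) e : bilinear_form B -> anisotropic B -> free2 e ->
  (forall x, x \in e -> span2 (diag_values B) x) ->
  exists C, subform C B /\ diag_values C = e.
Proof.
move=> bB aB fe eB; have [X hX] := span2_rowsE eB.
pose Y := castmx (erefl, size_diag_values B) X.
have fY : row_free Y.
  by rewrite /Y; case: _ / (size_diag_values B); rewrite castmx_id; apply: free2_rows hX.
exists (BForm (Y *m gram B *m Y^T)); split; first exact: subform_rows.
apply: (@eq_from_nth _ 0) => [|i]; rewrite size_diag_values //= => hi.
rewrite (nth_diag_values (B := BForm (Y *m gram B *m Y^T)) (Ordinal hi)) -[RHS](hX (Ordinal hi)).
have -> : row (Ordinal hi) X = \row_j (row (Ordinal hi) Y) 0 (cast_ord (size_diag_values B) j).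
  by apply/rowP => j; rewrite !mxE castmxE cast_ordK cast_ord_id.
rewrite -tilde_ts ?bB.1 // /tilde -row_mul [LHS]mxE [RHS]mxE.
by apply: eq_bigr => k _; rewrite !mxE.
Qed.

Lemma subform_values (B C : bform F) x : bilinear_form B -> subform C B ->
  x \in diag_values C -> span2 (diag_values B) x.
Proof.
move=> bB /subform_rowsP[X fX e] xC; apply/span2_tilde; rewrite ?bB.1 //.
have hi : (index x (diag_values C) < bdim C)%N by rewrite -(size_diag_values C) index_mem.
pose i := Ordinal hi; have -> : x = gram C i i by rewrite -nth_diag_values /= nth_index.
exists (row i X); rewrite e /tilde -row_mul [LHS]mxE [RHS]mxE.
by apply: eq_bigr => k _; rewrite !mxE.
Qed.

Lemma subform_free (B C : bform F) : bilinear_form B -> anisotropic B -> subform C B ->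
  free2 (diag_values C).
Proof.
move=> bB aB sC; apply/anisotropic_free => //; first by case: sC => -[].
have [X fX e] := subform_rowsP sC; move=> [v v0 hv]; apply: aB; exists (v *m X).
  by apply: contra v0; rewrite mulmx_free_eq0.
by rewrite -hv /tilde trmx_mul e !mulmxA.
Qed.

Lemma diag_values_ext (K : fieldType) (iota : {rmorphism F -> K}) (B : bform F) :
  diag_values (bext iota B) = map iota (diag_values B).
Proof.
apply: (@eq_from_nth _ 0) => [|i].
  by rewrite size_diag_values size_map size_diag_values.
rewrite size_diag_values /= => hi; rewrite (nth_map 0) ?size_diag_values //.
by rewrite (nth_diag_values (B := bext iota B) (Ordinal hi))
           (nth_diag_values (B := B) (Ordinal hi)) /= mxE.
Qed.

Lemma tilde_diagb (c : seq F) (v : 'rV_(size c)) : tilde (diagb c) v = ts c v.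
Proof.
rewrite tilde_diag //; last by rewrite /= tr_diag_mx.
by apply: eq_bigr => i _; rewrite gram_diagb eqxx.
Qed.

Lemma subform_mons_value s (D : bform F) (X : 'M_(bdim D, _)) i :
  gram D = X *m gram (diagb (mons s)) *m X^T ->
  ts (mons s) (row i X) = (diag_values D)`_i.
Proof.
move=> eX; rewrite nth_diag_values eX -tilde_diagb /tilde -row_mul [LHS]mxE [RHS]mxE.
by apply: eq_bigr => k _; rewrite !mxE.
Qed.

Lemma subform_mons_adj s (D : bform F) x : subform D (diagb (mons s)) ->
  x \in diag_values D -> adj2 s x.
Proof.
move=> sD; have [X _ eX] := subform_rowsP sD => xD.
have hi : (index x (diag_values D) < bdim D)%N by rewrite -(size_diag_values D) index_mem.
apply/monsP => //; exists (row (Ordinal hi) X).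
by rewrite (subform_mons_value (Ordinal hi) eX) /= nth_index.
Qed.

Lemma subform_trace_gram s (D : bform F) : indep2 s -> subform D (diagb (mons s)) ->
  isometric D (trace_gram s (diag_values D)).
Proof.
move=> ind sD; have [X _ eX] := subform_rowsP sD.
apply: (@isometric_cast _ D (trace_gram s (diag_values D)) (esym (size_diag_values D))) => i j.
rewrite [RHS]mxE /= -!(subform_mons_value _ eX) lam_gram // -row_mul eX [LHS]mxE [RHS]mxE.
by apply: eq_bigr => k _; rewrite !mxE.
Qed.

Section OrthogonalFamilies.
Variables (s : seq F).
Hypothesis ind : indep2 s.

Lemma orth_span1 t x y : adj2 s x ->
  (forall z, z \in t -> adj2 s z /\ lam s (x * z) = 0) ->
  span2 t y -> adj2 s y /\ lam s (x * y) = 0.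
Proof.
move=> Mx h; move: y; apply: span2_ind => //.
- by rewrite mulr0 lam0 //; split=> //; apply: adj2_0.
- move=> y z [My hy] [Mz hz]; split; first exact: adj2_D.
  by rewrite mulrDr lamD ?hy ?hz ?addr0 //; apply: adj2_M.
move=> r y [My hy]; split; first by apply: adj2_M => //; apply: adj2_sqr.
by rewrite mulrCA lamZ ?hy ?mulr0 //; apply: adj2_M.
Qed.

(** If x were in the span of t, then x = lam(x x) = 0. *)
Lemma orth_free t : (forall x, x \in t -> adj2 s x) -> all (fun x => x != 0) t ->
  pairwise (fun x y => lam s (x * y) == 0) t -> free2 t.
Proof.
elim: t => [|x t IH] tM /=; first by move=> _ _; apply: free2_nil.
move=> /andP[x0 t0] /andP[/allP xt pt]; apply/free2_consP => //.
have Mx : adj2 s x by apply/tM/mem_head.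
have tM' y : y \in t -> adj2 s y by move=> yt; apply: tM; rewrite inE yt orbT.
split; last exact: IH.
move=> xs; have [|_] := orth_span1 (t := t) Mx _ xs.
  by move=> y yt; split; [apply: tM'|apply/eqP/xt].
by rewrite lam_sqr // => e; rewrite e eqxx in x0.
Qed.

Lemma orth_span n t x y : (forall z, z \in n ++ t -> adj2 s z) -> lam_orth s n t ->
  x \in n -> span2 t y -> lam s (x * y) = 0.
Proof.
move=> ntM nt xn yt; suff [] : adj2 s y /\ lam s (x * y) = 0 by [].
apply: orth_span1 yt; first by apply: ntM; rewrite mem_cat xn.
by move=> z zt; split; [apply: ntM; rewrite mem_cat zt orbT|apply: nt].
Qed.

Lemma orth_triple n : (forall x, x \in n -> adj2 s x) -> (size n + 2 < size (mons s))%N ->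
  exists x y z, [/\ [/\ x != 0, y != 0 & z != 0],
    forall w, w \in [:: x; y; z] -> adj2 s w,
    lam_orth s n [:: x; y; z] & pairwise (fun x y => lam s (x * y) == 0) [:: x; y; z]].
Proof.
move=> nM sn.
have [|x [x0 Mx xn]] := exists_orth charF2 ind nM; first by apply: leq_trans sn; rewrite ltnS leq_addr.
have nM1 y : y \in x :: n -> adj2 s y by rewrite inE => /predU1P[->|/nM].
have [|y [y0 My yn]] := exists_orth charF2 ind nM1.
  by apply: leq_trans sn; rewrite /= addn2.
have nM2 z : z \in y :: x :: n -> adj2 s z by rewrite inE => /predU1P[->|/nM1].
have [|z [z0 Mz zn]] := exists_orth charF2 ind nM2.
  by apply: leq_trans sn; rewrite /= addn2.
exists x, y, z; split=> //.
- by move=> w; rewrite !inE => /or3P[]/eqP->.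
- move=> u w un; rewrite !inE => /or3P[]/eqP->; [exact: xn| |].
    by apply: yn; rewrite inE un orbT.
  by apply: zn; rewrite !inE un !orbT.
rewrite /= !andbT -andbA; apply/and3P; split; apply/eqP.
- by apply: yn; rewrite mem_head.
- by apply: zn; rewrite !inE eqxx orbT.
by apply: zn; rewrite mem_head.
Qed.

Lemma trace_gram_diag t : (forall x, x \in t -> adj2 s x) ->
  pairwise (fun x y => lam s (x * y) == 0) t -> isometric (trace_gram s t) (diagb t).
Proof.
move=> tM /pairwiseP-/(_ 0) pt; apply: (isometric_diag (B := trace_gram s t) erefl) => i j.
rewrite mxE; case: (ltngtP i j) => [ij|ij|/val_inj->].
- by rewrite (eqP (pt i j _ _ ij)) ?inE // -val_eqE (ltn_eqF ij).
- by rewrite mulrC (eqP (pt j i _ _ ij)) ?inE // -val_eqE (gtn_eqF ij).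
by rewrite eqxx lam_sqr //; apply/tM/mem_nth.
Qed.

End OrthogonalFamilies.

Section Equivalence.
Variables (a b : F).
Hypothesis anisoQ : qanisotropic (totally_singular [:: 1; a; b]).
Variables (K : fieldType) (iota : {rmorphism F -> K}).
Hypothesis FQ : is_function_field a b iota.
Variable B : bform F.
Hypotheses (bB : bilinear_form B) (aB : anisotropic B) (dimB : bdim B = 5%N).
Local Notation E := (adj2 [:: a; b]).

Definition e2_condition c (C : bform F) :=
  forall u v : F, in_F2 a b u -> in_F2 a b v -> u != 0 -> v != 0 ->
  (exists D, subform D (pfister [:: a; b; c]) /\
    similar_forms (diagb [:: u; v; u * v]) D) ->
  e2_length (orth (orth C (diagb [:: \det (gram C)])) (pfister [:: u; v])) 2.

(** Three elements of a line would be the diagonal values of a subform of dimension 3,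
which is isotropic over K by [dependent_ext]. *)
Lemma minimal_no_line e g : minimal iota B -> free2 e -> size e = 3%N ->
  (forall x, x \in e -> span2 (diag_values B) x) -> g != 0 ->
  (forall x, x \in e -> E (x / g)) -> False.
Proof.
move=> [_ _ _ hmin] fe se eB g0 eE.
have [C [sC vC]] := subform_of_values bB aB fe eB.
have dC : bdim C = 3%N by rewrite -size_diag_values vC.
have := hmin C sC; rewrite dC dimB => /(_ isT) aC.
have sK : (gram (bext iota C))^T = gram (bext iota C).
  by case: sC => -[sC _] _; rewrite /= map_trmx sC.
have charK2 : 2%N \in [pchar K] by exact: (rmorph_pchar iota).
move: aC => /(anisotropic_free charK2 sK); rewrite diag_values_ext vC.
by apply: (dependent_ext charF2 anisoQ FQ (s := [::]) g0) => //; rewrite se.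
Qed.

Lemma isotropic_ext (C : bform F) : (gram C)^T = gram C ->
  isotropic (bext iota C) <-> ~ free2 (map iota (diag_values C)).
Proof.
move=> sC; have charK2 : 2%N \in [pchar K] by exact: (rmorph_pchar iota).
have sK : (gram (bext iota C))^T = gram (bext iota C) by rewrite /= map_trmx sC.
rewrite -diag_values_ext; split=> [h /(anisotropic_free charK2 sK)|h]; first exact.
by apply: contrapT => h'; apply/h/(anisotropic_free charK2 sK).
Qed.

(** The form <u, v, uv> is similar to a subform of the anisotropic form rho, so u, v, uv
are free over k. *)
Lemma similar_subform_indep c u v : indep2 [:: a; b; c] ->
  (exists D, subform D (pfister [:: a; b; c]) /\
     similar_forms (diagb [:: u; v; u * v]) D) -> indep2 [:: u; v].
Proof.
move=> ind [D [sD [k k0 simD]]]; apply: free2_indep.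
have bp := bilinear_pfister (indep2_all_nz ind).
have ap : anisotropic (pfister [:: a; b; c]).
  exact: isometric_anisotropic (isometric_pfister _) (diag_mons_anisotropic charF2 ind).
have fD := subform_free bp ap sD; have [[sD' _] _] := sD.
rewrite -[[:: _; _; _]]diag_values_diagb; apply/anisotropic_free => //.
  by rewrite /= tr_diag_mx.
apply: isometric_anisotropic simD _; apply/anisotropic_free => //.
  by rewrite /= linearZ /= sD'.
by rewrite diag_values_scale; apply: free2_scale.
Qed.

(** The values V of B lie in a plane g(E + cE).  Take C = g times the restriction of the
trace form to V / g.  If the invariant of [e2_condition] were a symbol,
[common_subfield] and [pure_line] would give two independent elements of <x, y, z> in
one line hE, and [orth_to_line] three independent elements of V in a line. *)
Lemma minimal_neighbor : minimal iota B -> exists (c : F) (C : bform F),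
    [/\ c != 0, bdim C = 5%N, strong_neighbor C (pfister [:: a; b; c]),
        qisometric (tilde B) (tilde C) & e2_condition c C].
Proof.
move=> minB; have [_ _ iK _] := minB; have sB := bB.1.
have fB : free2 (diag_values B) by apply/anisotropic_free.
have s5 : size (diag_values B) = 5%N by rewrite size_diag_values.
have [d [dV bd ad ex]] := isotropic_chain charF2 anisoQ FQ fB ((isotropic_ext sB).1 iK).
have iab := indep2_Q charF2 anisoQ.
have [|e [fe eB [[se [g g0 eE]]|[se [g [c [g0 eM']]]]]]] := chain_lines charF2 iab fB _ dV bd ad ex.
- by rewrite s5.
- by case: (minimal_no_line minB fe se eB g0 eE).
have gi0 : g^-1 != 0 by rewrite invr_eq0.
pose n := [seq g^-1 * x | x <- diag_values B].
have fn : free2 n by apply: free2_scale.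
have sn : size n = 5%N by rewrite size_map.
have nM' x : x \in n -> adj2 [:: c; a; b] x.
  move=> /mapP[y yB ->]; rewrite mulrC.
  have : span2 e y by apply: (free2_full charF2 fe eB); rewrite ?se ?s5 //; apply: span2_mem.
  move: (y); apply: span2_ind => [|u v hu hv|k u hu|u /eM'//].
  - by rewrite mul0r; apply: adj2_0.
  - by rewrite mulrDl; apply: adj2_D.
  by rewrite -mulrA; apply: adj2_M => //; apply: adj2_sqr.
have nc : ~ E c.
  move=> Ec; suff : (size n <= size (mons [:: a; b]))%N by rewrite sn.
  apply: (free2_size charF2 fn) => x /nM' hx; apply/monsP => //.
  by apply: adj2_sub hx => // y; rewrite inE => /predU1P[->//|]; apply: adj2_mem.
have icab : indep2 [:: c; a; b] by split.
have ind : indep2 [:: a; b; c].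
  apply: indep2_perm icab => //; apply/seq.permP => ? /=; rewrite !addn0.
  by rewrite addnC addnA.
have nM x : x \in n -> adj2 [:: a; b; c] x.
  by move=> /nM'; apply: adj2_subset => // y; rewrite !inE => /or3P[]->; rewrite ?orbT.
have snM := trace_gram_subform charF2 ind fn nM.
have bn : bilinear_form (trace_gram [:: a; b; c] n) by case: snM.
have c0 : c != 0 by apply: indep2_nz icab _; rewrite ?mem_head.
exists c, (bscale g (trace_gram [:: a; b; c] n)); split=> //.
- split; [exact: bilinear_scale|by rewrite /= sn|exists g => //].
  apply: subform_isometric _ (isometric_refl _) snM.
  exact: isometric_scaleK.
- apply: diag_values_qisometric => //; first exact: (bilinear_scale g0 bn).1.
  rewrite diag_values_scale (diag_values_trace_gram charF2 ind nM) -map_comp.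
  by rewrite map_id_in // => x _ /=; rewrite mulrA mulfV // mul1r.
move=> u v /in_F2_adj2 Eu /in_F2_adj2 Ev u0 v0 huv.
have iuv := similar_subform_indep ind huv.
have fullE x : E x -> adj2 [:: u; v] x.
  by apply: (indep2_full charF2 iuv) => // y; rewrite !inE => /orP[]/eqP->.
have Euv x : adj2 [:: u; v] x -> E x.
  by apply: adj2_sub => // y; rewrite !inE => /orP[]/eqP->.
have icuv : indep2 [:: c; u; v] by split=> // /Euv.
have Muv x : adj2 [:: a; b; c] x -> adj2 [:: c; u; v] x.
  apply: adj2_sub => // y; rewrite !inE => /or3P[]/eqP->.
  - by apply/adj2_cons/fullE/adj2_mem => //; rewrite mem_head.
  - by apply/adj2_cons/fullE/adj2_mem; rewrite // !inE eqxx orbT.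
  by apply/adj2_mem/mem_head.
have [|x [y [z [[x0 y0 z0] xyzM nt pt]]]] := orth_triple ind nM; first by rewrite sn.
have t0 : all (fun x => x != 0) [:: x; y; z] by rewrite /= x0 y0 z0.
have ntM w : w \in n ++ [:: x; y; z] -> adj2 [:: a; b; c] w.
  by rewrite mem_cat => /orP[/nM|/xyzM].
have split := trace_gram_split charF2 ind bn ntM t0 nt pt.
have a0 : a != 0 by apply: indep2_nz iab _; rewrite ?mem_head.
have b0 : b != 0 by apply: indep2_nz iab _; rewrite // !inE eqxx orbT.
exists (symb (y * z) (x * z) + symb u v).
  apply: (e2_graph_triple charF2 (alpha := g) a0 b0 c0 g0 x0 y0 z0 u0 v0) => //.
    exact: bilinear_scale.
  apply: isometric_trans (split _) _; first by rewrite sn.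
  apply: isometric_orth; last exact: isometric_refl.
  exact/isometric_sym/isometric_scaleK.
have yz0 : y * z != 0 by rewrite mulf_neq0.
have xz0 : x * z != 0 by rewrite mulf_neq0.
apply: nu2_length2 => // x' y' x'0 y'0 esum.
have fxyz := orth_free ind xyzM t0 pt.
have ipq := indep2_slots z0 fxyz.
have My : adj2 [:: c; u; v] y by apply/Muv/xyzM; rewrite !inE eqxx orbT.
have Mx : adj2 [:: c; u; v] x by apply/Muv/xyzM; rewrite !inE eqxx.
have Mz : adj2 [:: c; u; v] z by apply/Muv/xyzM; rewrite !inE eqxx !orbT.
have [r [Er pqr kr]] : exists q, [/\ adj2 [:: u; v] q, adj2 [:: y * z; x * z] q & ~ adj2 [::] q].
  apply: (common_subfield charF2 icuv _ _ ipq x'0 y'0); try exact: adj2_M.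
  by rewrite addrC.
have [h [h0 sh shr]] := pure_line x0 y0 z0 ipq pqr.
have Mspan w : span2 [:: x; y; z] w -> adj2 [:: a; b; c] w.
  move=> hw; have M1 := adj2_1 [:: a; b; c].
  by have [] := orth_span1 (t := [:: x; y; z]) ind (adj2_0 _) _ hw => // w' hw'; split; [apply: xyzM|rewrite mul0r lam0].
have r0 : r != 0 by apply: contraPneq kr => -> /(_ (adj2_0 _)).
have f1r : free2 [:: 1; r].
  apply/free2_consP => //; split.
    move=> /(span2_consP charF2)[k [_ [/span2_nil -> e1]]]; apply: kr; exists k^-1.
    have k0 : k != 0.
      by apply: contra_eq_neq e1 => ->; rewrite expr0n mulr0 addr0 oner_neq0.
    have k20 : k ^+ 2 != 0 by rewrite expf_neq0.
    by apply: (mulIf k20); rewrite -exprMn mulVf // expr1n e1 addr0.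
  apply/free2_consP => //; split; last exact: free2_nil.
  by move=> /span2_nil e0; rewrite e0 eqxx in r0.
have [||e3 [fe3 se3 he3]] := orth_to_line charF2 ind (Mspan _ sh) h0 nM fn f1r.
- move=> w; rewrite !inE => /orP[]/eqP->; [exact: adj2_1|exact: Euv].
- move=> w w' wn; rewrite !inE => /orP[]/eqP->; rewrite ?mulr1; exact: orth_span ntM nt wn _.
apply: (@minimal_no_line [seq g * w | w <- e3] (g * (h * c)) minB).
- exact: free2_scale.
- by rewrite size_map se3 sn.
- move=> _ /mapP[w /he3[wn _] ->].
  by move: wn => /span2_scale-/(_ charF2 gi0); rewrite invrK mulrC.
- by rewrite !mulf_neq0.
move=> _ /mapP[w /he3[_ wE] ->]; move: wE; congr (adj2 _ _).
by field; rewrite c0 h0 g0.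
Qed.

(** Put p = h c y1 and r = y2 / y1, made pure by adding the square of its trace.  Then
p, pr and a third element q form an orthogonal basis of the complement of C.  Its symbol
is dlog(r) dlog(pq), and dlog a dlog b = dlog r dlog f by [symbol_slot]; so the
invariant for u = a, v = b is the single symbol dlog(r) dlog(pqf). *)
Lemma orth_line_contra c (C : bform F) g n h y1 y2 : indep2 [:: a; b; c] ->
  bilinear_form C -> bdim C = 5%N -> g != 0 ->
  size n = 5%N -> (forall x, x \in n -> adj2 [:: a; b; c] x) ->
  isometric (bscale g C) (trace_gram [:: a; b; c] n) -> e2_condition c C ->
  adj2 [:: a; b; c] h -> h != 0 -> free2 [:: y1; y2] ->
  (forall y, y \in [:: y1; y2] -> E y /\
     forall x, x \in n -> lam [:: a; b; c] (x * (h * c * y)) = 0) -> False.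
Proof.
move=> ind bC C5 g0 sn nM iC cond Mh h0 fy hy.
have [a0 b0 c0] : [/\ a != 0, b != 0 & c != 0].
  by split; apply: indep2_nz ind _; rewrite !inE eqxx ?orbT.
have [Ey1 ny1] := hy y1 (mem_head _ _).
have [Ey2 ny2] : E y2 /\ _ := hy y2 (mem_last y1 [:: y2]).
have [y1s /(free2_consP charF2)[y2s _]] := (free2_consP charF2 _ _).1 fy.
have y10 : y1 != 0 by apply: contraPneq y1s => -> /(_ (span2_0 _)).
have y20 : y2 != 0 by apply: contraPneq y2s => -> /(_ (span2_0 _)).
have [s0 [s1 [s2 [s3 er]]]] : exists s0 s1 s2 s3 : F,
    y2 / y1 = (s0 ^+ 2 + b * s1 ^+ 2) + a * (s2 ^+ 2 + b * s3 ^+ 2).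
  by apply: E_coord; apply: adj2_div.
pose r := s2 ^+ 2 * a + s1 ^+ 2 * b + s3 ^+ 2 * (a * b).
have er' : r = y2 / y1 + s0 ^+ 2 by rewrite er /r; apply: (add2_eq charF2); ring2 charF2.
have r0 : r != 0.
  apply/eqP => r0; apply: y1s.
  have e2 : y2 = s0 ^+ 2 * y1.
    by apply: (mulIf (x := y1^-1)); rewrite ?invr_eq0 // mulfK //; apply: (add2_eq charF2); rewrite -er'.
  have s00 : s0 != 0 by apply: contraNneq y20 => s00; rewrite e2 s00 expr0n mul0r.
  have -> : y1 = s0^-1 ^+ 2 * y2 by rewrite e2; field.
  by apply/span2_Z/span2_mem/mem_head.
have Er : E r.
  rewrite er'; apply: adj2_D => //; first exact: adj2_div.
  exact: adj2_sqr.
have lr : lam [:: a; b; c] r = 0.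
  rewrite -(lam_E charF2 ind 0 s1 s2 s3); congr (lam _ _); rewrite /r; ring.
pose p := h * c * y1; have p0 : p != 0 by rewrite !mulf_neq0.
have Mp : adj2 [:: a; b; c] p.
  by apply: adj2_M => //; [apply: adj2_M => //; exact: last_adj|exact: line_adj].
have Mr : adj2 [:: a; b; c] r by apply: line_adj.
have Mpr : adj2 [:: a; b; c] (p * r) by apply: adj2_M.
have nMi x y : x \in n -> E y -> adj2 [:: a; b; c] (x * (h * c * y)).
  move=> xn Ey; apply: adj2_M => //; first exact: nM.
  by apply: adj2_M => //; [apply: adj2_M => //; exact: last_adj|exact: line_adj].
have np x : x \in n -> lam [:: a; b; c] (x * p) = 0 by apply: ny1.
have npr x : x \in n -> lam [:: a; b; c] (x * (p * r)) = 0.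
  move=> xn; have -> : x * (p * r) = x * (h * c * y2) + s0 ^+ 2 * (x * (h * c * y1)).
    by rewrite er' /p; field.
  rewrite lamD // ?lamZ // ?ny2 ?ny1 ?mulr0 ?addr0 //; try exact: nMi.
  by apply: adj2_M => //; [exact: adj2_sqr|exact: nMi].
have ppr : lam [:: a; b; c] (p * (p * r)) = 0.
  by rewrite mulrA -expr2 lamZ // lr mulr0.
have nM' x : x \in [:: p, p * r & n] -> adj2 [:: a; b; c] x.
  by rewrite !inE => /or3P[/eqP->|/eqP->|/nM].
have [|q [q0 Mq hq]] := exists_orth charF2 ind nM'; first by rewrite /= sn.
have pr0 : p * r != 0 by rewrite mulf_neq0.
have split : isometric (pfister [:: a; b; c]) (orth (bscale g C) (diagb [:: p; p * r; q])).
  apply: isometric_trans (isometric_orth (isometric_sym iC) (isometric_refl _)).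
  apply: trace_gram_split => //.
  - exact: bilinear_isometric (isometric_sym iC) (bilinear_scale g0 bC).
  - by move=> x; rewrite mem_cat => /orP[/nM//|]; rewrite !inE => /or3P[]/eqP->.
  - by rewrite /= p0 pr0 q0.
  - move=> x y xn; rewrite !inE => /or3P[]/eqP->; [exact: np|exact: npr|].
    by apply: hq; rewrite !inE xn !orbT.
  - by rewrite /= ppr eqxx !hq ?inE ?eqxx ?orbT.
  by rewrite sn.
have aF2 : in_F2 a b a by apply: subfield_in; right; left.
have bF2 : in_F2 a b b by apply: subfield_in; right; right.
have [|w gw [_ hw]] := cond a b aF2 bF2 a0 b0.
  have fab := free2_indep_mons (indep_ab charF2 ind).
  have abM x : x \in [:: a; b; a * b] -> adj2 [:: a; b; c] x.
    have Ma : E a by apply/adj2_mem/mem_head.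
    have Mb : E b by apply/adj2_mem; rewrite // !inE eqxx orbT.
    by rewrite !inE => /or3P[]/eqP->; apply: line_adj => //; apply: adj2_M.
  have sab := trace_gram_subform charF2 ind fab abM.
  exists (trace_gram [:: a; b; c] [:: a; b; a * b]); split=> //.
  exists 1; first exact: oner_neq0.
  apply: isometric_sym; rewrite /bscale scale1r.
  apply: (trace_gram_diag ind abM); rewrite /= !andbT -andbA.
  have l0 (s1' s2' s3' : F) := lam_E charF2 ind 0 s1' s2' s3'.
  apply/and3P; split; apply/eqP.
  - by rewrite -(l0 0 0 1); congr (lam _ _); ring.
  - by rewrite -(l0 a 0 0); congr (lam _ _); ring.
  by rewrite -(l0 0 b 0); congr (lam _ _); ring.
have bX : bilinear_form (orth (orth C (diagb [:: \det (gram C)])) (pfister [:: a; b])).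
  apply: bilinear_orth; last by apply: bilinear_pfister; rewrite /= a0 b0.
  apply: bilinear_orth => //; apply: bilinear_diagb.
  by rewrite /= andbT -unitfE -unitmxE; case: bC.
have gw' := e2_graph_triple charF2 a0 b0 c0 g0 p0 pr0 q0 a0 b0 bC C5 split.
have ew := e2_graph_uniq charF2 bX gw gw'.
have iba : indep2 [:: b; a].
  by apply: indep2_perm (indep_ab charF2 ind) => //; apply/seq.permP => ? /=; rewrite !addn0 addnC.
have [f f0 ef] := symbol_slot charF2 iba r0.
have pq0 : p * q != 0 by rewrite mulf_neq0.
suff /(hw _ _) : symbol_sum [:: (r, p * q * f)] = w by rewrite /= r0 !mulf_neq0 // => /(_ isT).
rewrite ew /symbol_sum big_seq1 ef -/r /= (_ : p * r * q = r * (p * q)); last by ring.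
by rewrite (dlogM r0 pq0) wedgeDl // wedge_alt // addr0 (dlogM pq0 f0) wedgeDr.
Qed.

(** B and C have the same values, up to a factor in a plane g(E + cE).  A proper subform
of B that is isotropic over K has no room for five independent elements, so
[chain_lines] gives three in a line, and [line_to_orth] two independent elements of a
line that are orthogonal to C. *)
Lemma neighbor_minimal c (C : bform F) : c != 0 -> bdim C = 5%N ->
  strong_neighbor C (pfister [:: a; b; c]) -> qisometric (tilde B) (tilde C) ->
  e2_condition c C -> minimal iota B.
Proof.
move=> c0 C5 [bC _ [g g0 sC]] [P /andP[fP _] BC] cond.
have sB := bB.1; have sCs := bC.1.
have fB : free2 (diag_values B) by apply/anisotropic_free.
have iab := indep2_Q charF2 anisoQ.
have a0 : a != 0 by apply: indep2_nz iab _; rewrite ?mem_head.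
have b0 : b != 0 by apply: indep2_nz iab _; rewrite // !inE eqxx orbT.
have gi0 : g^-1 != 0 by rewrite invr_eq0.
pose n := diag_values (bscale g C).
have nE : n = [seq g * x | x <- diag_values C] by apply: diag_values_scale.
have sn : size n = 5%N by rewrite size_diag_values.
have BCspan x : span2 (diag_values B) x -> span2 (diag_values C) x.
  by move=> /(span2_tilde charF2 _ sB)[v ->]; rewrite BC; apply/span2_tilde => //; eexists.
have fC : free2 (diag_values C).
  apply: free2_spanning fB _ _; last by rewrite !size_diag_values C5 dimB.
  by move=> y yB; apply/BCspan/span2_mem.
have fn : free2 n by rewrite nE; apply: free2_scale.
have sD : subform (bscale g C) (diagb (mons [:: a; b; c])).
  exact: subform_isometric (isometric_refl _) (isometric_pfister _) sC.
have nM x : x \in n -> adj2 [:: a; b; c] x by apply: subform_mons_adj.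
have nc : ~ E c.
  move=> Ec; suff : (size n <= size (mons [:: a; b]))%N by rewrite sn.
  apply: (free2_size charF2 fn) => x /nM hx; apply/monsP => //.
  apply: adj2_sub hx => // y; rewrite !inE => /or3P[]/eqP-> //;
  by apply: adj2_mem; rewrite // !inE eqxx ?orbT.
have icab : indep2 [:: c; a; b] by split.
have ind : indep2 [:: a; b; c].
  apply: indep2_perm icab => //; apply/seq.permP => ? /=; rewrite !addn0.
  by rewrite addnC addnA.
have bn : bilinear_form (trace_gram [:: a; b; c] n).
  by case: (trace_gram_subform charF2 ind fn nM).
have iC := subform_trace_gram ind sD.
have isoK x : x \in diag_values B -> adj2 [:: c; a; b] (x / g^-1).
  move=> xB; have : span2 (diag_values C) x by apply/BCspan/span2_mem.
  move: x {xB}; apply: span2_ind => [|x y hx hy|k x hx|x xC].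
  - by rewrite mul0r; apply: adj2_0.
  - by rewrite mulrDl; apply: adj2_D.
  - by rewrite -mulrA; apply: adj2_M => //; apply: adj2_sqr.
  rewrite invrK mulrC; apply: (adj2_subset charF2 (s := [:: a; b; c])).
    by move=> y; rewrite !inE => /or3P[]->; rewrite ?orbT.
  by apply/nM; rewrite nE; apply/map_f.
split=> //.
  apply/(isotropic_ext sB); apply: (dependent_ext charF2 anisoQ FQ (s := [:: c]) gi0) => //.
  by rewrite size_diag_values dimB.
move=> C0 sC0 dC0 /isotropic_ext nfK.
have fC0 := subform_free bB aB sC0; have [[sC0' _] _] := sC0.
have [d [dV bd ad ex]] := isotropic_chain charF2 anisoQ FQ fC0 (nfK sC0').
have s4 : (size (diag_values C0) < 5)%N by rewrite size_diag_values -dimB.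
have [|e [fe eB [[se [h h0 eE]]|[se _]]]] := chain_lines charF2 iab fC0 _ dV bd ad ex.
- exact: ltnW.
- have {}eB x : x \in e -> span2 (diag_values C) x.
    move=> /eB xC0; apply: BCspan; apply: (span2_sub charF2 _ xC0) => y; exact: subform_values.
  pose e' := [seq g * x | x <- e]; have fe' : free2 e' by apply: free2_scale.
  have en x : x \in e' -> span2 n x.
    move=> /mapP[y ye ->]; rewrite nE; apply/span2_scale => //.
    by rewrite mulrAC mulfV // mul1r; apply: eB.
  have eE' x : x \in e' -> E (x / (g * h)).
    move=> /mapP[y /eE yE ->]; move: yE; congr (adj2 _ _).
    by field; rewrite g0 h0.
  have gh0 : g * h != 0 by rewrite mulf_neq0.
  have Mgh : adj2 [:: a; b; c] (g * h).
    have [x xe x0] : exists2 x, x \in e' & x != 0.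
      have : size e' = 3%N by rewrite size_map.
      case: (e') (fe') => // x l /(free2_consP charF2)[xl _] _.
      exists x; first exact: mem_head.
      by apply: contraPneq xl => -> /(_ (span2_0 _)).
    have -> : g * h = x / (x / (g * h)) by field; rewrite g0 h0 x0.
    apply: adj2_div => //; last exact/(line_adj charF2)/eE'.
    move: (x) (en _ xe) => z; elim/span2_ind: z / => // [|z z' hz hz'|k z hz].
    - exact: adj2_0.
    - exact: adj2_D.
    by apply: adj2_M => //; apply: adj2_sqr.
  have [t [ft st ht]] := line_to_orth charF2 ind Mgh gh0 nM fe' (fun x xe => conj (en x xe) (eE' x xe)).
  move: st ft ht; rewrite sn size_map se; case: t => [|y1 [|y2 [|//]]] // _ ft ht.
  exact: (orth_line_contra ind bC C5 g0 sn nM iC cond Mgh gh0 ft ht).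
by have := free2_size charF2 fe eB; rewrite se leqNgt s4.
Qed.

End Equivalence.

End Conclusion.

Theorem theorem5 (F : fieldType) (charF2 : 2%N \in [pchar F])
    (B : bform F) (bilB : bilinear_form B) (anisoB : anisotropic B)
    (dimB : bdim B = 5%N)
    (a b : F) (anisoQ : qanisotropic (totally_singular [:: 1; a; b]))
    (K : fieldType) (iota : {rmorphism F -> K})
    (FQ : is_function_field a b iota) :
  minimal iota B <->
  exists (c : F) (C : bform F),
    [/\ c != 0, bdim C = 5%N,
        strong_neighbor C (pfister [:: a; b; c]),
        qisometric (tilde B) (tilde C)
      & forall u v : F, in_F2 a b u -> in_F2 a b v -> u != 0 -> v != 0 ->
          (exists D, subform D (pfister [:: a; b; c]) /\
                     similar_forms (diagb [:: u; v; u * v]) D) ->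
          e2_length
            (orth (orth C (diagb [:: \det (gram C)])) (pfister [:: u; v])) 2].
Proof.
split=> [minB|[c [C [c0 C5 nb iso cond]]]].
  exact: (minimal_neighbor charF2 anisoQ FQ bilB anisoB dimB minB).
exact: (neighbor_minimal charF2 anisoQ FQ bilB anisoB dimB c0 C5 nb iso cond).
Qed.
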